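(* Let $q:\mathbb{R}\to\mathbb{C}$ be $1$-periodic, $q\in L_1[0,1]$, Fourier coefficients $q_n$ (with $q_0=0$). Let $p\ge0$ be an integer, $q\in W_1^p[0,1]$, $s$ an integer with $0\le s\le p$ and $q^{(k)}(0)=q^{(k)}(1)$ for $k=0,\dots,s-1$. Suppose that for some $c>0$, $\varepsilon>0$ and all large $n$: $q_{2n}\sim q_{-2n}$, $|q_{2n}|>cn^{-s-1}$, and at least one of $\operatorname{Re}(q_{2n}q_{-2n})\ge0$ or $|\operatorname{Im}(q_{2n}q_{-2n})|\ge\varepsilon|q_{2n}q_{-2n}|$ holds. Then for all sufficiently large $n$ and all $t\in[0,\rho]$ the eigenvalues $\lambda_{n,1}(t),\lambda_{n,2}(t)$ of $L_t(q)$ are simple, and with a suitable numbering, for $j=1,2$, $\lambda_{n,j}(t)=(2\pi n+t)^2+\tfrac12\big(A(\lambda_{n,j}(t),t)+A'(\lambda_{n,j}(t),t)\big)-4\pi nt+(-1)^j\sqrt{D(\lambda_{n,j}(t),t)},$ where the square root has positive real part.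
   Context: $q_n=\int_0^1q(x)e^{-i2\pi nx}dx$. $L_t(q)$ is the operator in $L_2[0,1]$ generated by $-y''+q(x)y$ with $y(1)=e^{it}y(0)$, $y'(1)=e^{it}y'(0)$. $W_1^p[0,1]$: derivatives up to order $p$ in $L_1$. $a_n\sim b_n$: $a_n=O(b_n)$ and $b_n=O(a_n)$. $\rho\in(0,\pi/2)$ fixed and sufficiently small; $D(n,t,\rho)=\{\lambda:|\lambda-(2\pi n+t)^2|<15\pi n\rho\}$; for large $n$, $t\in[0,\rho]$, $\lambda_{n,1}(t),\lambda_{n,2}(t)$ are the two eigenvalues (with multiplicity) of $L_t(q)$ in $D(n,t,\rho)$. For $\lambda\in D(n,t,\rho)$, $k\ge1$: $a_k(\lambda,t)=\sum\frac{q_{n_1}\cdots q_{n_k}q_{-n_1-\dots-n_k}}{\prod_{r=1}^k[\lambda-(2\pi(n-n_1-\dots-n_r)+t)^2]}$, $b_k$ the same with $q_{-n_1-\dots-n_k}$ replaced by $q_{2n-n_1-\dots-n_k}$, summed over $n_r\ne0$, $n_1+\dots+n_r\notin\{0,2n\}$ ($r=1,\dots,k$); $a'_k(\lambda,t)=\sum\frac{q_{n_1}\cdots q_{n_k}q_{-n_1-\dots-n_k}}{\prod_{r=1}^k[\lambda-(2\pi(n+n_1+\dots+n_r)-t)^2]}$, $b'_k$ the same with $q_{-2n-n_1-\dots-n_k}$, summed over $n_r\ne0$, $n_1+\dots+n_r\notin\{0,-2n\}$. $A=\sum a_k$, $B=\sum b_k$, $A'=\sum a'_k$, $B'=\sum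 b'_k$, $C=\frac12(A-A')$, and $D(\lambda,t)=(4\pi nt)^2+q_{2n}q_{-2n}+8\pi ntC(\lambda,t)+C^2(\lambda,t)+q_{2n}B'(\lambda,t)+q_{-2n}B(\lambda,t)+B(\lambda,t)B'(\lambda,t).$ *)

(* Defs.v *)
From mathcomp Require Import all_boot all_order all_algebra.
From mathcomp Require Import all_classical all_reals all_analysis.
From mathcomp Require Export complex.
From Stdlib Require Import ClassicalEpsilon.
Import Order.TTheory GRing.Theory Num.Theory.
Import numFieldNormedType.Exports.

Set Implicit Arguments.
Unset Strict Implicit.
Unset Printing Implicit Defensive.

Local Open Scope classical_set_scope.
Local Open Scope ring_scope.

Section Defs.
Variable R : realType.
Local Notation C := (R[i]).
Local Notation mu := (@lebesgue_measure R).

Definition RC (x : R) : C := complex.Complex x 0.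
Definition cabs (z : C) : R :=
  Num.sqrt (complex.Re z ^+ 2 + complex.Im z ^+ 2).
Definition cexpi (th : R) : C := complex.Complex (cos th) (sin th).

Definition cintegrable (A : set R) (f : R -> C) : Prop :=
  mu.-integrable A (EFin \o (fun x => complex.Re (f x))) /\
  mu.-integrable A (EFin \o (fun x => complex.Im (f x))).
Definition cint (A : set R) (f : R -> C) : C :=
  complex.Complex (Rintegral mu A (fun x => complex.Re (f x)))
                  (Rintegral mu A (fun x => complex.Im (f x))).
Definition cL2 (A : set R) (f : R -> C) : Prop :=
  measurable_fun A (fun x => complex.Re (f x)) /\
  measurable_fun A (fun x => complex.Im (f x)) /\
  mu.-integrable A
    (EFin \o (fun x => complex.Re (f x) ^+ 2 + complex.Im (f x) ^+ 2)).

Definition fourier (q : R -> C) (n : int) : C :=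
  cint `[0, 1] (fun x => q x * cexpi (- (2 * pi * n%:~R * x))).

(* y(x) = y(0) + int_0^x g  for all x in [0,1]  (y absolutely continuous on
   [0,1] with derivative g) *)
Definition cprim (g y : R -> C) : Prop :=
  forall x : R, 0 <= x <= 1 -> y x = y 0 + cint `[0, x] g.

(* q in W_1^p[0,1]: g 0 is (a representative of) q, g k = q^{(k)} for k <= p *)
Definition W1p (q : R -> C) (p : nat) (g : nat -> R -> C) : Prop :=
  {ae mu, forall x, 0 <= x <= 1 -> g 0%N x = q x} /\
  (forall k, (k <= p)%N -> cintegrable `[0, 1] (g k)) /\
  (forall k, (k < p)%N -> cprim (g k.+1) (g k)).

(* The operator L_t(q): (Lrel q t y f) means y is in the domain of L_t(q)
   and L_t(q) y = f in L_2[0,1]. *)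
Definition Lrel (q : R -> C) (t : R) (y f : R -> C) : Prop :=
  exists y1 y2 : R -> C,
    cintegrable `[0, 1] y1 /\ cintegrable `[0, 1] y2 /\
    cprim y1 y /\ cprim y2 y1 /\ cL2 `[0, 1] f /\
    {ae mu, forall x, 0 <= x <= 1 -> f x = - y2 x + q x * y x} /\
    y 1 = cexpi t * y 0 /\ y1 1 = cexpi t * y1 0.

Definition is_eigenvalue (q : R -> C) (t : R) (lam : C) : Prop :=
  exists y : R -> C, Lrel q t y (fun x => lam * y x) /\
    exists x : R, 0 <= x <= 1 /\ y x <> 0.

(* root vector: y in ker (L_t(q) - lam)^m for some m (as an element of
   L_2[0,1], i.e. compared on [0,1]) *)
Definition rootvec (q : R -> C) (t : R) (lam : C) (y : R -> C) : Prop :=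
  exists (m : nat) (u : nat -> R -> C),
    (forall x : R, 0 <= x <= 1 -> u 0%N x = 0) /\
    (forall k, (k < m)%N ->
       Lrel q t (u k.+1) (fun x => lam * u k.+1 x + u k x)) /\
    (forall x : R, 0 <= x <= 1 -> y x = u m x).

Definition indep_on01 (m : nat) (ys : 'I_m -> R -> C) : Prop :=
  forall c : 'I_m -> C,
    (forall x : R, 0 <= x <= 1 -> \sum_(i < m) c i * ys i x = 0) ->
    forall i, c i = 0.

Definition alg_mult (q : R -> C) (t : R) (lam : C) (m : nat) : Prop :=
  (exists ys : 'I_m -> R -> C,
      (forall i, rootvec q t lam (ys i)) /\ indep_on01 ys) /\
  ~ (exists ys : 'I_m.+1 -> R -> C,
      (forall i, rootvec q t lam (ys i)) /\ indep_on01 ys).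

Definition ccvg (u : nat -> C) (l : C) : Prop :=
  forall e : R, 0 < e -> exists N : nat, forall k, (N <= k)%N ->
    cabs (u k - l) < e.
Definition clim (u : nat -> C) : C :=
  epsilon (inhabits (0 : C)) (fun l => ccvg u l).

Definition zksum (k : nat) (F : {ffun 'I_k -> int} -> C) : C :=
  clim (fun N : nat =>
    \sum_(f : {ffun 'I_k -> 'I_(N + N).+1})
       F [ffun i => (nat_of_ord (f i))%:Z - N%:Z]).

Definition psum (k : nat) (v : {ffun 'I_k -> int}) (r : nat) : int :=
  \sum_(i < k | (i < r)%N) v i.

(* generic term of a_k, b_k, a'_k, b'_k:
   ok  : admissibility of the partial sums,
   cen : centre of the denominators as a function of the partial sum,
   lst : index of the last Fourier coefficient as a function of n_1+..+n_k *)
Definition gterm (q : R -> C) (lam : C) (ok : int -> bool) (cen : int -> R)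
    (lst : int -> int) (k : nat) (v : {ffun 'I_k -> int}) : C :=
  if [forall i : 'I_k, v i != 0] && [forall r : 'I_k, ok (psum v r.+1)] then
    (\prod_(i < k) fourier q (v i)) * fourier q (lst (psum v k)) /
    \prod_(r < k) (lam - RC (cen (psum v r.+1) ^+ 2))
  else 0.

Definition kseries (F : nat -> C) : C :=
  clim (fun K : nat => \sum_(1 <= k < K.+1) F k).

Definition okp (n : nat) (s : int) : bool := (s != 0) && (s != 2 * n%:Z).
Definition okm (n : nat) (s : int) : bool := (s != 0) && (s != - (2 * n%:Z)).
Definition cenp (n : nat) (t : R) (s : int) : R := 2 * pi * (n%:Z - s)%:~R + t.
Definition cenm (n : nat) (t : R) (s : int) : R := 2 * pi * (n%:Z + s)%:~R - t.

Definition a_k q n (lam : C) t k :=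
  zksum (@gterm q lam (okp n) (cenp n t) (fun S => - S) k).
Definition b_k q n (lam : C) t k :=
  zksum (@gterm q lam (okp n) (cenp n t) (fun S => 2 * n%:Z - S) k).
Definition a'_k q n (lam : C) t k :=
  zksum (@gterm q lam (okm n) (cenm n t) (fun S => - S) k).
Definition b'_k q n (lam : C) t k :=
  zksum (@gterm q lam (okm n) (cenm n t) (fun S => - (2 * n%:Z) - S) k).

Definition Aser q n lam t := kseries (a_k q n lam t).
Definition Bser q n lam t := kseries (b_k q n lam t).
Definition A'ser q n lam t := kseries (a'_k q n lam t).
Definition B'ser q n lam t := kseries (b'_k q n lam t).
Definition Cser q n lam t := (Aser q n lam t - A'ser q n lam t) / 2.

Definition Dfun (q : R -> C) (n : nat) (lam : C) (t : R) : C :=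
  let q2n := fourier q (2 * n%:Z) in
  let qm2n := fourier q (- (2 * n%:Z)) in
  RC ((4 * pi * n%:R * t) ^+ 2) + q2n * qm2n
  + RC (8 * pi * n%:R * t) * Cser q n lam t + Cser q n lam t ^+ 2
  + q2n * B'ser q n lam t + qm2n * Bser q n lam t
  + Bser q n lam t * B'ser q n lam t.

Definition inD (n : nat) (t rho : R) (lam : C) : Prop :=
  cabs (lam - RC ((2 * pi * n%:R + t) ^+ 2)) < 15 * pi * n%:R * rho.

End Defs.

(* Main.v *)
Require Import Defs.
From mathcomp Require Import all_boot all_order all_algebra.
From mathcomp Require Import all_classical all_reals all_analysis.
From mathcomp Require Import measurable_realfun complex ring lra zify.
Import Order.TTheory GRing.Theory Num.Theory.
Import numFieldNormedType.Exports.

Set Implicit Arguments.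
Unset Strict Implicit.
Unset Printing Implicit Defensive.

Local Open Scope classical_set_scope.
Local Open Scope ring_scope.

(** In Fourier coefficients [u m] of [y] with respect to [e^{i (2 pi m + t) x}], the equation
    [L_t(q) y = lam y] reads [(lam - (2 pi m + t)^2) u m = sum_k q_{m-k} u k].  For [lam] in
    [D(n,t,rho)] every row with [m <> n, -n] has a large denominator and can be eliminated by a
    Neumann series, whose terms are exactly the series A, B, A', B'.  This leaves a 2x2 system
    for [(u n, u (-n))], with diagonal [lam - (2 pi n + t)^2 - A], [lam - (2 pi n - t)^2 - A'] and
    off-diagonal entries [q_{2n} + B], [q_{-2n} + B']; its determinant vanishes iff
    [lam = F_+(lam)] or [lam = F_-(lam)], the two equations of the theorem.

    Since [B], [B'] are [o(n^{-s-1})] and [C = O(t/n)], [D] is a small perturbation of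
    [(4 pi n t)^2 + q_{2n} q_{-2n}], which the sector hypothesis keeps away from the negative
    axis; hence [sqrt D] has a Lipschitz branch with positive real part, and [F_+], [F_-] are
    contractions of the disc, with one fixed point each.  A Jordan chain at such a point would
    force the derivative of the determinant, which is about [2 sqrt D], to be negligible; so both
    eigenvalues are simple. *)

(** With [q] merely in L1 the coefficients q_j need not be summable. What is summable is u m =
    O(m^-2), because y'' is integrable; hence y is a uniform limit of its Fourier series on (0,1),
    and multiplication by [q] becomes a convolution. The critical estimate is B, B' = o(n^(-s-1)).
    The weights sum to about log n / n. Terms of order two and more carry the square of this, which
    is o(1/n); but in the first-order term absolute values lose the logarithm when [s = 0]. There
    the denominators are replaced by 4 pi^2 (n^2 - l^2), which cancel against q_j = 2 pi i j Q_j for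
    a primitive Q of [q]. What is left is a coefficient of Q^2, whose derivative 2 q Q is
    integrable, so the Riemann-Lebesgue lemma applies. Uniformity down to t = 0 requires C to be
    small relative to 4 pi n t: A and A' coincide for weights even in m, and evenness fails only by
    a term proportional to t. All bounds on sqrt D are relative to h = sqrt((4 pi n t)^2 + |q_{2n}
    q_{-2n}|), which cancels from the contraction factor. *)

Section ComplexBasics.
Variable R : realType.
Local Notation C := (R[i]).
Implicit Types (x y z : C) (a b : R).

Lemma cabsE z : cabs z = ComplexField.Normc.normc z.
Proof. by case: z. Qed.

Lemma cabs_ge0 z : 0 <= cabs z. Proof. exact: sqrtr_ge0. Qed.
Lemma cabs0 : cabs (0 : C) = 0.
Proof. by rewrite /cabs /= expr0n /= addr0 sqrtr0. Qed.
Lemma cabs1 : cabs (1 : C) = 1.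
Proof. by rewrite /cabs /= expr0n /= addr0 expr1n sqrtr1. Qed.
Lemma cabsM x y : cabs (x * y) = cabs x * cabs y.
Proof. by rewrite !cabsE ComplexField.Normc.normcM. Qed.
Lemma cabsV x : cabs x^-1 = (cabs x)^-1.
Proof. by rewrite !cabsE ComplexField.Normc.normcV. Qed.
Lemma cabsX x n : cabs (x ^+ n) = cabs x ^+ n.
Proof. by elim: n => [|n IH]; rewrite ?expr0 ?cabs1 // !exprS cabsM IH. Qed.
Lemma cabsN x : cabs (- x) = cabs x.
Proof. by rewrite !cabsE normcN. Qed.
Lemma cabsD x y : cabs (x + y) <= cabs x + cabs y.
Proof. by rewrite !cabsE le_normcD. Qed.
Lemma cabsB x y : cabs (x - y) <= cabs x + cabs y.
Proof. by rewrite -(cabsN y) cabsD. Qed.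
Lemma cabs_eq0 x : cabs x = 0 -> x = 0.
Proof. by rewrite cabsE => /ComplexField.Normc.eq0_normc. Qed.
Lemma cabs_gt0 x : x != 0 -> 0 < cabs x.
Proof.
by move=> x0; rewrite lt_neqAle cabs_ge0 andbT eq_sym; apply: contra x0 => /eqP/cabs_eq0/eqP.
Qed.
Lemma cabs_subC x y : cabs (x - y) = cabs (y - x).
Proof. by rewrite -cabsN opprB. Qed.
Lemma cabs_tri x y z : cabs (x - z) <= cabs (x - y) + cabs (y - z).
Proof. by apply: le_trans (cabsD _ _); rewrite addrA subrK. Qed.
Lemma cabs_lb x y : cabs x - cabs y <= cabs (x - y).
Proof. by rewrite lerBlDr; apply: le_trans (cabsD _ _); rewrite subrK. Qed.
Lemma cabs_sum (I : Type) (r : seq I) (P : pred I) (F : I -> C) :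
  cabs (\sum_(i <- r | P i) F i) <= \sum_(i <- r | P i) cabs (F i).
Proof.
elim/big_ind2 : _ => [|x1 y1 x2 y2 h1 h2|//]; first by rewrite cabs0.
exact: le_trans (cabsD _ _) (lerD h1 h2).
Qed.
Lemma cabs_RC a : cabs (RC a : C) = `|a|.
Proof. by rewrite /cabs /= expr0n /= addr0 sqrtr_sqr. Qed.
Lemma cabs_sqr z : cabs z ^+ 2 = complex.Re z ^+ 2 + complex.Im z ^+ 2.
Proof. by rewrite sqr_sqrtr // addr_ge0 ?sqr_ge0. Qed.
Lemma Re_le_cabs z : `|complex.Re z| <= cabs z.
Proof. by rewrite -sqrtr_sqr ler_sqrt ?lerDl ?sqr_ge0 // addr_ge0 ?sqr_ge0. Qed.
Lemma Im_le_cabs z : `|complex.Im z| <= cabs z.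
Proof. by rewrite -sqrtr_sqr ler_sqrt ?lerDr ?sqr_ge0 // addr_ge0 ?sqr_ge0. Qed.
Lemma cabs_le_ReIm z : cabs z <= `|complex.Re z| + `|complex.Im z|.
Proof.
rewrite -ler_sqr ?nnegrE ?cabs_ge0 ?addr_ge0 // cabs_sqr sqrrD.
rewrite -addrA (addrC (_ *+ 2)) addrA !real_normK ?num_real // lerDl.
by rewrite mulrn_wge0 // mulr_ge0.
Qed.
Lemma cabs_small x : (forall e : R, 0 < e -> cabs x <= e) -> x = 0.
Proof.
move=> h; apply: cabs_eq0; apply/eqP; rewrite eq_le cabs_ge0 andbT leNgt; apply/negP => x0.
by have := h (cabs x / 2) ltac:(lra); lra.
Qed.

Lemma RCD a b : RC (a + b) = RC a + RC b :> C. Proof. exact: (rmorphD (real_complex R)). Qed.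
Lemma RCB a b : RC (a - b) = RC a - RC b :> C. Proof. exact: (rmorphB (real_complex R)). Qed.
Lemma RCN a : RC (- a) = - RC a :> C. Proof. exact: (rmorphN (real_complex R)). Qed.
Lemma RCM a b : RC (a * b) = RC a * RC b :> C. Proof. exact: (rmorphM (real_complex R)). Qed.
Lemma RCV a : RC a^-1 = (RC a)^-1 :> C. Proof. exact: (fmorphV (real_complex R)). Qed.
Lemma RCX a n : RC (a ^+ n) = RC a ^+ n :> C. Proof. exact: (rmorphXn (real_complex R)). Qed.
Lemma RCnat n : RC n%:R = n%:R :> C. Proof. exact: (rmorph_nat (real_complex R)). Qed.
Lemma RC_eq0 a : (RC a == 0 :> C) = (a == 0). Proof. exact: (fmorph_eq0 (real_complex R)). Qed.

Lemma cReD x y : complex.Re (x + y) = complex.Re x + complex.Re y.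
Proof. by case: x; case: y. Qed.
Lemma cImD x y : complex.Im (x + y) = complex.Im x + complex.Im y.
Proof. by case: x; case: y. Qed.
Lemma cReN x : complex.Re (- x) = - complex.Re x. Proof. by case: x. Qed.
Lemma cImN x : complex.Im (- x) = - complex.Im x. Proof. by case: x. Qed.
Lemma cReM x y : complex.Re (x * y) = complex.Re x * complex.Re y - complex.Im x * complex.Im y.
Proof. by case: x; case: y. Qed.
Lemma cImM x y : complex.Im (x * y) = complex.Re x * complex.Im y + complex.Im x * complex.Re y.
Proof. by case: x; case: y. Qed.
Lemma cReC x : complex.Re (x^*)%C = complex.Re x. Proof. by case: x. Qed.
Lemma cImC x : complex.Im (x^*)%C = - complex.Im x. Proof. by case: x. Qed.
Lemma cplx_eq x y : complex.Re x = complex.Re y -> complex.Im x = complex.Im y -> x = y.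
Proof. by case: x; case: y => ? ? ? ? /= -> ->. Qed.

Lemma mulcJ_abs z : z * (z^*)%C = RC (cabs z ^+ 2).
Proof. by apply: cplx_eq; rewrite cabs_sqr; case: z => a b /=; ring. Qed.

Lemma cexpiD a b : cexpi (a + b) = cexpi a * cexpi b.
Proof. by apply: cplx_eq; rewrite /= ?cosD ?sinD; ring. Qed.
Lemma cexpi0 : cexpi (0 : R) = 1. Proof. by rewrite /cexpi cos0 sin0. Qed.
Lemma cexpiN a : cexpi (- a) = ((cexpi a)^*)%C.
Proof. by rewrite /cexpi cosN sinN. Qed.
Lemma cabs_cexpi a : cabs (cexpi a) = 1.
Proof. by rewrite /cabs /= cos2Dsin2 sqrtr1. Qed.
Lemma cexpi2pin n : cexpi (2 * pi * n%:R) = 1 :> C.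
Proof.
elim: n => [|n IH]; first by rewrite mulr0 cexpi0.
rewrite -[n.+1%:R]natr1 mulrDr cexpiD IH mulr1 mul1r.
by rewrite /cexpi mulr_natl cos2pi sin2pi.
Qed.
Lemma cexpi2pi (m : int) : cexpi (2 * pi * m%:~R) = 1 :> C.
Proof.
case: m => n; first exact: cexpi2pin.
by rewrite NegzE mulrNz mulrN cexpiN (cexpi2pin n.+1) conjc1.
Qed.

(** The hypothesis says that [x] is off the closed negative real axis. From |w|^2 = |x| and Re(w^2)
    = Re x comes the formula for (Re w)^2, which later turns a lower bound of |x| + Re x into one of
    Re w. *)
Lemma csqrt_exists x : 0 < cabs x + complex.Re x ->
  exists w : C, [/\ w ^+ 2 = x, 0 < complex.Re w &
    complex.Re w ^+ 2 = (cabs x + complex.Re x) / 2].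
Proof.
move=> h; have e := sqr_sqrtc x; set w := sqrtc x in e *.
have hr v : v ^+ 2 = x -> complex.Re v ^+ 2 = (cabs x + complex.Re x) / 2.
  by move=> <-; rewrite cabsX cabs_sqr cReM; lra.
have r0 v : v ^+ 2 = x -> complex.Re v != 0.
  by move=> /hr hv; apply/eqP => v0; move: hv; rewrite v0 expr0n /=; lra.
have rn := r0 _ e; case: (ltrgtP 0 (complex.Re w)) => [w0|w0|w0]; last by rewrite -w0 eqxx in rn.
- by exists w; split=> //; exact: hr.
- exists (- w); have e' : (- w) ^+ 2 = x by rewrite sqrrN.
  by split=> //; [rewrite cReN oppr_gt0|exact: hr].
Qed.

End ComplexBasics.

(** * Limits of complex sequences *)

Section ComplexLimits.
Variable R : realType.
Local Notation C := (R[i]).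
Implicit Types (u v : nat -> C) (l : C).

Lemma ccvg_unique u l l' : ccvg u l -> ccvg u l' -> l = l'.
Proof.
move=> h h'; apply/eqP; rewrite -subr_eq0; apply/eqP; apply: cabs_small => e e0.
have [N hN] := h (e / 2) ltac:(lra); have [N' hN'] := h' (e / 2) ltac:(lra).
have := hN (maxn N N') (leq_maxl _ _); have := hN' (maxn N N') (leq_maxr _ _).
rewrite (cabs_subC _ l) => h1 h2; apply: le_trans (cabs_tri _ (u (maxn N N')) _) _; lra.
Qed.
(** [clim] picks a limit by choice, so every value of it has to pass through a proof of
    convergence. *)
Lemma clim_eq u l : ccvg u l -> clim u = l.
Proof.
move=> h; apply: (fun a => ccvg_unique a h); apply: (ClassicalEpsilon.epsilon_spec _ (fun l' => ccvg u l')); by exists l.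
Qed.
Lemma ccvg_cst l : ccvg (fun=> l) l.
Proof. by move=> e e0; exists 0%N => k _; rewrite subrr cabs0. Qed.
Lemma ccvg_near u v l : (exists N, forall k, (N <= k)%N -> u k = v k) -> ccvg u l -> ccvg v l.
Proof.
move=> [N hN] h e e0; have [M hM] := h e e0; exists (maxn N M) => k.
by rewrite geq_max => /andP[k1 k2]; rewrite -hN // hM.
Qed.
Lemma ccvg_ext u v l : u =1 v -> ccvg u l -> ccvg v l.
Proof. by move=> h; apply: ccvg_near; exists 0%N. Qed.
Lemma ccvgD u v l l' : ccvg u l -> ccvg v l' -> ccvg (fun k => u k + v k) (l + l').
Proof.
move=> h h' e e0.
have [N hN] := h (e / 2) ltac:(lra); have [N' hN'] := h' (e / 2) ltac:(lra).
exists (maxn N N') => k; rewrite geq_max => /andP[k1 k2].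
have := hN k k1; have := hN' k k2 => a b.
by rewrite opprD addrACA; apply: le_lt_trans (cabsD _ _) _; lra.
Qed.
Lemma ccvgZ u l (c : C) : ccvg u l -> ccvg (fun k => c * u k) (c * l).
Proof.
move=> h e e0; have c1 : 0 < cabs c + 1 by have := cabs_ge0 c; lra.
have [N hN] := h (e / (cabs c + 1)) (divr_gt0 e0 c1).
exists N => k /hN; rewrite -mulrBr cabsM ltr_pdivlMr // => h1.
by apply: le_lt_trans h1; rewrite mulrDr mulr1 mulrC lerDl cabs_ge0.
Qed.
Lemma ccvgN u l : ccvg u l -> ccvg (fun k => - u k) (- l).
Proof.
by move=> h; rewrite -mulN1r; apply: ccvg_ext (@ccvgZ u l (-1) h) => k; rewrite mulN1r.
Qed.
Lemma ccvgB u v l l' : ccvg u l -> ccvg v l' -> ccvg (fun k => u k - v k) (l - l').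
Proof. by move=> h h'; apply: ccvgD h (ccvgN h'). Qed.
Lemma ccvgS u l : ccvg (fun k => u k.+1) l <-> ccvg u l.
Proof.
split=> h e e0; have [N hN] := h e e0.
- by exists N.+1 => -[//|k] /hN.
- by exists N => k Nk; apply: hN; apply: leqW.
Qed.
Lemma ccvg_bound u l (B : R) : ccvg u l -> (forall k, cabs (u k) <= B) -> cabs l <= B.
Proof.
move=> h hB; rewrite leNgt; apply/negP => hl.
have [N hN] := h (cabs l - B) ltac:(lra).
have := hN N (leqnn N); have := hB N; have := cabs_lb l (u N); rewrite cabs_subC; lra.
Qed.

Lemma cauchy_real_cvg (u : nat -> R) :
  (forall e, 0 < e -> exists N, forall k l : nat, (N <= k)%N -> (N <= l)%N -> `|u k - u l| < e) ->
  exists l : R, forall e, 0 < e -> exists N, forall k, (N <= k)%N -> `|u k - l| < e.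
Proof.
move=> h; have cv : cvgn u.
  apply/cauchy_cvgP/cauchy_exP => e e0; have [N hN] := h e e0.
  by exists (u N); exists N => // k /= Nk; rewrite /ball /= hN.
exists (limn u) => e e0.
have /cvgrPdist_lt/(_ e e0)[N _ hN] : u @ \oo --> limn u by [].
by exists N => k Nk; rewrite distrC; apply: hN.
Qed.
Lemma cauchy_ccvg u :
  (forall e : R, 0 < e -> exists N, forall k, (N <= k)%N -> cabs (u k - u N) <= e) ->
  exists l, ccvg u l.
Proof.
move=> h.
have h2 e : 0 < e -> exists N, forall k l : nat, (N <= k)%N -> (N <= l)%N -> cabs (u k - u l) < e.
  move=> e0; have [N hN] := h (e / 3) ltac:(lra); exists N => k l Nk Nl.
  have := hN k Nk; have := hN l Nl; rewrite (cabs_subC (u l)) => h1 h3.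
  by have := cabs_tri (u k) (u N) (u l); lra.
have [e e0|a ha] := @cauchy_real_cvg (fun k => complex.Re (u k)).
  have [N hN] := h2 e e0; exists N => k l Nk Nl.
  by rewrite -cReN -cReD; apply: le_lt_trans (Re_le_cabs _) (hN _ _ Nk Nl).
have [e e0|b hb] := @cauchy_real_cvg (fun k => complex.Im (u k)).
  have [N hN] := h2 e e0; exists N => k l Nk Nl.
  by rewrite -cImN -cImD; apply: le_lt_trans (Im_le_cabs _) (hN _ _ Nk Nl).
exists (complex.Complex a b) => e e0.
have [N hN] := ha (e / 2) ltac:(lra); have [M hM] := hb (e / 2) ltac:(lra).
exists (maxn N M) => k; rewrite geq_max => /andP[/hN k1 /hM k2].
apply: le_lt_trans (cabs_le_ReIm _) _; rewrite cReD cImD cReN cImN /=; lra.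
Qed.
End ComplexLimits.

(** * Absolutely convergent sums over the integers *)

Section IntSums.
Variable R : realType.
Local Notation C := (R[i]).
Implicit Types (F G : int -> C) (f : int -> R) (s : seq int).

Definition box (N : nat) : seq int := [seq i%:Z - N%:Z | i <- iota 0 (N + N).+1].

Lemma mem_box N (j : int) : (j \in box N) = (`|j| <= N)%N.
Proof.
apply/mapP/idP => [ [i hi ->] | h]; first by move: hi; rewrite mem_iota; lia.
exists (absz (j + N%:Z)); last by lia.
by rewrite mem_iota; lia.
Qed.
Lemma box_uniq N : uniq (box N).
Proof. by rewrite map_inj_uniq ?iota_uniq // => i j /=; lia. Qed.
Lemma box_sub N M : (N <= M)%N -> {subset box N <= box M}.
Proof. by move=> NM j; rewrite !mem_box => h; apply: leq_trans NM. Qed.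
Lemma sub_box s : exists N, {subset s <= box N}.
Proof.
elim: s => [|a s [N hN]]; first by exists 0%N.
exists (maxn `|a|%N N) => j; rewrite inE => /orP[/eqP->|/hN]; rewrite !mem_box; lia.
Qed.

(** Summability of a nonnegative family together with a bound on its sum. Quantifying over all
    finite sets rather than over boxes makes it stable under injective reindexing. *)
Definition bsum f (M : R) : Prop := forall s, uniq s -> \sum_(j <- s) f j <= M.

Lemma bsum_ge0 f M : bsum f M -> 0 <= M.
Proof. by move=> /(_ [::] isT); rewrite big_nil. Qed.
Lemma bsum_le f g M : (forall j, f j <= g j) -> bsum g M -> bsum f M.
Proof. by move=> h hg s us; apply: le_trans (hg s us); exact: ler_sum. Qed.
Lemma bsum_leM f M M' : M <= M' -> bsum f M -> bsum f M'.
Proof. by move=> h hf s us; apply: le_trans h; exact: hf. Qed.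
Lemma bsumZ f M c : 0 <= c -> bsum f M -> bsum (fun j => c * f j) (c * M).
Proof. by move=> c0 h s us; rewrite -mulr_sumr ler_wpM2l // h. Qed.
Lemma bsumD f g M M' : bsum f M -> bsum g M' -> bsum (fun j => f j + g j) (M + M').
Proof. by move=> h h' s us; rewrite big_split lerD // ?h ?h'. Qed.
Lemma bsum_inj f M (h : int -> int) : injective h -> bsum f M -> bsum (fun j => f (h j)) M.
Proof. by move=> hi hf s us; rewrite -(big_map h predT f) hf // map_inj_uniq. Qed.
Lemma bsum1 f M j : bsum f M -> f j <= M.
Proof. by move=> /(_ [:: j] isT); rewrite big_seq1. Qed.
Lemma bsum_pt (a : int) (x : R) : 0 <= x -> bsum (fun j => if j == a then x else 0) x.
Proof.
move=> x0 s us; rewrite -big_mkcond /= big_const_seq iter_addr_0 -/(count_mem a s).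
by rewrite count_uniq_mem //; case: (a \in s); rewrite ?mulr1n ?mulr0n.
Qed.

Lemma sum_cond_disjoint (V : nmodType) (F : int -> V) s s' : uniq s -> uniq s' -> {subset s <= s'} ->
  \sum_(j <- s') F j = \sum_(j <- s) F j + \sum_(j <- [seq j <- s' | j \notin s]) F j.
Proof.
move=> us us' sub; rewrite (bigID (fun j => j \in s)) /= -big_filter; congr (_ + _).
  apply: perm_big; apply: uniq_perm; rewrite ?filter_uniq // => j.
  by rewrite mem_filter; case: (boolP (j \in s)) => // /sub ->.
by rewrite big_filter.
Qed.

(** A finite set whose sum is within [e] of the supremum lies in some box; a finite set outside that
    box can add at most [e] to it. *)
Lemma bsum_tail f M (e : R) : (forall j, 0 <= f j) -> bsum f M -> 0 < e ->
  exists N, forall s, uniq s -> (forall j, j \in s -> (N < `|j|)%N) -> \sum_(j <- s) f j <= e.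
Proof.
move=> f0 h e0; pose E := [set x : R | exists s, uniq s /\ x = \sum_(j <- s) f j].
have hE : has_sup E.
  split; first by exists 0, [::]; rewrite big_nil.
  by exists M => _ [s [us ->]]; exact: h.
have [_ [s0 [us0 ->]] hs0] := sup_adherent e0 hE.
have [N hN] := sub_box s0; exists N => s us hs.
have dis j : j \in s -> j \notin s0.
  by move=> /hs h1; apply/negP => /hN; rewrite mem_box; lia.
have : \sum_(j <- s0 ++ s) f j <= sup E.
  apply: sup_upper_bound hE _ _; exists (s0 ++ s); split => //.
  rewrite cat_uniq us0 us andbT; apply/hasPn => j /dis //.
by rewrite big_cat /=; lra.
Qed.

(** Symmetric partial sums, to match the truncation used by [zksum]. *)
Definition csum F : C := clim (fun N => \sum_(j <- box N) F j).

Definition dom F f := forall j, cabs (F j) <= f j.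

Lemma dom_ge0 F f j : dom F f -> 0 <= f j.
Proof. by move=> /(_ j); apply: le_trans; exact: cabs_ge0. Qed.

Lemma sum_dom F f s : dom F f -> cabs (\sum_(j <- s) F j) <= \sum_(j <- s) f j.
Proof. by move=> h; apply: le_trans (cabs_sum _ _ _) _; apply: ler_sum. Qed.

Lemma csum_cvg F f M : dom F f -> bsum f M -> ccvg (fun N => \sum_(j <- box N) F j) (csum F).
Proof.
move=> hd hb; have [//|l hl] := @cauchy_ccvg _ (fun N => \sum_(j <- box N) F j); last first.
  by rewrite /csum (clim_eq hl).
move=> e e0; have [N hN] := bsum_tail (fun j => dom_ge0 j hd) hb e0; exists N => k Nk.
rewrite (sum_cond_disjoint F (box_uniq N) (box_uniq k) (box_sub Nk)) addrC addKr.
apply: le_trans (sum_dom _ hd) _; apply: hN; first by rewrite filter_uniq ?box_uniq.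
by move=> j; rewrite mem_filter mem_box -ltnNge => /andP[].
Qed.

Lemma csum_le F f M : dom F f -> bsum f M -> cabs (csum F) <= M.
Proof.
move=> hd hb; apply: ccvg_bound (csum_cvg hd hb) _ => k.
by apply: le_trans (sum_dom _ hd) _; apply: hb; exact: box_uniq.
Qed.

Lemma csum_approx F f M (e : R) : dom F f -> bsum f M -> 0 < e ->
  exists N, forall s, uniq s -> {subset box N <= s} -> cabs (csum F - \sum_(j <- s) F j) <= e.
Proof.
move=> hd hb e0; have [|N hN] := bsum_tail (fun j => dom_ge0 j hd) hb (e := e / 2); first by lra.
have hN' s : uniq s -> {subset box N <= s} ->
    cabs (\sum_(j <- s) F j - \sum_(j <- box N) F j) <= e / 2.
  move=> us sub; rewrite (sum_cond_disjoint F (box_uniq N) us sub) addrC addKr.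
  apply: le_trans (sum_dom _ hd) _; apply: hN; first by rewrite filter_uniq.
  by move=> j; rewrite mem_filter mem_box -ltnNge => /andP[].
exists N => s us sub; apply: le_trans (cabs_tri _ (\sum_(j <- box N) F j) _) _.
rewrite [in X in _ + X]cabs_subC; have := hN' s us sub.
have : cabs (csum F - \sum_(j <- box N) F j) <= e / 2; last by lra.
have h1 := ccvgB (csum_cvg hd hb) (ccvg_cst (\sum_(j <- box N) F j)).
apply: (@ccvg_bound _ (fun k => \sum_(j <- box (k + N)) F j - \sum_(j <- box N) F j)).
  move=> d /h1[K hK]; exists K => k Kk; apply: hK; exact: leq_trans Kk (leq_addr _ _).
by move=> k; apply: hN' (box_uniq _) _; apply: box_sub; exact: leq_addl.
Qed.

Lemma csum_near F f M N (e : R) : dom F f -> bsum f M ->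
  (forall s, uniq s -> (forall j, j \in s -> (N < `|j|)%N) -> \sum_(j <- s) f j <= e) ->
  cabs (csum F - \sum_(j <- box N) F j) <= e.
Proof.
move=> hd hb hN.
have h1 := ccvgB (csum_cvg hd hb) (ccvg_cst (\sum_(j <- box N) F j)).
apply: (@ccvg_bound _ (fun k => \sum_(j <- box (k + N)) F j - \sum_(j <- box N) F j)).
  move=> d /h1[K hK]; exists K => k Kk; apply: hK; exact: leq_trans Kk (leq_addr _ _).
move=> k; have sub := box_sub (leq_addl k N).
rewrite (sum_cond_disjoint F (box_uniq N) (box_uniq _) sub) addrC addKr.
apply: le_trans (sum_dom _ hd) _; apply: hN; first by rewrite filter_uniq ?box_uniq.
by move=> j; rewrite mem_filter mem_box -ltnNge => /andP[].
Qed.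

Lemma csum_eq F G : F =1 G -> csum F = csum G.
Proof. by move=> h; congr csum; apply: funext. Qed.

Lemma csumD F G f g M M' : dom F f -> bsum f M -> dom G g -> bsum g M' ->
  csum (fun j => F j + G j) = csum F + csum G.
Proof.
move=> hF hf hG hg; apply: clim_eq; apply: ccvg_ext (ccvgD (csum_cvg hF hf) (csum_cvg hG hg)).
by move=> k; rewrite big_split.
Qed.
Lemma csumZ F f M c : dom F f -> bsum f M -> csum (fun j => c * F j) = c * csum F.
Proof.
move=> hF hf; apply: clim_eq; apply: ccvg_ext (ccvgZ c (csum_cvg hF hf)).
by move=> k; rewrite mulr_sumr.
Qed.
Lemma csumB F G f g M M' : dom F f -> bsum f M -> dom G g -> bsum g M' ->
  csum (fun j => F j - G j) = csum F - csum G.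
Proof.
move=> hF hf hG hg; apply: clim_eq; apply: ccvg_ext (ccvgB (csum_cvg hF hf) (csum_cvg hG hg)).
by move=> k; rewrite sumrB.
Qed.

(** Shifts and reflections do not preserve boxes; absolute convergence allows both sums to be
    compared over one large finite set. *)
Lemma csum_bij F f M (h h' : int -> int) : cancel h h' -> cancel h' h -> dom F f -> bsum f M ->
  csum (fun j => F (h j)) = csum F.
Proof.
move=> hK h'K hd hb.
have hd' : dom (fun j => F (h j)) (fun j => f (h j)) by move=> j; apply: hd.
have hb' := bsum_inj (can_inj hK) hb.
apply/eqP; rewrite -subr_eq0; apply/eqP; apply: cabs_small => e e0.
have [|N hN] := csum_approx hd hb (e := e / 2); first by lra.
have [|N' hN'] := csum_approx hd' hb' (e := e / 2); first by lra.
(* This box contains [box N'], and its image under [h] contains [box N], so the same finite sum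
   approximates both sides. *)
have [K hK1] := sub_box (box N' ++ [seq h' j | j <- box N]).
have h1 : cabs (csum (fun j => F (h j)) - \sum_(j <- box K) F (h j)) <= e / 2.
  by apply: hN' (box_uniq _) _ => j hj; apply: hK1; rewrite mem_cat hj.
have := hN [seq h j | j <- box K]; rewrite map_inj_uniq ?box_uniq; last exact: can_inj hK.
rewrite big_map => /(_ isT) h2.
have {}h2 : cabs (csum F - \sum_(j <- box K) F (h j)) <= e / 2.
  apply: h2 => j hj; apply/mapP; exists (h' j); rewrite ?h'K //.
  by apply: hK1; rewrite mem_cat map_f ?orbT.
apply: le_trans (cabs_tri _ (\sum_(j <- box K) F (h j)) _) _.
rewrite [in X in _ + X]cabs_subC; lra.
Qed.

(** Dominated convergence in which the terms and the box depend on the same [N]. This is the form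
    needed for the [k]-fold sums, whose indices are all truncated at once. *)
Lemma csum_tannery (FN : nat -> int -> C) F f M : (forall N, dom (FN N) f) -> dom F f -> bsum f M ->
  (forall j, ccvg (FN ^~ j) (F j)) ->
  ccvg (fun N => \sum_(j <- box N) FN N j) (csum F).
Proof.
move=> hd hF hb hc e e0.
have [|N hN] := csum_approx hF hb (e := e / 4); first by lra.
have [|N' hN'] := bsum_tail (fun j => dom_ge0 j hF) hb (e := e / 4); first by lra.
pose K := maxn N N'.
have [L hL] : exists L, forall k, (L <= k)%N ->
    cabs (\sum_(j <- box K) FN k j - \sum_(j <- box K) F j) < e / 4.
  have : ccvg (fun k => \sum_(j <- box K) FN k j) (\sum_(j <- box K) F j).
    elim: (box K) => [|a s IH].
      by rewrite big_nil; apply: ccvg_ext (ccvg_cst 0) => k; rewrite big_nil.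
    rewrite big_cons; apply: ccvg_ext (ccvgD (hc a) IH) => k; by rewrite big_cons.
  by apply; lra.
exists (maxn K L) => k; rewrite geq_max => /andP[Kk /hL h1].
have h2 := hN (box K) (box_uniq _) (box_sub (leq_maxl _ _)).
have h3 : cabs (\sum_(j <- box k) FN k j - \sum_(j <- box K) FN k j) <= e / 4.
  rewrite (sum_cond_disjoint (FN k) (box_uniq K) (box_uniq k) (box_sub Kk)) addrC addKr.
  apply: le_trans (sum_dom _ (hd k)) _; apply: hN'; first by rewrite filter_uniq ?box_uniq.
  move=> j; rewrite mem_filter mem_box -ltnNge => /andP[+ _]; apply: leq_ltn_trans.
  exact: leq_maxr.
apply: le_lt_trans (cabs_tri _ (\sum_(j <- box K) FN k j) _) _.
have := cabs_tri (\sum_(j <- box K) FN k j) (\sum_(j <- box K) F j) (csum F).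
rewrite cabs_subC in h2; lra.
Qed.

Lemma csum_pt (a : int) (x : C) : csum (fun j => if j == a then x else 0) = x.
Proof.
apply: clim_eq; apply: ccvg_near (ccvg_cst x); exists `|a|%N => k ak.
rewrite -big_mkcond /= big_const_seq iter_addr_0 -/(count_mem a (box k)).
by rewrite count_uniq_mem ?box_uniq // mem_box ak mulr1n.
Qed.

Lemma csum_split1 F f M (a : int) : dom F f -> bsum f M ->
  csum F = F a + csum (fun j => if j == a then 0 else F j).
Proof.
move=> hd hb; rewrite -[X in _ = X + _](csum_pt a (F a)).
have f0 j := dom_ge0 j hd.
rewrite -(@csumD _ _ (fun j => if j == a then f a else 0) f (f a) M) //.
- by apply: csum_eq => j; case: eqP => [->|]; rewrite ?addr0 ?add0r.
- by move=> j; case: eqP; rewrite ?cabs0 ?hd.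
- exact: bsum_pt.
- by move=> j; case: eqP; rewrite ?cabs0 ?hd ?f0.
Qed.

(** By [csum_tannery] both iterated sums are limits of the same sums over squares; the product
    majorant dominates each of them. *)
Lemma csum_fubini (G : int -> int -> C) al be Ma Mb :
  (forall i j, cabs (G i j) <= al i * be j) -> bsum al Ma -> bsum be Mb ->
  (forall i, 0 <= al i) -> (forall j, 0 <= be j) ->
  csum (fun i => csum (fun j => G i j)) = csum (fun j => csum (fun i => G i j)).
Proof.
move=> hG hal hbe al0 be0.
have Mb0 := bsum_ge0 hbe; have Ma0 := bsum_ge0 hal.
have d1 i : dom (G i) (fun j => al i * be j) by move=> j.
have b1 i : bsum (fun j => al i * be j) (al i * Mb) by apply: bsumZ.
have d2 j : dom (G ^~ j) (fun i => be j * al i) by move=> i; rewrite mulrC.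
have b2 j : bsum (fun i => be j * al i) (be j * Ma) by apply: bsumZ.
have D1 : dom (fun i => csum (G i)) (fun i => Mb * al i).
  by move=> i; rewrite mulrC; apply: csum_le (d1 i) (b1 i).
have B1 : bsum (fun i => Mb * al i) (Mb * Ma) by apply: bsumZ.
apply: clim_eq.
have H : ccvg (fun N => \sum_(j <- box N) (\sum_(i <- box N) G i j)) (csum (fun j => csum (G ^~ j))).
  apply: (@csum_tannery (fun N j => \sum_(i <- box N) G i j) _ (fun j => Ma * be j) (Ma * Mb)).
  - move=> N j; apply: le_trans (sum_dom _ (d2 j)) _; rewrite mulrC; apply: b2.
    exact: box_uniq.
  - by move=> j; rewrite mulrC; apply: csum_le (d2 j) (b2 j).
  - exact: bsumZ.
  - by move=> j; apply: csum_cvg (d2 j) (b2 j).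
have H' : ccvg (fun N => \sum_(i <- box N) (\sum_(j <- box N) G i j)) (csum (fun i => csum (G i))).
  apply: (@csum_tannery (fun N i => \sum_(j <- box N) G i j) _ (fun i => Mb * al i) (Mb * Ma)) => //.
  - move=> N i; apply: le_trans (sum_dom _ (d1 i)) _; rewrite mulrC; apply: b1.
    exact: box_uniq.
  - by move=> i; apply: csum_cvg (d1 i) (b1 i).
have -> : csum (fun j => csum (G ^~ j)) = csum (fun i => csum (G i)).
  apply: ccvg_unique H' ; apply: ccvg_ext H => N; exact: exchange_big.
exact: csum_cvg D1 B1.
Qed.

End IntSums.

(** * Neumann series of a kernel whose norm on bounded sequences is at most 1/2 *)

Section Neumann.
Variable R : realType.
Local Notation C := (R[i]).
Variables (K : int -> int -> C) (ka : int -> R).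
Hypotheses (hK : forall m l, cabs (K m l) <= ka l) (hka : bsum ka (1 / 2)).
Implicit Types (f g phi psi : int -> C).

Definition kop (phi : int -> C) (m : int) : C := csum (fun l => K m l * phi l).
Definition nser (g : int -> C) (m : int) : C :=
  clim (fun k => \sum_(i < k) iter i kop g m).

Definition bd (phi : int -> C) (G : R) := forall m, cabs (phi m) <= G.

Lemma bd_ge0 phi G : bd phi G -> 0 <= G.
Proof. by move=> /(_ 0); apply: le_trans; exact: cabs_ge0. Qed.

Lemma kop_dom phi G m : bd phi G -> dom (fun l => K m l * phi l) (fun l => G * ka l).
Proof. by move=> h l; rewrite cabsM mulrC ler_pM ?cabs_ge0. Qed.
Lemma kop_bsum phi G : bd phi G -> bsum (fun l => G * ka l) (G / 2).
Proof. by move=> h; rewrite -(mul1r 2^-1); apply: bsumZ => //; apply: bd_ge0 h. Qed.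

Lemma kop_bd phi G : bd phi G -> bd (kop phi) (G / 2).
Proof. by move=> h m; apply: csum_le (kop_dom m h) (kop_bsum h). Qed.

Lemma iter_kop_bd g G i : bd g G -> bd (iter i kop g) (G / 2 ^+ i).
Proof.
move=> h; elim: i => [|i IH]; first by rewrite expr0 divr1.
by rewrite iterS exprSr invfM mulrA; exact: kop_bd IH.
Qed.

Lemma kopD f g F G m : bd f F -> bd g G -> kop (fun l => f l + g l) m = kop f m + kop g m.
Proof.
move=> hf hg; rewrite /kop -(csumD (kop_dom m hf) (kop_bsum hf) (kop_dom m hg) (kop_bsum hg)).
by apply: csum_eq => l; rewrite mulrDr.
Qed.
Lemma kopZ c g G m : bd g G -> kop (fun l => c * g l) m = c * kop g m.
Proof.
move=> hg; rewrite /kop -(csumZ c (kop_dom m hg) (kop_bsum hg)).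
by apply: csum_eq => l; rewrite mulrCA.
Qed.
Lemma bdN g G : bd g G -> bd (fun l => - g l) G.
Proof. by move=> h l; rewrite cabsN. Qed.
Lemma bdD f g F G : bd f F -> bd g G -> bd (fun l => f l + g l) (F + G).
Proof. by move=> hf hg l; apply: le_trans (cabsD _ _) _; exact: lerD. Qed.
Lemma bdZ c g G : bd g G -> bd (fun l => c * g l) (cabs c * G).
Proof. by move=> h l; rewrite cabsM ler_wpM2l ?cabs_ge0. Qed.
Lemma bd_le g G G' : G <= G' -> bd g G -> bd g G'.
Proof. by move=> h hg l; apply: le_trans h. Qed.
Lemma kopN g G m : bd g G -> kop (fun l => - g l) m = - kop g m.
Proof.
move=> hg; have -> : (fun l => - g l) = (fun l => -1 * g l) by apply: funext => l; rewrite mulN1r.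
exact: etrans (kopZ (-1) m hg) (mulN1r _).
Qed.
Lemma kopB f g F G m : bd f F -> bd g G -> kop (fun l => f l - g l) m = kop f m - kop g m.
Proof. by move=> hf hg; rewrite (kopD m hf (bdN hg)) (kopN m hg). Qed.

Definition npart g k m : C := \sum_(i < k) iter i kop g m.

Lemma half_small (G e : R) : 0 <= G -> 0 < e -> exists N, forall k, (N <= k)%N -> G / 2 ^+ k < e.
Proof.
move=> G0 e0; have h : G / e < (Num.bound (G / e))%:R by apply: archi_boundP; apply: divr_ge0 => //; exact: ltW.
exists (Num.bound (G / e)) => k hk.
have h2 : (Num.bound (G / e))%:R <= 2 ^+ k :> R.
  rewrite -natrX ler_nat; apply: leq_trans hk _; exact: ltnW (ltn_expl _ _).
rewrite ltr_pdivrMr ?exprn_gt0 // mulrC -ltr_pdivrMr //; exact: lt_le_trans h h2.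
Qed.

Lemma npart_step g G k l m : bd g G -> cabs (npart g (k + l) m - npart g k m) <= 2 * G / 2 ^+ k.
Proof.
move=> hg; have G0 := bd_ge0 hg; have p i : 0 < 2 ^+ i :> R by rewrite exprn_gt0.
(* The subtracted term makes the geometric bound inductive in [l]. *)
have : cabs (npart g (k + l) m - npart g k m) <= 2 * G / 2 ^+ k - 2 * G / 2 ^+ (k + l).
  elim: l => [|l IH]; first by rewrite addn0 !subrr cabs0.
  rewrite addnS /npart big_ord_recr /= -/(npart g (k + l) m) addrAC.
  apply: le_trans (cabsD _ _) _; have h := iter_kop_bd (k + l) hg m.
  apply: le_trans (lerD IH h) _; rewrite exprSr invfM; lra.
have := divr_ge0 G0 (ltW (p (k + l)%N)); lra.
Qed.

Lemma nser_cvg g G m : bd g G -> ccvg (fun k => npart g k m) (nser g m).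
Proof.
move=> hg; have G0 := bd_ge0 hg; have [e e0|l hl] := @cauchy_ccvg _ (fun k => npart g k m); last first.
  by rewrite /nser (clim_eq hl).
have [|N hN] := @half_small (2 * G) e _ e0; first by lra.
exists N => k Nk; rewrite -(subnKC Nk); apply: le_trans (npart_step _ _ _ hg) (ltW (hN N (leqnn N))).
Qed.

Lemma nser_approx g G k m : bd g G -> cabs (nser g m - npart g k m) <= 2 * G / 2 ^+ k.
Proof.
move=> hg.
apply: (@ccvg_bound _ (fun l => npart g (k + l) m - npart g k m)); last by move=> l; exact: npart_step.
apply: ccvgB _ (ccvg_cst (npart g k m)) => e e0; have [N hN] := nser_cvg m hg e0.
by exists N => l Nl; apply: hN; apply: leq_trans Nl (leq_addl _ _).
Qed.

Lemma npart_bd g G k : bd g G -> bd (npart g k) (2 * G).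
Proof.
move=> hg m; have := npart_step 0 k m hg; rewrite add0n /npart big_ord0 subr0 expr0.
by rewrite divr1.
Qed.
Lemma nser_bd g G : bd g G -> bd (nser g) (2 * G).
Proof.
by move=> hg m; have := nser_approx 0 m hg; rewrite /npart big_ord0 subr0 expr0 divr1.
Qed.

Lemma npartS g G k m : bd g G -> npart g k.+1 m = kop (npart g k) m + g m.
Proof.
move=> hg; elim: k m => [|k IH] m.
  have -> : kop (npart g 0) m = 0.
    apply: clim_eq; apply: ccvg_ext (ccvg_cst 0) => N; rewrite big1 // => l _.
    by rewrite /npart big_ord0 mulr0.
  by rewrite /npart big_ord_recr big_ord0 /=.
rewrite {1}/npart big_ord_recr /= -/(npart g k.+1 m) IH addrAC; congr (_ + _).
have -> : npart g k.+1 = (fun l => npart g k l + iter k kop g l).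
  by apply: funext => l; rewrite /npart big_ord_recr.
exact/esym/(kopD m (npart_bd k hg) (iter_kop_bd k hg)).
Qed.

Lemma nser_eq g G m : bd g G -> nser g m = kop (nser g) m + g m.
Proof.
move=> hg; have G0 := bd_ge0 hg; apply/eqP; rewrite -subr_eq0; apply/eqP; apply: cabs_small => e e0.
have [|k hk] := @half_small (4 * G) e _ e0; first by lra.
have h1 := nser_approx k.+1 m hg; rewrite (npartS _ _ hg) in h1.
have h2 : cabs (kop (npart g k) m - kop (nser g) m) <= 2 * G / 2 ^+ k / 2.
  rewrite -(kopB m (npart_bd k hg) (nser_bd hg)); apply: kop_bd => l.
  by rewrite cabs_subC; exact: nser_approx.
have -> : nser g m - (kop (nser g) m + g m) = (nser g m - (kop (npart g k) m + g m))
   + (kop (npart g k) m - kop (nser g) m) by ring.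
apply: le_trans (cabsD _ _) _; apply: le_trans (lerD h1 h2) _; apply: le_trans (ltW (hk k (leqnn k))).
rewrite exprS invfM; have := divr_ge0 G0 (exprn_ge0 k (ler0n R 2)); lra.
Qed.

Lemma kop_fix0 phi G : bd phi G -> (forall m, phi m = kop phi m) -> forall m, phi m = 0.
Proof.
move=> hg h m; have G0 := bd_ge0 hg; apply: cabs_small => e e0.
have hb k : bd phi (G / 2 ^+ k).
  elim: k => [|k IH]; first by rewrite expr0 divr1.
  by move=> l; rewrite h exprSr invfM mulrA; exact: kop_bd IH l.
have [k hk] := half_small G0 e0.
by apply: le_trans (hb k m) (ltW (hk k (leqnn k))).
Qed.

Lemma nser_unique g G phi H : bd g G -> bd phi H ->
  (forall m, phi m = kop phi m + g m) -> forall m, phi m = nser g m.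
Proof.
move=> hg hp h m; apply/eqP; rewrite -subr_eq0; apply/eqP.
apply: (@kop_fix0 (fun m => phi m - nser g m)).
  exact: bdD hp (bdN (nser_bd hg)).
by move=> l; rewrite (kopB l hp (nser_bd hg)) {1}h {1}(nser_eq l hg); ring.
Qed.
Lemma nser_fix_bd g G phi H : bd g G -> bd phi H ->
  (forall m, phi m = kop phi m + g m) -> bd phi (2 * G).
Proof. by move=> hg hp h m; rewrite (nser_unique hg hp h); exact: nser_bd. Qed.

(** [kseries] starts at [k = 1], the Neumann series at the free term [g]; hence the subtraction,
    which is why q_{2n} and q_{-2n} appear separately from B and B'. *)
Lemma kseries_nser g G m (F : nat -> C) : bd g G ->
  (forall k, (0 < k)%N -> F k = iter k kop g m) -> Defs.kseries F = nser g m - g m.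
Proof.
move=> hg hF; apply: clim_eq.
have h : ccvg (fun k => npart g k.+1 m - g m) (nser g m - g m).
  by apply: ccvgB (ccvg_cst _); apply: (proj2 (ccvgS (fun k => npart g k m) _)); exact: nser_cvg hg.
apply: ccvg_ext h => k; rewrite /npart big_ord_recl /= addrC addKr.
rewrite big_add1 /= big_mkord; apply: eq_bigr => i _.
by rewrite hF.
Qed.

End Neumann.

(** * The multiple sums of a_k, b_k, a'_k, b'_k as iterates of one operator *)

Section PathSums.
Variable R : realType.
Local Notation C := (R[i]).
Variables (q w : int -> C).

(** One summation index truncated to a box, moving the position from [m] to [m - j]. Its [k]-th
    iterate is the truncated [k]-fold sum, the positions being nu - n_1 - ... - n_r. *)
Definition bstep (N : nat) (phi : int -> C) (m : int) : C :=
  \sum_(j <- box N) q j * w (m - j) * phi (m - j).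

Definition pterm (g : int -> C) (nu : int) (k : nat) (v : {ffun 'I_k -> int}) : C :=
  (\prod_(i < k) q (v i)) * (\prod_(r < k) w (nu - psum v r.+1)) * g (nu - psum v k).

Definition fcons (T : finType) k (x : T) (f : {ffun 'I_k -> T}) : {ffun 'I_k.+1 -> T} :=
  [ffun i => if unlift ord0 i is Some j then f j else x].

Lemma sum_fcons (T : finType) k (F : {ffun 'I_k.+1 -> T} -> C) :
  \sum_f F f = \sum_(x : T) \sum_(f : {ffun 'I_k -> T}) F (fcons x f).
Proof.
rewrite pair_big /= (reindex (fun p : T * {ffun 'I_k -> T} => fcons p.1 p.2)) //=.
exists (fun f => (f ord0, [ffun i => f (lift ord0 i)])) => [[x f] _ /=|f _ /=].
  congr pair; first by rewrite ffunE unlift_none.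
  by apply/ffunP => i; rewrite !ffunE liftK.
by apply/ffunP => i; rewrite !ffunE; case: unliftP => [j ->|->]; rewrite ?ffunE.
Qed.

Lemma sum_box (T : nmodType) N (F : int -> T) :
  \sum_(x : 'I_(N + N).+1) F ((nat_of_ord x)%:Z - N%:Z) = \sum_(j <- box N) F j.
Proof. by rewrite big_map -[iota _ _]/(index_iota 0 (N + N).+1) big_mkord. Qed.

Lemma psum_fcons k (T : finType) (c : T -> int) x (f : {ffun 'I_k -> T}) r :
  psum [ffun i => c (fcons x f i)] r.+1 = c x + psum [ffun i => c (f i)] r.
Proof.
rewrite /psum big_mkcond big_ord_recl /= ffunE /fcons ffunE unlift_none; congr (_ + _).
rewrite [RHS]big_mkcond /=; apply: eq_bigr => i _.
by rewrite !ffunE liftK /bump /= add1n ltnS.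
Qed.

Lemma iter_bstep N k g nu : iter k (bstep N) g nu =
  \sum_(f : {ffun 'I_k -> 'I_(N + N).+1}) pterm g nu [ffun i => (nat_of_ord (f i))%:Z - N%:Z].
Proof.
elim: k nu => [|k IH] nu.
  have hu (f : {ffun 'I_0 -> 'I_(N + N).+1}) : f = finfun (fun=> ord0).
    by apply/ffunP => -[].
  rewrite (bigD1 [ffun=> ord0]) //= big1 ?addr0; last first.
    by move=> f; rewrite (hu f) eqxx.
  by rewrite /pterm !big_ord0 !mul1r /psum big_ord0 subr0.
rewrite iterS /bstep -/(bstep N) -(sum_box N (fun j => q j * w (nu - j) * iter k (bstep N) g (nu - j))).
rewrite sum_fcons; apply: eq_bigr => x _; rewrite IH mulr_sumr; apply: eq_bigr => f _.
pose c (x : 'I_(N + N).+1) : int := (nat_of_ord x)%:Z - N%:Z.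
rewrite /pterm -/(c x) !big_ord_recl.
have p0 (v : {ffun 'I_k -> int}) : psum v 0 = 0 by rewrite /psum big_pred0.
have -> : nu - psum [ffun i => c (fcons x f i)] (@ord0 k).+1 = nu - c x.
  by rewrite (psum_fcons c x f 0) p0 addr0.
have -> : nu - psum [ffun i => c (fcons x f i)] k.+1 = nu - c x - psum [ffun i => c (f i)] k.
  by rewrite (psum_fcons c x f k) opprD addrA.
have -> : [ffun i => c (fcons x f i)] ord0 = c x by rewrite !ffunE unlift_none.
have -> : \prod_(i < k) q ([ffun i => c (fcons x f i)] (lift ord0 i)) = \prod_(i < k) q ([ffun i => c (f i)] i).
  by apply: eq_bigr => i _; rewrite !ffunE liftK.
have -> : \prod_(r < k) w (nu - psum [ffun i => c (fcons x f i)] (lift ord0 r).+1) =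
    \prod_(r < k) w (nu - c x - psum [ffun i => c (f i)] r.+1).
  by apply: eq_bigr => r _; rewrite (psum_fcons c x f r.+1) opprD addrA.
have H (x1 w1 a b g1 : C) : x1 * w1 * (a * b * g1) = x1 * a * (w1 * b) * g1 by ring.
exact: H.
Qed.

(** Both restrictions on the indices are absorbed by the factors: n_r = 0 is killed by [q 0 = 0],
    and a forbidden partial sum by a zero weight. *)
Lemma gterm_pterm (qf : R -> C) (lam : C) ok cen lst k (v : {ffun 'I_k -> int}) g nu :
  (forall j, fourier qf j = q j) -> q 0 = 0 ->
  (forall s, w (nu - s) = if ok s then (lam - RC (cen s ^+ 2))^-1 else 0) ->
  (forall s, g (nu - s) = q (lst s)) ->
  gterm qf lam ok cen lst v = pterm g nu v.
Proof.
move=> hq q0 hw hg; rewrite /gterm /pterm hg hq.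
have -> : \prod_(i < k) fourier qf (v i) = \prod_(i < k) q (v i) by apply: eq_bigr.
case: ifPn => [/andP[_ /fintype.forallP h]|].
  have -> : \prod_(r < k) w (nu - psum v r.+1) = (\prod_(r < k) (lam - RC (cen (psum v r.+1) ^+ 2)))^-1.
    by rewrite -prodfV; apply: eq_bigr => r _; rewrite hw h.
  by rewrite mulrAC.
rewrite negb_and => /orP[/forallPn [r0]|/forallPn [i hi]].
  by rewrite negbK => /eqP h; rewrite (bigD1 r0) //= h q0 !mul0r.
rewrite [X in _ * X * _](_ : _ = 0) ?mulr0 ?mul0r //.
by rewrite (bigD1 i) //= hw (negbTE hi) mul0r.
Qed.

Variables (M : R).
Hypotheses (hq : forall j, cabs (q j) <= M) (hw : bsum (fun l => M * cabs (w l)) (1 / 2)).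
Let K m l := q (m - l) * w l.

Lemma conv_ker m l : cabs (K m l) <= M * cabs (w l).
Proof. by rewrite /K cabsM ler_wpM2r ?cabs_ge0. Qed.

Lemma flip_inv (m : int) : cancel (fun j => m - j) (fun j => m - j).
Proof. by move=> j; rewrite opprB addrC subrK. Qed.

Lemma kop_flip phi G m : bd phi G -> kop K phi m = csum (fun j => q j * w (m - j) * phi (m - j)).
Proof.
move=> hp; rewrite /kop -(csum_bij (flip_inv m) (flip_inv m) (kop_dom conv_ker m hp) (kop_bsum hw hp)).
by apply: csum_eq => j; rewrite /K opprB addrC subrK.
Qed.

Lemma bstep_dom phi G m : bd phi G ->
  dom (fun j => q j * w (m - j) * phi (m - j)) (fun j => G * (M * cabs (w (m - j)))).
Proof.
by move=> h j; rewrite cabsM mulrC ler_pM ?cabs_ge0 // cabsM ler_wpM2r ?cabs_ge0.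
Qed.
Lemma bstep_bsum G m : 0 <= G -> bsum (fun j => G * (M * cabs (w (m - j)))) (G / 2).
Proof.
move=> G0; rewrite -(mul1r 2^-1); apply: bsumZ => //.
exact: (bsum_inj (h := fun j => m - j) (can_inj (flip_inv m)) hw).
Qed.

Lemma iter_bstep_bd N k g G : bd g G -> bd (iter k (bstep N) g) G.
Proof.
move=> hg; have G0 := bd_ge0 hg; elim: k => [//|k IH] m; rewrite iterS.
apply: le_trans (sum_dom _ (bstep_dom m IH)) _.
apply: le_trans (bstep_bsum m G0 (box_uniq N)) _; lra.
Qed.

(** The truncation [N] acts on every level simultaneously, so the induction passes to the limit by
    [csum_tannery] instead of one index at a time. *)
Lemma iter_bstep_cvg k g G m : bd g G -> ccvg (fun N => iter k (bstep N) g m) (iter k (kop K) g m).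
Proof.
move=> hg; have G0 := bd_ge0 hg; elim: k m => [|k IH] m; first exact: ccvg_cst.
have hb : bd (iter k (kop K) g) G.
  apply: bd_le (iter_kop_bd conv_ker hw k hg).
  by rewrite ler_pdivrMr ?exprn_gt0 // ler_peMr // exprn_ege1 // ler1n.
rewrite iterS (kop_flip m hb).
apply: (csum_tannery (FN := fun N j => q j * w (m - j) * iter k (bstep N) g (m - j))).
- by move=> N; apply: bstep_dom; exact: iter_bstep_bd.
- exact: bstep_dom hb.
- exact: bstep_bsum.
- by move=> j; apply: ccvgZ; exact: IH.
Qed.

Lemma zksum_kop (qf : R -> C) (lam : C) ok cen lst k g nu G :
  (forall j, fourier qf j = q j) -> q 0 = 0 ->
  (forall s, w (nu - s) = if ok s then (lam - RC (cen s ^+ 2))^-1 else 0) ->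
  (forall s, g (nu - s) = q (lst s)) -> bd g G ->
  zksum (gterm qf lam ok cen lst (k := k)) = iter k (kop K) g nu.
Proof.
move=> h1 h2 h3 h4 hg; apply: clim_eq; apply: ccvg_ext (iter_bstep_cvg k nu hg) => N.
rewrite iter_bstep; apply: eq_bigr => f _; exact/esym/gterm_pterm.
Qed.

End PathSums.
Arguments conv_ker {R q w M}.
Arguments zksum_kop {R q w M}.
Arguments kop_flip {R q w M}.

(* [psis q w nu] is the solution of [psi m = sum_l q_{m-l} w_l psi_l + q_{m-nu}]; at
   [m, nu = n, -n] its values are A, A', q_{2n} + B, q_{-2n} + B' (see [Aser_psis] etc.). *)
Definition psis (R : realType) (q w : int -> R[i]) (nu m : int) : R[i] :=
  nser (fun m l => q (m - l) * w l) (fun m => q (m - nu)) m.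

(** * Identification of A, B, A', B' with values of [psis] *)

Section SeriesValues.
Variable R : realType.
Local Notation C := (R[i]).
Variables (qf : R -> C) (n : nat) (lam : C) (t M : R).

(* The weight 0 at [n] and [-n] encodes the excluded partial sums. *)
Definition wt (m : int) : C :=
  if (m == n%:Z) || (m == - n%:Z) then 0 else (lam - RC ((2 * pi * m%:~R + t) ^+ 2))^-1.

Hypotheses (n0 : (0 < n)%N) (q0 : fourier qf 0 = 0) (hq : forall j, cabs (fourier qf j) <= M)
  (hw : bsum (fun l => M * cabs (wt l)) (1 / 2)).

Let q := fourier qf.
Lemma bd_shift nu : bd (fun m => q (m - nu)) M. Proof. by move=> m; exact: hq. Qed.

Lemma wt_p s : wt (n%:Z - s) = if okp n s then (lam - RC (cenp n t s ^+ 2))^-1 else 0.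
Proof.
rewrite /wt /okp; have -> : (n%:Z - s == n%:Z) || (n%:Z - s == - n%:Z) = ~~ ((s != 0) && (s != 2 * n%:Z)).
  by apply/idP/idP; lia.
by case: (_ && _).
Qed.
Lemma wt_m s : wt (- n%:Z - s) = if okm n s then (lam - RC (cenm n t s ^+ 2))^-1 else 0.
Proof.
rewrite /wt /okm; have -> : (- n%:Z - s == n%:Z) || (- n%:Z - s == - n%:Z) = ~~ ((s != 0) && (s != - (2 * n%:Z))).
  by apply/idP/idP; lia.
(* [cenm] is minus the frequency 2 pi (-n - s) + t, and only its square enters. *)
case: (_ && _) => //=; congr (lam - RC _)^-1; rewrite /cenm -[LHS]sqrrN; congr (_ ^+ 2).
by rewrite -opprD rmorphN mulrN opprD opprK.
Qed.

Lemma Aser_psis : Aser qf n lam t = psis q wt n n.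
Proof.
rewrite /Aser (kseries_nser (conv_ker (w := wt) hq) hw (m := n) (bd_shift n%:Z)).
  by rewrite subrr [q 0]q0 subr0.
move=> k _; rewrite /a_k.
apply: (zksum_kop hq hw _ _ _ _ _ k _ _ M _ q0 wt_p _ (bd_shift n%:Z)) => // s.
by congr q; ring.
Qed.
Lemma Bser_psis : Bser qf n lam t = psis q wt (- n%:Z) n - q (2 * n%:Z).
Proof.
rewrite /Bser (kseries_nser (conv_ker (w := wt) hq) hw (m := n) (bd_shift (- n%:Z))).
  by congr (_ - q _); ring.
move=> k _; rewrite /b_k.
apply: (zksum_kop hq hw _ _ _ _ _ k _ _ M _ q0 wt_p _ (bd_shift (- n%:Z))) => // s.
by congr q; ring.
Qed.
Lemma A'ser_psis : A'ser qf n lam t = psis q wt (- n%:Z) (- n%:Z).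
Proof.
rewrite /A'ser (kseries_nser (conv_ker (w := wt) hq) hw (m := - n%:Z) (bd_shift (- n%:Z))).
  by rewrite subrr [q 0]q0 subr0.
move=> k _; rewrite /a'_k.
apply: (zksum_kop hq hw _ _ _ _ _ k _ _ M _ q0 wt_m _ (bd_shift (- n%:Z))) => // s.
by congr q; ring.
Qed.
Lemma B'ser_psis : B'ser qf n lam t = psis q wt n (- n%:Z) - q (- (2 * n%:Z)).
Proof.
rewrite /B'ser (kseries_nser (conv_ker (w := wt) hq) hw (m := - n%:Z) (bd_shift n%:Z)).
  by congr (_ - q _); ring.
move=> k _; rewrite /b'_k.
apply: (zksum_kop hq hw _ _ _ _ _ k _ _ M _ q0 wt_m _ (bd_shift n%:Z)) => // s.
by congr q; ring.
Qed.
End SeriesValues.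

(** * Primitives of integrable real functions *)

Section RealPrimitives.
Variable R : realType.
Local Notation mu := (@lebesgue_measure R).
Implicit Types (f g h : R -> R).

Definition rprim g (x : R) : R := \int[mu]_(s in `[0, x]) g s.
Definition rintegrable (A : set R) g : Prop := mu.-integrable A (EFin \o g).

Lemma sub0 b x : x <= b -> `[0, x]%classic `<=` `[0, b : R]%classic.
Proof. by move=> x1; apply: subset_itvl; rewrite bnd_simp. Qed.

Lemma rintegrableS b x g : x <= b -> rintegrable `[0, b] g -> rintegrable `[0, x] g.
Proof. by move=> xb; apply: integrableS => //; exact: sub0. Qed.

Lemma rintegrable_mfun A g : rintegrable A g -> measurable_fun A g.
Proof. by move=> h; apply/measurable_EFinP; exact: measurable_int h. Qed.

Lemma rintegrable_norm A g : rintegrable A g -> rintegrable A (fun s => `|g s|).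
Proof. exact: integrable_norm. Qed.

Lemma patch_integrable (A : set R) g : measurable A -> rintegrable A g -> rintegrable setT (g \_ A).
Proof.
move=> mA ig; rewrite /rintegrable (_ : EFin \o _ = (EFin \o g) \_ A); last first.
  by apply/funext => s; rewrite /= /patch; case: ifP.
by apply/(integrable_mkcond _ _).1.
Qed.

Lemma rprim_bd g b x : rintegrable `[0, b] g -> x <= b ->
  `|rprim g x| <= \int[mu]_(s in `[0, b]) `|g s|.
Proof.
move=> ig xb; apply: le_trans (le_normr_Rintegral _ (rintegrableS xb ig)) _ => //.
have ia := rintegrable_norm ig.
rewrite Rintegral_mkcond [leRHS]Rintegral_mkcond.
apply: le_Rintegral => //.
- by apply: patch_integrable => //; exact: rintegrableS xb ia.
- exact: patch_integrable.
- move=> s _; rewrite /patch /=; case: ifPn => [|_]; last by case: ifP => _ //; exact: normr_ge0.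
  by rewrite inE => /(sub0 xb) h; rewrite mem_set.
Qed.

Lemma rprim_measurable g b : 0 <= b -> rintegrable `[0, b] g -> measurable_fun `[0, b] (rprim g).
Proof.
move=> b0 ig; apply: subspace_continuous_measurable_fun => //.
exact: parameterized_integral_continuous.
Qed.

Lemma mul_bounded_integrable f g (A : set R) (B : R) : measurable A -> rintegrable A g ->
  measurable_fun A f -> (forall x, A x -> `|f x| <= B) ->
  rintegrable A (fun x => g x * f x).
Proof.
move=> mA ig mf hB.
have mg := rintegrable_mfun ig.
have iB : mu.-integrable A (fun x => B%:E * (`|g x|%R)%:E)%E.
  by apply: integrableZl => //; exact: integrable_norm.
apply: le_integrable iB => //.
  by apply/measurable_EFinP; exact: measurable_funM.
move=> x Ax; rewrite /= lee_fin normrM normrM normr_id mulrC ler_wpM2r //.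
exact: le_trans (hB _ Ax) (ler_norm _).
Qed.

Lemma integral_Zpatch (c : R) f (A : set R) : measurable A -> rintegrable A f ->
  (\int[mu]_y (c * (f \_ A) y)%:E)%E = (c * \int[mu]_(y in A) f y)%:E.
Proof.
move=> mA ifA; under eq_integral do rewrite EFinM.
have ip := patch_integrable mA ifA.
rewrite integralZl // EFinM; congr (_ * _)%E.
rewrite Rintegral_mkcond /Rintegral fineK //.
exact: integrable_fin_num ip.
Qed.

(** Fubini for g(s) h(r) on the triangle r <= s of [0, x]^2: integrating first in r gives the left
    side, first in s the right side. The primitives are only absolutely continuous, so no pointwise
    derivative is used. *)
Lemma rprim_parts g h x : 0 <= x -> rintegrable `[0, x] g -> rintegrable `[0, x] h ->
  \int[mu]_(s in `[0, x]) (g s * rprim h s) =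
  rprim g x * rprim h x - \int[mu]_(r in `[0, x]) (h r * rprim g r).
Proof.
move=> x0 ig ih.
pose g' := g \_ `[0, x]; pose h' := h \_ `[0, x].
have ig' : rintegrable setT g' by apply: patch_integrable.
have ih' : rintegrable setT h' by apply: patch_integrable.
have mg' := rintegrable_mfun ig'; have mh' := rintegrable_mfun ih'.
(* The triangle is encoded by the last factor, so that Fubini can be applied on the whole plane. *)
pose F (p : R * R) := (g' p.1 * h' p.2 * (p.2 <= p.1)%R%:R)%:E.
have mF : measurable_fun setT F.
  apply/measurable_EFinP; apply: measurable_funM; first apply: measurable_funM.
  - exact: measurableT_comp mg' _.
  - exact: measurableT_comp mh' _.
  - rewrite (_ : (fun p : R * R => _) = (fun p => if p.2 <= p.1 then 1 else 0)); last first.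
      by apply/funext => p; case: ifP.
    by apply: measurable_fun_ifT => //; exact: measurable_fun_ler.
have iF : (mu \x mu)%E.-integrable setT F.
  apply/integrable12ltyP => //.
  pose c : R := \int[mu]_r `|h' r|.
  have hc s : (\int[mu]_r `|F (s, r)| <= (`|g' s| * c)%:E)%E.
    rewrite EFinM /c /Rintegral fineK; last by apply: integrable_fin_num => //; exact: rintegrable_norm.
    rewrite -ge0_integralZl_EFin; [|by []|by move=> r _; rewrite lee_fin| |by []]; last first.
      by apply/measurable_EFinP; exact: measurableT_comp mh'.
    apply: ge0_le_integral => //.
    - by apply: measurableT_comp => //; apply: (measurableT_comp mF); exact: measurable_pair1.
    - apply/measurable_EFinP; apply: measurable_funM => //; exact: measurableT_comp mh'.
    - move=> r _; rewrite /F /= -EFinM lee_fin !normrM.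
      by rewrite ler_piMr ?mulr_ge0 //; case: (r <= s); rewrite ?normr1 ?normr0 ?ler01.
  apply: (@le_lt_trans _ _ (\int[mu]_s (`|g' s| * c)%:E)%E).
    apply: ge0_le_integral => //.
    - by move=> s _; apply: integral_ge0.
    - have mF' : measurable_fun setT (abse \o F) by exact: measurableT_comp.
      exact: (@measurable_fun_fubini_tonelli_F _ _ _ _ _ mu (abse \o F) mF' (fun=> abse_ge0 _)).
    - by apply/measurable_EFinP; apply: measurable_funM => //; exact: measurableT_comp mg'.
  have : rintegrable setT (fun s => `|g' s| * c).
    apply: (@mul_bounded_integrable (fun=> c) _ _ `|c|) => //; exact: rintegrable_norm.
  by move=> /(integrable_fin_num measurableT) /fin_numPlt /andP[].
have E1 s : (\int[mu]_r F (s, r))%E = ((EFin \o (fun s => g s * rprim h s)) \_ `[0, x]) s.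
  rewrite /patch; case: ifPn => [|sD]; rewrite ?inE /=; last first.
    rewrite (eq_integral (fun=> 0%E)) ?integral0 // => r _.
    by rewrite /F /g' /= /patch (negbTE sD) !mul0r.
  move=> /= hs; have /andP[s0 sx] : 0 <= s <= x by move: hs; rewrite in_itv.
  rewrite -(integral_Zpatch (g s) _ (rintegrableS sx ih)) //; apply: eq_integral => r _.
  rewrite /F /g' /h' /= /patch mem_set //= -mulrA; congr (_ * _)%:E.
  rewrite !mem_setE !in_itv /=; case: (leP 0 r) => //= r0; last by rewrite mul0r.
  case: (leP r s) => rs; last by rewrite mulr0.
  by rewrite (le_trans rs sx) mulr1.
have E2 r : (\int[mu]_s F (s, r))%E =
    ((EFin \o (fun r => h r * (rprim g x - rprim g r))) \_ `[0, x]) r.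
  rewrite /patch; case: ifPn => [|rD]; rewrite ?inE /=; last first.
    rewrite (eq_integral (fun=> 0%E)) ?integral0 // => s _.
    have h0 : h' r = 0 by rewrite /h' /patch (negbTE rD).
    by rewrite /F /= h0 mulr0 mul0r.
  move=> /= hr; have /andP[r0 rx] : 0 <= r <= x by move: hr; rewrite in_itv.
  have irx : rintegrable `[r, x] g.
    by apply: integrableS ig => //; apply: subset_itvr; rewrite bnd_simp.
  rewrite /rprim Rintegral_itvB ?bnd_simp // Rintegral_itv_obnd_cbnd; last first.
    by apply: integrableS irx => //; apply: subset_itvr; rewrite bnd_simp.
  rewrite -(integral_Zpatch (h r) _ irx) //; apply: eq_integral => s _.
  rewrite /F /g' /h' /= /patch !mem_setE !in_itv /= r0 rx /= mulrAC mulrC; congr (_ * _)%:E.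
  have pt : (point : R) = 0 by [].
  case: (leP s x) => //= sx; rewrite ?andbF ?andbT; last by rewrite pt mul0r.
  case: (leP r s) => rs; last by rewrite mulr0.
  by rewrite (le_trans r0 rs) mulr1.
have mG : measurable_fun `[0, x] (rprim g) := rprim_measurable x0 ig.
have bG : forall y, `[0, x]%classic y -> `|rprim g y| <= \int[mu]_(s in `[0, x]) `|g s|.
  by move=> y; rewrite /= in_itv /= => /andP[_ yx]; exact: rprim_bd.
have ihG := mul_bounded_integrable (measurable_itv _) ih mG bG.
have := Fubini iF.
have -> : (\int[mu]_s \int[mu]_r F (s, r))%E = (\int[mu]_(s in `[0%R, x]) (g s * rprim h s)%:E)%E.
  by rewrite [RHS]integral_mkcond; apply: eq_integral => s1 _; exact: E1.
have -> : (\int[mu]_r \int[mu]_s F (s, r))%E =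
    (\int[mu]_(r in `[0%R, x]) (h r * (rprim g x - rprim g r))%:E)%E.
  by rewrite [RHS]integral_mkcond; apply: eq_integral => r1 _; exact: E2.
move=> /(congr1 fine).
rewrite -[LHS]/(\int[mu]_(s in `[0, x]) (g s * rprim h s)) => ->.
rewrite -[LHS]/(\int[mu]_(r in `[0, x]) (h r * (rprim g x - rprim g r))).
under eq_Rintegral do rewrite mulrBr.
rewrite RintegralB //; last first.
  by apply: (@mul_bounded_integrable (fun=> rprim g x) h `[0, x]%classic `|rprim g x|).
by rewrite RintegralZr // mulrC.
Qed.
End RealPrimitives.

(** * Complex integrals, bounded measurable functions and products of primitives *)

Section ComplexIntegral.
Variable R : realType.
Local Notation C := (R[i]).
Local Notation mu := (@lebesgue_measure R).
Local Notation Re := complex.Re.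
Local Notation Im := complex.Im.
Implicit Types (f g h y : R -> C) (A : set (measurableTypeR R)) (c z : C).

Lemma cintegrableD A f g : measurable A -> cintegrable A f -> cintegrable A g ->
  cintegrable A (fun x => f x + g x).
Proof.
move=> mA [f1 f2] [g1 g2]; split.
- have := integrableD (mu := mu) mA f1 g1; apply: eq_integrable => // x _ /=.
  by rewrite cReD EFinD.
- have := integrableD (mu := mu) mA f2 g2; apply: eq_integrable => // x _ /=.
  by rewrite cImD EFinD.
Qed.
Lemma cintegrableZ A f c : measurable A -> cintegrable A f -> cintegrable A (fun x => c * f x).
Proof.
move=> mA [f1 f2]; split.
- have := integrableB (mu := mu) mA (integrableZl (mu := mu) mA (Re c) f1) (integrableZl (mu := mu) mA (Im c) f2).
  by apply: eq_integrable => // x _; rewrite /comp; cbv beta; rewrite cReM EFinB !EFinM.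
- have := integrableD (mu := mu) mA (integrableZl (mu := mu) mA (Re c) f2) (integrableZl (mu := mu) mA (Im c) f1).
  by apply: eq_integrable => // x _; rewrite /comp; cbv beta; rewrite cImM EFinD !EFinM.
Qed.

Lemma cintD A f g : measurable A -> cintegrable A f -> cintegrable A g ->
  cint A (fun x => f x + g x) = cint A f + cint A g.
Proof.
move=> mA [f1 f2] [g1 g2]; apply: cplx_eq => /=.
- by rewrite -RintegralD //; apply: eq_Rintegral => x _; rewrite cReD.
- by rewrite -RintegralD //; apply: eq_Rintegral => x _; rewrite cImD.
Qed.
Lemma cintZ A f c : measurable A -> cintegrable A f -> cint A (fun x => c * f x) = c * cint A f.
Proof.
move=> mA [f1 f2]; apply: cplx_eq; rewrite ?cReM ?cImM /=.
- rewrite -!RintegralZl // -RintegralB //; last 2 first.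
  + exact: (integrableZl (mu := mu) mA (Re c) f1).
  + exact: (integrableZl (mu := mu) mA (Im c) f2).
  by apply: eq_Rintegral => x _; rewrite cReM.
- rewrite -!RintegralZl // -RintegralD //; last 2 first.
  + exact: (integrableZl (mu := mu) mA (Re c) f2).
  + exact: (integrableZl (mu := mu) mA (Im c) f1).
  by apply: eq_Rintegral => x _; rewrite cImM.
Qed.
Lemma cint_eq A f g : (forall x, A x -> f x = g x) -> cint A f = cint A g.
Proof.
move=> h; apply: cplx_eq => /=; apply: eq_Rintegral => x; rewrite inE => Ax; by rewrite h.
Qed.
Lemma cintegrable_eq A f g : measurable A -> (forall x, A x -> f x = g x) -> cintegrable A f -> cintegrable A g.
Proof.
move=> mA h [f1 f2]; split.
- by apply: (@eq_integrable _ _ _ mu A mA _ _ _ f1) => x; rewrite inE /= => Ax; rewrite h.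
- by apply: (@eq_integrable _ _ _ mu A mA _ _ _ f2) => x; rewrite inE /= => Ax; rewrite h.
Qed.
Lemma cintegrableN A f : measurable A -> cintegrable A f -> cintegrable A (fun x => - f x).
Proof.
by move=> mA hf; apply: cintegrable_eq (cintegrableZ (-1) mA hf) => // x _; rewrite mulN1r.
Qed.
Lemma cintN A f : measurable A -> cintegrable A f -> cint A (fun x => - f x) = - cint A f.
Proof.
move=> mA hf; rewrite -mulN1r -cintZ //; apply: cint_eq => x _; by rewrite mulN1r.
Qed.
Lemma cintegrableB A f g : measurable A -> cintegrable A f -> cintegrable A g ->
  cintegrable A (fun x => f x - g x).
Proof. by move=> mA hf hg; apply: cintegrableD mA hf (cintegrableN mA hg). Qed.
Lemma cintB A f g : measurable A -> cintegrable A f -> cintegrable A g ->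
  cint A (fun x => f x - g x) = cint A f - cint A g.
Proof. by move=> mA hf hg; rewrite cintD ?cintN //; exact: cintegrableN. Qed.
Lemma cintegrable0 A : measurable A -> cintegrable A (fun=> 0 : C).
Proof. by move=> mA; split; apply: (@integrable0 _ _ _ mu A). Qed.
Lemma cintegrable_sum A (I : Type) (r : seq I) (F : I -> R -> C) : measurable A ->
  (forall i, cintegrable A (F i)) -> cintegrable A (fun x => \sum_(i <- r) F i x).
Proof.
move=> mA h; elim: r => [|i0 r IH].
  by apply: cintegrable_eq (cintegrable0 mA) => // x _; rewrite big_nil.
by apply: cintegrable_eq (cintegrableD mA (h i0) IH) => // x _; rewrite big_cons.
Qed.
Lemma cint0 A : cint A (fun=> 0 : C) = 0.
Proof.
by apply: cplx_eq; rewrite /= /Rintegral integral0_eq.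
Qed.
Lemma cint_sum A (I : Type) (r : seq I) (F : I -> R -> C) : measurable A ->
  (forall i, cintegrable A (F i)) ->
  cint A (fun x => \sum_(i <- r) F i x) = \sum_(i <- r) cint A (F i).
Proof.
move=> mA h; elim: r => [|i0 r IH].
  by rewrite big_nil -[RHS](cint0 A); apply: cint_eq => x _; rewrite big_nil.
rewrite big_cons -IH -cintD //; last exact: cintegrable_sum.
by apply: cint_eq => x _; rewrite big_cons.
Qed.

Local Notation I01 := (`[0, 1]%classic : set R).
Lemma mI01 : measurable (I01 : set (measurableTypeR R)). Proof. exact: measurable_itv. Qed.
Lemma I01P x : I01 x <-> 0 <= x <= 1. Proof. by rewrite /= in_itv. Qed.

Lemma cintegrableS f x : x <= 1 -> cintegrable I01 f -> cintegrable `[0, x] f.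
Proof. by move=> x1 [f1 f2]; split; exact: (rintegrableS x1). Qed.

Definition cmeas f := measurable_fun I01 (fun x => Re (f x)) /\ measurable_fun I01 (fun x => Im (f x)).
Definition bmf f (B : R) := cmeas f /\ forall x, 0 <= x <= 1 -> cabs (f x) <= B.

Lemma cintegrable_meas f : cintegrable I01 f -> cmeas f.
Proof. by move=> [f1 f2]; split; exact: rintegrable_mfun. Qed.

Lemma bmf_ge0 f B : bmf f B -> 0 <= B.
Proof. by move=> [_ /(_ 0)]; rewrite lexx ler01 => /(_ isT); apply: le_trans; exact: cabs_ge0. Qed.

Lemma cmeas_eq f g : (forall x, 0 <= x <= 1 -> f x = g x) -> cmeas f -> cmeas g.
Proof.
move=> h [h1 h2]; split.
- by apply: eq_measurable_fun h1 => x; rewrite inE => /I01P /h ->.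
- by apply: eq_measurable_fun h2 => x; rewrite inE => /I01P /h ->.
Qed.

Lemma cmeasM f g : cmeas f -> cmeas g -> cmeas (fun x => f x * g x).
Proof.
move=> [f1 f2] [g1 g2]; split.
- have -> : (fun x => Re (f x * g x)) = (fun x => Re (f x) * Re (g x) - Im (f x) * Im (g x)).
    by apply: funext => x; rewrite cReM.
  by apply: measurable_funB; apply: measurable_funM.
- have -> : (fun x => Im (f x * g x)) = (fun x => Re (f x) * Im (g x) + Im (f x) * Re (g x)).
    by apply: funext => x; rewrite cImM.
  by apply: measurable_funD; apply: measurable_funM.
Qed.
Lemma cmeasD f g : cmeas f -> cmeas g -> cmeas (fun x => f x + g x).
Proof.
move=> [f1 f2] [g1 g2]; split.
- have -> : (fun x => Re (f x + g x)) = (fun x => Re (f x) + Re (g x)).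
    by apply: funext => x; rewrite cReD.
  exact: measurable_funD.
- have -> : (fun x => Im (f x + g x)) = (fun x => Im (f x) + Im (g x)).
    by apply: funext => x; rewrite cImD.
  exact: measurable_funD.
Qed.
Lemma cmeas_cst c : cmeas (fun=> c).
Proof. by split; exact: measurable_cst. Qed.
Lemma cmeas_conj f : cmeas f -> cmeas (fun x => (f x)^*%C).
Proof.
move=> [f1 f2]; split.
- have -> // : (fun x => Re (f x)^*%C) = (fun x => Re (f x)).
  by apply: funext => x; rewrite cReC.
- have -> : (fun x => Im (f x)^*%C) = (fun x => - Im (f x)).
    by apply: funext => x; rewrite cImC.
  exact: measurable_funN.
Qed.

Lemma bmfM f g B B' : bmf f B -> bmf g B' -> bmf (fun x => f x * g x) (B * B').
Proof.
move=> [f1 f2] [g1 g2]; split; first exact: cmeasM.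
by move=> x x01; rewrite cabsM ler_pM ?cabs_ge0 ?f2 ?g2.
Qed.
Lemma bmfD f g B B' : bmf f B -> bmf g B' -> bmf (fun x => f x + g x) (B + B').
Proof.
move=> [f1 f2] [g1 g2]; split; first exact: cmeasD.
by move=> x x01; apply: le_trans (cabsD _ _) _; rewrite lerD ?f2 ?g2.
Qed.
Lemma bmf_cst c : bmf (fun=> c) (cabs c).
Proof. by split => //; exact: cmeas_cst. Qed.
Lemma bmfZ c f B : bmf f B -> bmf (fun x => c * f x) (cabs c * B).
Proof. exact: bmfM (bmf_cst c). Qed.
Lemma bmfB f g B B' : bmf f B -> bmf g B' -> bmf (fun x => f x - g x) (B + B').
Proof.
move=> hf hg; have := bmfD hf (bmfZ (-1) hg); rewrite cabsN cabs1 mul1r => -[h1 h2].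
split; first by apply: cmeas_eq h1 => x _; rewrite mulN1r.
by move=> x x01; rewrite -mulN1r; exact: h2.
Qed.
Lemma cabs_conj z : cabs (z^*)%C = cabs z.
Proof. by rewrite /cabs cReC cImC sqrrN. Qed.
Lemma bmf_conj f B : bmf f B -> bmf (fun x => (f x)^*%C) B.
Proof.
by move=> [f1 f2]; split; [exact: cmeas_conj|move=> x x01; rewrite cabs_conj; exact: f2].
Qed.
Lemma bmf_sum (I : Type) (r : seq I) (F : I -> R -> C) (B : I -> R) :
  (forall i, bmf (F i) (B i)) -> bmf (fun x => \sum_(i <- r) F i x) (\sum_(i <- r) B i).
Proof.
move=> h; elim: r => [|i0 r [IH1 IH2]].
  split; first by apply: cmeas_eq (cmeas_cst 0) => x _; rewrite big_nil.
  by move=> x _; rewrite !big_nil cabs0.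
have [h1 h2] := bmfD (h i0) (conj IH1 IH2).
split; first by apply: cmeas_eq h1 => x _; rewrite big_cons.
by move=> x x01; rewrite !big_cons; exact: h2.
Qed.

Lemma cexpi_cmeas (a : R) : cmeas (fun x => cexpi (a * x)).
Proof.
split => /=; apply: measurable_funTS; apply: continuous_measurable_fun => x.
- apply: (@continuous_comp _ _ _ (fun x => a * x) (@cos R)); last exact: continuous_cos.
  exact: mulrl_continuous.
- apply: (@continuous_comp _ _ _ (fun x => a * x) (@sin R)); last exact: continuous_sin.
  exact: mulrl_continuous.
Qed.
Lemma cexpi_bmf (a : R) : bmf (fun x => cexpi (a * x)) 1.
Proof. by split; [exact: cexpi_cmeas|move=> x _; rewrite cabs_cexpi]. Qed.

(** An equivalent of the L1 norm that avoids integrating the modulus. Treating real and imaginary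
    parts separately is the source of the factors 2 in the bounds with [n1]. *)
Definition n1 f : R := \int[mu]_(x in I01) (`|Re (f x)| + `|Im (f x)|).

Lemma n1_integrable f : cintegrable I01 f -> rintegrable I01 (fun x => `|Re (f x)| + `|Im (f x)|).
Proof.
move=> [f1 f2]; have := integrableD (mu := mu) mI01 (rintegrable_norm f1) (rintegrable_norm f2).
by apply: eq_integrable => // x _; rewrite /= EFinD.
Qed.
Lemma n1_ge0 f : 0 <= n1 f.
Proof. by apply: Rintegral_ge0 => x _; apply: addr_ge0. Qed.

Lemma rintegrable_cst (b a : R) : rintegrable `[0, b] (fun=> a).
Proof.
apply: (@continuous_compact_integrable R (fun=> a) `[0, b]%classic); first exact: segment_compact.
by move=> x; exact: cst_continuous.
Qed.

Lemma bmf_rintegrable (f : R -> R) B : measurable_fun I01 f ->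
  (forall x, 0 <= x <= 1 -> `|f x| <= B) -> rintegrable I01 f.
Proof.
move=> mf hB; have -> : f = (fun x => (fun=> 1) x * f x) by apply: funext => x; rewrite mul1r.
apply: (mul_bounded_integrable mI01 (rintegrable_cst 1 1) mf (B := B)) => x /I01P; exact: hB.
Qed.

Lemma bmf_integrable f B : bmf f B -> cintegrable I01 f.
Proof.
move=> [[f1 f2] hB]; split; apply: (bmf_rintegrable (B := B)) => // x /hB; apply: le_trans.
- exact: Re_le_cabs.
- exact: Im_le_cabs.
Qed.

Lemma cintegrableM f g B : cintegrable I01 f -> bmf g B -> cintegrable I01 (fun x => f x * g x).
Proof.
move=> [f1 f2] [[g1 g2] hB].
have hr x : I01 x -> `|Re (g x)| <= B by move=> /I01P /hB; apply: le_trans; exact: Re_le_cabs.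
have hi x : I01 x -> `|Im (g x)| <= B by move=> /I01P /hB; apply: le_trans; exact: Im_le_cabs.
have i11 := mul_bounded_integrable mI01 f1 g1 hr; have i12 := mul_bounded_integrable mI01 f1 g2 hi.
have i21 := mul_bounded_integrable mI01 f2 g1 hr; have i22 := mul_bounded_integrable mI01 f2 g2 hi.
split.
- apply: (@eq_integrable _ _ _ mu I01 mI01 _ _ _ (integrableB (mu := mu) mI01 i11 i22)) => x _.
  by rewrite /comp cReM EFinB.
- apply: (@eq_integrable _ _ _ mu I01 mI01 _ _ _ (integrableD (mu := mu) mI01 i12 i21)) => x _.
  by rewrite /comp cImM EFinD.
Qed.

Lemma cint_bound f g B : cintegrable I01 f -> bmf g B ->
  cabs (cint I01 (fun x => f x * g x)) <= 2 * B * n1 f.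
Proof.
move=> hf hg; have B0 := bmf_ge0 hg; have [i1 i2] := cintegrableM hf hg.
have key (h : R -> R) : rintegrable I01 h -> (forall x, I01 x -> `|h x| <= cabs (f x * g x)) ->
    `|\int[mu]_(x in I01) h x| <= B * n1 f.
  move=> ih hh; apply: le_trans (le_normr_Rintegral (mu := mu) mI01 ih) _.
  rewrite /n1 -RintegralZl //; last exact: n1_integrable.
  apply: le_Rintegral => //; first exact: rintegrable_norm.
    exact: (integrableZl (mu := mu) mI01 B (n1_integrable hf)).
  move=> x Ix; apply: le_trans (hh x Ix) _; rewrite cabsM mulrC.
  by apply: ler_pM; rewrite ?cabs_ge0 ?cabs_le_ReIm // hg.2 //; apply/I01P.
apply: le_trans (cabs_le_ReIm _) _.
have h1 : `|\int[mu]_(x in I01) Re (f x * g x)| <= B * n1 f.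
  by apply: key => // x _; exact: Re_le_cabs.
have h2 : `|\int[mu]_(x in I01) Im (f x * g x)| <= B * n1 f.
  by apply: key => // x _; exact: Im_le_cabs.
by rewrite /=; lra.
Qed.

Lemma cint_bmf_bound f B : bmf f B -> cabs (cint I01 f) <= 4 * B.
Proof.
move=> hf; have h1 : cintegrable I01 (fun=> 1 : C) by apply: bmf_integrable (bmf_cst 1).
have := cint_bound h1 hf; rewrite (cint_eq (g := f)); last by move=> x _; rewrite mul1r.
have -> : n1 (fun=> 1 : C) = 1.
  rewrite /n1 /= normr1 normr0 addr0 Rintegral_cst //= lebesgue_measure_itv /= lte_fin ltr01.
  by rewrite /= !mul1r subr0.
by have := bmf_ge0 hf; lra.
Qed.

Definition cprm g (x : R) : C := cint `[0, x] g.

Lemma cprm_bmf g : cintegrable I01 g -> bmf (cprm g) (2 * n1 g).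
Proof.
move=> [g1 g2]; split; first by split; apply: rprim_measurable.
move=> x /andP[x0 x1]; apply: le_trans (cabs_le_ReIm _) _.
have h (k : R -> R) : rintegrable I01 k -> (forall x, `|k x| <= `|Re (g x)| + `|Im (g x)|) ->
    `|rprim k x| <= n1 g.
  move=> ik hk; apply: le_trans (rprim_bd ik x1) _.
  by apply: le_Rintegral => //; [exact: rintegrable_norm|exact: n1_integrable].
have : `|rprim (fun x => Re (g x)) x| <= n1 g by apply: h => // s; rewrite lerDl.
have : `|rprim (fun x => Im (g x)) x| <= n1 g by apply: h => // s; rewrite lerDr.
rewrite /cprm /cint /=; rewrite /rprim; lra.
Qed.

Lemma cprm_parts g h x : 0 <= x <= 1 -> cintegrable I01 g -> cintegrable I01 h ->
  cint `[0, x] (fun s => g s * cprm h s) + cint `[0, x] (fun s => h s * cprm g s) =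
  cprm g x * cprm h x.
Proof.
move=> /andP[x0 x1] ig ih.
have := cintegrableS x1 (cintegrableM ig (cprm_bmf ih)).
have := cintegrableS x1 (cintegrableM ih (cprm_bmf ig)).
have [g1 g2] := cintegrableS x1 ig; have [h1 h2] := cintegrableS x1 ih.
have mI : measurable (`[0, x]%classic : set (measurableTypeR R)) by exact: measurable_itv.
have pr (k l : R -> R) : rintegrable `[0, x] k -> rintegrable `[0, x] l ->
   rintegrable `[0, x] (fun s => k s * rprim l s).
  move=> ik il; apply: (mul_bounded_integrable mI ik (rprim_measurable x0 il)
    (B := \int[mu]_(s in `[0, x]) `|l s|)) => y.
  by rewrite /= in_itv /= => /andP[_ yx]; exact: (rprim_bd il yx).
have P (k l : R -> R) (ik : rintegrable `[0, x] k) (il : rintegrable `[0, x] l) := rprim_parts x0 ik il.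
move=> _ _.
have eR (k l : R -> C) : cintegrable `[0, x] k -> cintegrable `[0, x] l ->
    \int[mu]_(s in `[0, x]) Re (k s * cprm l s) =
    \int[mu]_(s in `[0, x]) (Re (k s) * rprim (fun u => Re (l u)) s)
    - \int[mu]_(s in `[0, x]) (Im (k s) * rprim (fun u => Im (l u)) s).
  move=> [k1 k2] [l1 l2]; rewrite -(RintegralB mI (pr _ _ k1 l1) (pr _ _ k2 l2)).
  by apply: eq_Rintegral => s _; rewrite cReM.
have eI (k l : R -> C) : cintegrable `[0, x] k -> cintegrable `[0, x] l ->
    \int[mu]_(s in `[0, x]) Im (k s * cprm l s) =
    \int[mu]_(s in `[0, x]) (Re (k s) * rprim (fun u => Im (l u)) s)
    + \int[mu]_(s in `[0, x]) (Im (k s) * rprim (fun u => Re (l u)) s).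
  move=> [k1 k2] [l1 l2]; rewrite -(RintegralD mI (pr _ _ k1 l2) (pr _ _ k2 l1)).
  by apply: eq_Rintegral => s _; rewrite cImM.
have ikg : cintegrable `[0, x] g by []; have ikh : cintegrable `[0, x] h by [].
apply: cplx_eq; rewrite ?cReD ?cImD ?cReM ?cImM.
- rewrite [Re (cint _ _)](eR g h ikg ikh) [X in _ + X](eR h g ikh ikg).
  rewrite (P _ _ g1 h1) (P _ _ g2 h2); rewrite /cprm /cint /rprim /=; ring.
- rewrite [Im (cint _ _)](eI g h ikg ikh) [X in _ + X](eI h g ikh ikg).
  rewrite (P _ _ g1 h2) (P _ _ g2 h1); rewrite /cprm /cint /rprim /=; ring.
Qed.

Lemma cprimE g y x : cprim g y -> 0 <= x <= 1 -> y x = y 0 + cprm g x.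
Proof. by move=> h /h. Qed.

Lemma cprim_bmf g y : cintegrable I01 g -> cprim g y -> bmf y (cabs (y 0) + 2 * n1 g).
Proof.
move=> ig hy; have [h1 h2] := bmfD (bmf_cst (y 0)) (cprm_bmf ig).
split; first by apply: cmeas_eq h1 => x x01; rewrite (cprimE hy x01).
by move=> x x01; rewrite (cprimE hy x01); exact: h2.
Qed.

Lemma cprimM g h G H : cintegrable I01 g -> cintegrable I01 h -> cprim g G -> cprim h H ->
  cprim (fun x => g x * H x + h x * G x) (fun x => G x * H x).
Proof.
move=> ig ih hG hH x x01; have /andP[x0 x1] := x01.
rewrite (cprimE hG x01) (cprimE hH x01).
have mI : measurable (`[0, x]%classic : set (measurableTypeR R)) by exact: measurable_itv.
have igx := cintegrableS x1 ig; have ihx := cintegrableS x1 ih.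
have iA := cintegrableS x1 (cintegrableM ig (cprm_bmf ih)).
have iB := cintegrableS x1 (cintegrableM ih (cprm_bmf ig)).
have -> : cint `[0, x] (fun s => g s * H s + h s * G s) =
    cint `[0, x] (fun s => (H 0 * g s + g s * cprm h s) + (G 0 * h s + h s * cprm g s)).
  apply: cint_eq => s; rewrite /= in_itv /= => /andP[s0 sx].
  have s01 : 0 <= s <= 1 by rewrite s0 (le_trans sx x1).
  by rewrite (cprimE hG s01) (cprimE hH s01); ring.
rewrite !cintD ?cintZ //; try (apply: cintegrableD => //); try exact: cintegrableZ.
rewrite mulrDl !mulrDr -(cprm_parts x01 ig ih) /cprm; ring.
Qed.

Lemma cprim_cexpi (a : R) :
  cprim (fun x => complex.Complex 0 a * cexpi (a * x)) (fun x => cexpi (a * x)).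
Proof.
move=> x /andP[x0 x1]; rewrite mulr0 cexpi0.
have dm (v : R) : is_derive v 1 (fun u => a * u) a.
  have := @is_deriveZ _ _ _ id a v 1 1 (is_derive_id v 1).
  by rewrite /GRing.scale /= mulr1.
(* The fundamental theorem of calculus invoked below needs a nondegenerate interval, so x = 0 is
   settled first. *)
move: x0; rewrite le_eqVlt => /predU1P[<-|x0].
  rewrite mulr0 cexpi0 set_itv1; apply: cplx_eq; rewrite ?cReD ?cImD /= Rintegral_set1; ring.
have cA (k : R -> R) : continuous k -> continuous (fun v => k (a * v)).
  move=> ck v; apply: (@continuous_comp _ _ _ (fun u => a * u) k); last exact: ck.
  exact: mulrl_continuous.
have F2 (f F : R -> R) : continuous f -> (forall v : R, is_derive v (1 : R) F (f v)) ->
    \int[mu]_(v in `[0, x]) f v = F x - F 0.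
  move=> cf dF; rewrite /Rintegral (@continuous_FTC2 _ f F 0 x) //.
  - by apply: continuous_subspaceT.
  - have cF : continuous F by move=> v; apply: differentiable_continuous; apply/derivable1_diffP; exact: (@ex_derive _ _ _ _ _ _ _ (dF v)).
    split; first by move=> v _; exact: (@ex_derive _ _ _ _ _ _ _ (dF v)).
    + by apply: cvg_at_right_filter; exact: cF.
    + by apply: cvg_at_left_filter; exact: cF.
  - by move=> v _; rewrite derive1E; apply: derive_val.
have d1 (v : R) : is_derive v (1 : R) (fun u => cos (a * u)) (- a * sin (a * v)).
  have := is_derive1_comp (is_derive_cos (a * v)) (dm v).
  by rewrite mulrC mulNr mulrN.
have d2 (v : R) : is_derive v (1 : R) (fun u => sin (a * u)) (a * cos (a * v)).
  by have := is_derive1_comp (is_derive_sin (a * v)) (dm v); rewrite mulrC.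
have cZ (b : R) (k : R -> R) : continuous k -> continuous (fun v => b * k v).
  move=> ck v; apply: (@continuous_comp _ _ _ k (fun u => b * u)); first exact: ck.
  exact: mulrl_continuous.
have c1 : continuous (fun v => - a * sin (a * v)) by apply: cZ; apply: cA; exact: continuous_sin.
have c2 : continuous (fun v => a * cos (a * v)) by apply: cZ; apply: cA; exact: continuous_cos.
have e1 := F2 _ _ c1 d1; have e2 := F2 _ _ c2 d2.
rewrite mulr0 cos0 in e1; rewrite mulr0 sin0 in e2.
apply: cplx_eq; rewrite ?cReD ?cImD /=.
- rewrite (@eq_Rintegral _ _ _ mu _ (fun v => - a * sin (a * v))) ?e1; first ring.
  by move=> v _; ring.
- rewrite (@eq_Rintegral _ _ _ mu _ (fun v => a * cos (a * v))) ?e2; first ring.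
  by move=> v _; ring.
Qed.

End ComplexIntegral.

(** * Fourier coefficients at the frequencies 2 pi m + t, and Bessel's inequality *)

Section FourierCoefficients.
Variable R : realType.
Local Notation C := (R[i]).
Local Notation mu := (@lebesgue_measure R).
Local Notation Re := complex.Re.
Local Notation Im := complex.Im.
Local Notation I01 := (`[0, 1]%classic : set R).
Implicit Types (f g h y : R -> C) (c : C).

Definition tco y (a : R) : C := cint I01 (fun x => y x * cexpi (- (a * x))).
Definition fr (t : R) (m : int) : R := 2 * pi * m%:~R + t.

Lemma fourierE f m : fourier f m = tco f (fr 0 m).
Proof. by rewrite /fr addr0. Qed.


Lemma cexpiN_bmf (a : R) : bmf (fun x => cexpi (- (a * x))) 1.
Proof.
have [h1 h2] := cexpi_bmf (- a); split; first by apply: cmeas_eq h1 => x _; rewrite mulNr.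
by move=> x _; rewrite cabs_cexpi.
Qed.

Lemma tco_integrable f a : cintegrable I01 f -> cintegrable I01 (fun x => f x * cexpi (- (a * x))).
Proof. by move=> hf; exact: cintegrableM hf (cexpiN_bmf a). Qed.

Lemma tcoD f g a : cintegrable I01 f -> cintegrable I01 g ->
  tco (fun x => f x + g x) a = tco f a + tco g a.
Proof.
move=> hf hg; rewrite /tco -(cintD (@mI01 R) (tco_integrable a hf) (tco_integrable a hg)).
by apply: cint_eq => x _; rewrite mulrDl.
Qed.
Lemma tcoZ f c a : cintegrable I01 f -> tco (fun x => c * f x) a = c * tco f a.
Proof.
move=> hf; rewrite /tco -(cintZ c (@mI01 R) (tco_integrable a hf)).
by apply: cint_eq => x _; rewrite mulrA.
Qed.
Lemma tcoB f g a : cintegrable I01 f -> cintegrable I01 g ->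
  tco (fun x => f x - g x) a = tco f a - tco g a.
Proof.
move=> hf hg; rewrite /tco -(cintB (@mI01 R) (tco_integrable a hf) (tco_integrable a hg)).
by apply: cint_eq => x _; rewrite mulrBl.
Qed.
Lemma tco_sum (I : Type) (r : seq I) (F : I -> R -> C) a : (forall i, cintegrable I01 (F i)) ->
  tco (fun x => \sum_(i <- r) F i x) a = \sum_(i <- r) tco (F i) a.
Proof.
move=> hF; rewrite /tco -(cint_sum _ (@mI01 R) (fun i => tco_integrable a (hF i))).
by apply: cint_eq => x _; rewrite mulr_suml.
Qed.
Lemma tco_eq f g a : (forall x, 0 <= x <= 1 -> f x = g x) -> tco f a = tco g a.
Proof. by move=> h; apply: cint_eq => x /I01P /h ->. Qed.
Lemma tco_bound f a : cintegrable I01 f -> cabs (tco f a) <= 2 * n1 f.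
Proof.
by move=> hf; have := cint_bound hf (cexpiN_bmf a); rewrite mulr1.
Qed.
Lemma tco_shift f a b : tco (fun x => f x * cexpi (- (b * x))) a = tco f (b + a).
Proof.
by apply: cint_eq => x _; rewrite -mulrA -cexpiD mulrDl opprD.
Qed.
Lemma tco_shiftN f a b : tco (fun x => f x * cexpi (b * x)) a = tco f (a - b).
Proof.
rewrite addrC -tco_shift; apply: tco_eq => x _; by rewrite mulNr opprK.
Qed.

Lemma tco_ibp g y a : cintegrable I01 g -> cprim g y ->
  tco g a = y 1 * cexpi (- a) - y 0 + complex.Complex 0 a * tco y a.
Proof.
move=> ig hy; have hb := cprim_bmf ig hy.
have ie := bmf_integrable (bmfZ (complex.Complex 0 (- a)) (cexpi_bmf (- a))).
have h1 := cprimM ig ie hy (cprim_cexpi (- a)).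
have := h1 1 ltac:(by rewrite ler01 lexx).
rewrite mulr0 mulr1 cexpi0 mulr1 => ->.
have ->: cint I01 (fun x => g x * cexpi (- a * x) + complex.Complex 0 (- a) * cexpi (- a * x) * y x)
   = cint I01 (fun x => g x * cexpi (- (a * x)) + complex.Complex 0 (- a) * (y x * cexpi (- (a * x)))).
  by apply: cint_eq => x _; rewrite mulNr; ring.
have iy := bmf_integrable hb.
rewrite cintD; [|exact: mI01|exact: tco_integrable|]; last first.
  by apply: cintegrableZ (@mI01 R) _; exact: tco_integrable.
rewrite cintZ; [|exact: mI01|exact: tco_integrable].
rewrite -/(tco g a) -/(tco y a).
have -> : complex.Complex 0 (- a) = - complex.Complex 0 a :> C by apply: cplx_eq; rewrite /= ?oppr0.
ring.
Qed.

(** Integration by parts of the constant 1: derivative and boundary terms vanish, so the frequency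
    times the integral is 0. *)
Lemma int_cexpi (m : int) : cint I01 (fun x => cexpi (- (fr 0 m * x)) : C) = (m == 0)%:R.
Proof.
have -> : cint I01 (fun x => cexpi (- (fr 0 m * x)) : C) = tco (fun=> 1) (fr 0 m).
  by apply: cint_eq => x _; rewrite mul1r.
have h1 : cprim (fun=> 0 : C) (fun=> 1) by move=> x _; rewrite cint0 addr0.
have h2 := cintegrable0 (@mI01 R).
have := tco_ibp (fr 0 m) h2 h1.
have -> : tco (fun=> 0) (fr 0 m) = 0 by rewrite -[RHS](cint0 I01); apply: cint_eq => x _; rewrite mul0r.
have [->|m0] := eqVneq m 0.
  move=> _; rewrite /tco -[RHS](_ : cint I01 (fun=> 1 : C) = _).
    by apply: cint_eq => x _; rewrite /fr mulr0 addr0 mul0r oppr0 cexpi0 mulr1.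
  apply: cplx_eq => /=; rewrite Rintegral_cst //= lebesgue_measure_itv /= lte_fin ltr01 /=.
    by rewrite mul1r subr0.
  by rewrite mul0r.
rewrite {1}/fr addr0 -mulrN -rmorphN /= cexpi2pi mulr1 subrr add0r => /esym/eqP.
rewrite mulf_eq0 => /orP[/eqP[]/eqP|/eqP -> //].
by rewrite /fr addr0 mulf_eq0 intr_eq0 (negbTE m0) orbF mulf_eq0 pnatr_eq0 /= (gt_eqF (pi_gt0 R)).
Qed.

Lemma fourier_cst1 (m : int) : fourier (fun=> 1 : C) m = (m == 0)%:R.
Proof. by rewrite -int_cexpi fourierE; apply: cint_eq => x _; rewrite mul1r. Qed.

Lemma tco_cexpi t m k : tco (fun x => cexpi (fr t k * x)) (fr t m) = (m == k)%:R.
Proof.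
rewrite -subr_eq0 -int_cexpi; apply: cint_eq => x _; rewrite -cexpiD; congr cexpi.
by rewrite /fr rmorphB /=; ring.
Qed.

Lemma conjcD (u v : C) : ((u + v)^*)%C = (u^*)%C + (v^*)%C.
Proof. exact: (rmorphD (@conjc R)). Qed.
Lemma conjcM (u v : C) : ((u * v)^*)%C = (u^*)%C * (v^*)%C.
Proof. exact: (rmorphM (@conjc R)). Qed.

Lemma bessel g B t (s : seq int) : bmf g B -> uniq s ->
  \sum_(m <- s) cabs (tco g (fr t m)) ^+ 2 <= B ^+ 2.
Proof.
move=> hg us; have ig := bmf_integrable hg; have B0 := bmf_ge0 hg.
pose c m := tco g (fr t m).
pose P x := \sum_(m <- s) c m * cexpi (fr t m * x).
have hE m : bmf (fun x => c m * cexpi (fr t m * x)) (cabs (c m) * 1).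
  exact: bmfZ (cexpi_bmf _).
have hP : bmf P (\sum_(m <- s) cabs (c m) * 1) by exact: bmf_sum hE.
have iP := bmf_integrable hP.
pose S : R := \sum_(m <- s) cabs (c m) ^+ 2.
have cP h : cintegrable I01 h -> cint I01 (fun x => h x * (P x)^*%C) =
    \sum_(m <- s) (c m)^*%C * tco h (fr t m).
  move=> ih.
  rewrite (@cint_eq _ _ _ (fun x => \sum_(m <- s) (c m)^*%C * (h x * cexpi (- (fr t m * x))))); last first.
    move=> x _; rewrite /P (big_morph (@conjc R) conjcD (conjc0 R)) mulr_sumr; apply: eq_bigr => m _.
    by rewrite conjcM -cexpiN; ring.
  rewrite cint_sum; [|exact: mI01|by move=> m; apply: cintegrableZ (@mI01 R) _; exact: tco_integrable].
  by apply: eq_bigr => m _; rewrite cintZ //; exact: tco_integrable.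
have c1 : cint I01 (fun x => g x * (P x)^*%C) = RC S.
  rewrite (cP g ig) /S.
  have -> : RC (\sum_(m <- s) cabs (c m) ^+ 2) = \sum_(m <- s) RC (cabs (c m) ^+ 2) :> C.
    exact: (rmorph_sum (real_complex R)).
  by apply: eq_bigr => m _; rewrite -/(c m) mulrC mulcJ_abs.
have c2 : cint I01 (fun x => P x * (P x)^*%C) = RC S.
  rewrite (cP P iP) -c1 (cP g ig); apply: eq_big_seq => m ms; congr (_ * _).
  rewrite tco_sum; last by move=> k; exact: bmf_integrable (hE k).
  rewrite (bigD1_seq m) //= tcoZ; last exact: bmf_integrable (cexpi_bmf _).
  rewrite tco_cexpi eqxx mulr1 big1 ?addr0 // => k km.
  rewrite tcoZ; last exact: bmf_integrable (cexpi_bmf _).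
  by rewrite tco_cexpi eq_sym (negbTE km) mulr0.
have i1 : cintegrable I01 (fun x => g x * (P x)^*%C) by exact: cintegrableM ig (bmf_conj hP).
have i2 : cintegrable I01 (fun x => P x * (P x)^*%C) by exact: cintegrableM iP (bmf_conj hP).
have : Re (cint I01 (fun x => 2 * (g x * (P x)^*%C) - P x * (P x)^*%C)) <= B ^+ 2.
  have i3 := cintegrableB (@mI01 R) (cintegrableZ 2 (@mI01 R) i1) i2.
  have -> : B ^+ 2 = \int[mu]_(x in I01) (B ^+ 2).
    by rewrite Rintegral_cst //= lebesgue_measure_itv /= lte_fin ltr01 /= subr0 mulr1.
  apply: le_Rintegral; [exact: mI01|exact: i3.1|exact: rintegrable_cst|].
  move=> x /I01P x01; have := hg.2 x x01.
  rewrite -ler_sqr ?nnegrE ?cabs_ge0 // cabs_sqr; apply: le_trans.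
  rewrite mulcJ_abs cabs_sqr; case: (g x) => a b; case: (P x) => u v /=.
  have := sqr_ge0 (a - u); have := sqr_ge0 (b - v); rewrite !sqrrB; lra.
rewrite cintB; [|exact: mI01|exact: cintegrableZ (@mI01 R) i1|exact: i2].
rewrite cintZ; [|exact: mI01|exact: i1].
rewrite c1 c2 -/S /=; lra.
Qed.

Lemma bessel_small g B t (e : R) : bmf g B -> 0 < e ->
  exists N, forall m : int, (N < `|m|)%N -> cabs (tco g (fr t m)) <= e.
Proof.
move=> hg e0; have [ | | |N hN] := @bsum_tail R (fun m => cabs (tco g (fr t m)) ^+ 2) (B ^+ 2) (e ^+ 2).
- by move=> j; exact: sqr_ge0.
- by move=> s us; exact: bessel.
- by rewrite exprn_gt0.
exists N => m Nm; rewrite -ler_sqr ?nnegrE ?cabs_ge0 ?(ltW e0) //.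
have := hN [:: m] isT; rewrite big_seq1; apply => j.
by rewrite inE => /eqP ->.
Qed.

End FourierCoefficients.

(** * Pointwise Fourier inversion and absolutely convergent Fourier series *)

Section FourierInversion.
Variable R : realType.
Local Notation C := (R[i]).
Local Notation mu := (@lebesgue_measure R).
Local Notation Re := complex.Re.
Local Notation Im := complex.Im.
Local Notation I01 := (`[0, 1]%classic : set R).
Implicit Types (f g h y F G : R -> C) (c : C) (u : int -> C).

Lemma sin_ge_near0 : exists d : R, 0 < d /\ forall x, 0 <= x < d -> x / 2 <= sin x.
Proof.
have /cvgrPdist_lt/(_ (1 / 2)) := @continuous_cos R 0.
rewrite cos0 => /(_ ltac:(lra)) /nbhs_ballP[d /= d0 hd].
exists d; split => // x /andP[]; rewrite le_eqVlt => /predU1P[<- _|x0 xd].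
  by rewrite sin0 mul0r.
have [|z] := @MVT R (@sin R) (@cos R) 0 x x0 (fun z _ => is_derive_sin z).
  by apply: continuous_subspaceT; exact: continuous_sin.
rewrite in_itv /= => /andP[z0 zx]; rewrite sin0 !subr0 => ->.
have : `|1 - cos z| < 1 / 2.
  by apply: hd; rewrite /ball /= sub0r normrN gtr0_norm //; exact: lt_trans zx xd.
rewrite ltr_norml => /andP[_ h]; rewrite mulrC; apply: ler_wpM2r; [exact: ltW|lra].
Qed.

(** Near 0 the sine is at least half its argument, and on the remaining compact interval it has a
    positive minimum. With d = |x - x0| this bounds e^{2 pi i (x - x0)} - 1 from below on [0,1]. *)
Lemma sin_pi_ge (eta : R) : 0 < eta < 1 ->
  exists k : R, 0 < k /\ forall d, 0 <= d <= 1 - eta -> k * d <= sin (pi * d).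
Proof.
move=> /andP[eta0 eta1]; have [d0 [d0p hd]] := sin_ge_near0.
have p0 : 0 < pi := pi_gt0 R; have p2 := pi_ge2 R.
pose d1 := d0 / pi; have d1p : 0 < d1 by apply: divr_gt0.
have near d : 0 <= d -> d < d1 -> d <= sin (pi * d).
  move=> dp dd; have := hd (pi * d); rewrite mulr_ge0 ?(ltW p0) //=.
  rewrite mulrC -ltr_pdivlMr // dd => /(_ isT); apply: le_trans.
  by have := ler_wpM2l dp p2; lra.
have [le1|lt1] := leP d1 (1 - eta); last first.
  exists 1; split => // d /andP[dp dd]; rewrite mul1r; apply: near => //; lra.
have [|m] := @EVT_min R (fun d => sin (pi * d)) d1 (1 - eta) le1.
  apply: continuous_subspaceT => x.
  apply: (@continuous_comp _ _ _ (fun x => pi * x) (@sin R)); last exact: continuous_sin.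
  exact: mulrl_continuous.
rewrite in_itv /= => /andP[m1 m2] hm.
have s0 : 0 < sin (pi * m).
  by apply: sin_gt0_pi; rewrite mulr_gt0 //=; [rewrite gtr_pMr //; lra|lra].
exists (Num.min 1 (sin (pi * m))); split; first by rewrite lt_min ltr01 s0.
move=> d /andP[dp dd]; have [dd1|dd1] := ltP d d1.
  apply: (@le_trans _ _ d); last exact: near.
  by apply: ler_piMl => //; rewrite ge_min lexx.
apply: le_trans (hm d _); last by rewrite in_itv /= dd1 dd.
apply: (@le_trans _ _ (sin (pi * m) * d)); first by apply: ler_wpM2r => //; rewrite ge_min lexx orbT.
by rewrite ger_pMr //; lra.
Qed.

Lemma cexpi_sub1 (a : R) : cabs (cexpi (2 * a) - 1) = 2 * `|sin a|.
Proof.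
have -> : cexpi (2 * a) - 1 = cexpi a * complex.Complex 0 (2 * sin a).
  apply: cplx_eq; rewrite ?cReD ?cImD ?cReM ?cImM /=.
  - by rewrite mulr_natl cos_mulr2n; have := cos2Dsin2 a; lra.
  - by rewrite mulr_natl sin_mulr2n; lra.
rewrite cabsM cabs_cexpi mul1r /cabs /= expr0n /= add0r sqrtr_sqr normrM.
by rewrite (@ger0_norm _ 2).
Qed.

Lemma cmeasV f : cmeas f -> cmeas (fun x => (f x)^-1).
Proof.
move=> [f1 f2].
have m0 : measurable_fun I01 (fun x => (Re (f x) ^+ 2 + Im (f x) ^+ 2)^-1).
  have -> : (fun x => (Re (f x) ^+ 2 + Im (f x) ^+ 2)^-1) =
      (fun x => powR (Re (f x) ^+ 2 + Im (f x) ^+ 2) (-1)).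
    by apply: funext => x; rewrite powR_inv1 // addr_ge0 ?sqr_ge0.
  have mS : measurable_fun I01 (fun x => Re (f x) ^+ 2 + Im (f x) ^+ 2).
    by apply: measurable_funD; apply: measurable_funX.
  exact: (measurableT_comp (measurable_powR (-1)) mS).
split.
- have -> : (fun x => Re (f x)^-1) = (fun x => Re (f x) * (Re (f x) ^+ 2 + Im (f x) ^+ 2)^-1).
    by apply: funext => x; case: (f x) => a b.
  exact: measurable_funM.
- have -> : (fun x => Im (f x)^-1) = (fun x => - (Im (f x) * (Re (f x) ^+ 2 + Im (f x) ^+ 2)^-1)).
    by apply: funext => x; case: (f x) => a b /=; rewrite ?mulNr.
  by apply: measurable_funN; exact: measurable_funM.
Qed.

Lemma rprim_lip (k : R -> R) (B a b : R) : rintegrable I01 k -> (forall x, 0 <= x <= 1 -> `|k x| <= B) ->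
  0 <= a -> a <= b -> b <= 1 -> `|rprim k b - rprim k a| <= B * (b - a).
Proof.
move=> ik hB a0 ab b1.
have ikb := rintegrableS b1 ik.
rewrite /rprim Rintegral_itvB ?bnd_simp //.
have iab : rintegrable `]a, b] k.
  by apply: integrableS ikb => //; apply: subset_itvr; rewrite bnd_simp.
apply: le_trans (le_normr_Rintegral _ iab) _ => //.
have -> : B * (b - a) = \int[mu]_(x in `]a, b]) B.
  rewrite Rintegral_cst //= lebesgue_measure_itv /= lte_fin.
  by move: ab; rewrite le_eqVlt => /predU1P[->|->] //; rewrite ltxx subrr.
apply: le_Rintegral => //; first exact: rintegrable_norm.
- apply: integrableS (rintegrable_cst b B) => //.
  by apply: subset_itvr; rewrite bnd_simp.
- move=> x; rewrite /= in_itv /= => /andP[ax xb]; apply: hB.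
  by rewrite (le_trans xb b1) (le_trans a0 (ltW ax)).
Qed.

Lemma cprim_lip g y B : bmf g B -> cprim g y -> forall a b, 0 <= a <= 1 -> 0 <= b <= 1 ->
  cabs (y b - y a) <= 2 * B * `|b - a|.
Proof.
move=> hg hy; have [i1 i2] := bmf_integrable hg.
have key a b : 0 <= a <= 1 -> 0 <= b <= 1 -> a <= b -> cabs (y b - y a) <= 2 * B * (b - a).
  move=> a01 b01 ab; have /andP[a0 _] := a01; have /andP[_ b1] := b01.
  rewrite (cprimE hy a01) (cprimE hy b01) opprD addrACA subrr add0r.
  apply: le_trans (cabs_le_ReIm _) _; rewrite cReD cImD cReN cImN.
  have h1 : `|rprim (fun x => Re (g x)) b - rprim (fun x => Re (g x)) a| <= B * (b - a).
    by apply: rprim_lip => // x x01; exact: le_trans (Re_le_cabs _) (hg.2 x x01).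
  have h2 : `|rprim (fun x => Im (g x)) b - rprim (fun x => Im (g x)) a| <= B * (b - a).
    by apply: rprim_lip => // x x01; exact: le_trans (Im_le_cabs _) (hg.2 x x01).
  move: h1 h2; rewrite /rprim /cprm /cint /=; lra.
move=> a b a01 b01; have [ab|ba] := leP a b.
  by rewrite ger0_norm ?subr_ge0 //; exact: key.
rewrite cabs_subC distrC ger0_norm ?subr_ge0 ?(ltW ba) //; apply: key => //; exact: ltW.
Qed.

Lemma telescope_box N (z : int -> C) :
  \sum_(m <- box N) (z m - z (m - 1)) = z N%:Z - z (- N%:Z - 1).
Proof.
rewrite big_map -[iota _ _]/(index_iota 0 (N + N).+1).
rewrite (eq_bigr (fun i : nat => z (i.+1%:Z - N%:Z - 1) - z (i%:Z - N%:Z - 1))); last first.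
  by move=> i _; congr (z _ - _); lia.
by rewrite telescope_sumr //; congr (z _ - z _); lia.
Qed.

(* Chernoff's argument: [(F x - F x0) / (e^{2 pi i (x - x0)} - 1)] is bounded, and its Fourier
   coefficients telescope in the partial sums at [x0]. *)
Lemma inversion0 G F B x0 : bmf G B -> cprim G F -> 0 < x0 < 1 ->
  ccvg (fun N => \sum_(m <- box N) tco F (fr 0 m) * cexpi (fr 0 m * x0)) (F x0).
Proof.
move=> hG hF /andP[x00 x01].
have iG := bmf_integrable hG; have bF := cprim_bmf iG hF; have iF := bmf_integrable bF.
have x0I : 0 <= x0 <= 1 by rewrite !ltW.
pose eta := Num.min x0 (1 - x0).
have [|k [k0 hk]] := @sin_pi_ge eta.
  by rewrite lt_min x00 subr_gt0 x01 /= gt_min x01.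
have eta1 : eta <= x0 by rewrite ge_min lexx.
have eta2 : eta <= 1 - x0 by rewrite ge_min lexx orbT.
pose hh x : C := cexpi (2 * (pi * (x - x0))) - 1.
have hhk x : 0 <= x <= 1 -> 2 * k * `|x - x0| <= cabs (hh x).
  move=> /andP[xp x1]; rewrite /hh cexpi_sub1 -mulrA ler_pM2l //.
  have [xx|xx] := leP x0 x.
    rewrite ger0_norm ?subr_ge0 //; apply: le_trans (ler_norm _); apply: hk.
    rewrite subr_ge0 xx /=; lra.
  rewrite ltr0_norm ?subr_lt0 // -normrN -sinN -mulrN; apply: le_trans (ler_norm _); apply: hk.
  by apply/andP; split; lra.
have hh0 x : 0 <= x <= 1 -> x != x0 -> hh x != 0.
  move=> xI xx; apply/eqP => h; have := hhk x xI; rewrite h cabs0.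
  have : 0 < `|x - x0| by rewrite normr_gt0 subr_eq0.
  by move=> p; have := mulr_gt0 k0 p; lra.
(* At x = x0 the quotient is 0, so the relation [eq1] below holds there too. *)
pose g x := (F x - F x0) * (hh x)^-1.
have hg : bmf g (B / k).
  have B0 := bmf_ge0 hG; split.
    apply: cmeasM; first exact: (bmfB bF (bmf_cst (F x0))).1.
    apply: cmeasV; have [m1 m2] := (bmfB (bmfZ (cexpi (- (2 * pi * x0))) (cexpi_bmf (2 * pi))) (bmf_cst 1)).1.
    apply: cmeas_eq (conj m1 m2) => x _; rewrite /hh; congr (_ - 1).
    by rewrite -cexpiD; congr cexpi; ring.
  move=> x xI; have [->|xx] := eqVneq x x0; first by rewrite /g subrr mul0r cabs0 divr_ge0 // ltW.
  rewrite cabsM cabsV ler_pdivrMr ?cabs_gt0 ?hh0 //.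
  apply: le_trans (cprim_lip hG hF x0I xI) _.
  apply: le_trans (ler_wpM2l (divr_ge0 B0 (ltW k0)) (hhk x xI)).
  rewrite le_eqVlt; apply/orP; left; apply/eqP.
  by have k1 : k != 0; [rewrite gt_eqF|field].
have ig := bmf_integrable hg.
have eq1 x : 0 <= x <= 1 -> F x - F x0 = cexpi (- (2 * pi * x0)) * (g x * cexpi (fr 0 1 * x)) - g x.
  move=> xI; have -> : cexpi (- (2 * pi * x0)) * (g x * cexpi (fr 0 1 * x)) - g x = g x * hh x.
    have -> : hh x = cexpi (- (2 * pi * x0)) * cexpi (fr 0 1 * x) - 1.
      by rewrite /hh -cexpiD /fr; congr (cexpi _ - 1); ring.
    ring.
  have [->|xx] := eqVneq x x0; first by rewrite /g subrr !mul0r.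
  by rewrite /g mulfVK ?hh0.
pose z m := tco g (fr 0 m) * cexpi (fr 0 m * x0).
have ib : cintegrable I01 (fun x => g x * cexpi (fr 0 1 * x)).
  exact: cintegrableM ig (cexpi_bmf _).
have key m : tco F (fr 0 m) * cexpi (fr 0 m * x0) - (if m == 0 then F x0 else 0) = - (z m - z (m - 1)).
  have : tco (fun x => F x - F x0) (fr 0 m) =
      cexpi (- (2 * pi * x0)) * tco g (fr 0 (m - 1)) - tco g (fr 0 m).
    rewrite (tco_eq _ eq1) tcoB //; last exact: cintegrableZ (@mI01 R) ib.
    rewrite tcoZ // tco_shiftN; congr (_ * tco _ _ - _).
    by rewrite /fr rmorphB /=; ring.
  rewrite tcoB //; last exact: bmf_integrable (bmf_cst _).
  have -> : tco (fun=> F x0) (fr 0 m) = F x0 * (m == 0)%:R.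
    rewrite -fourier_cst1 fourierE -tcoZ; last exact: bmf_integrable (bmf_cst _).
    by apply: tco_eq => x _; rewrite mulr1.
  move=> /(congr1 (fun w => w * cexpi (fr 0 m * x0))); rewrite !mulrBl.
  have -> : F x0 * (m == 0)%:R * cexpi (fr 0 m * x0) = if m == 0 then F x0 else 0.
    by case: eqP => [->|_]; rewrite ?mulr1 ?mulr0 ?mul0r // /fr mulr0 addr0 mul0r cexpi0 mulr1.
  move=> ->; rewrite /z opprB; congr (_ - _).
  rewrite mulrAC -cexpiD mulrC; congr (_ * cexpi _).
  by rewrite /fr rmorphB /=; ring.
have sumE N : \sum_(m <- box N) tco F (fr 0 m) * cexpi (fr 0 m * x0) - F x0 =
    z (- N%:Z - 1) - z N%:Z.
  rewrite -[RHS]opprB -telescope_box -sumrN -(eq_bigr _ (fun m _ => key m)) sumrB; congr (_ - _).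
  rewrite -big_mkcond /= big_const_seq iter_addr_0 -/(count_mem 0 (box N)).
  by rewrite count_uniq_mem ?box_uniq // mem_box /= mulr1n.
move=> e e0; have [|N hN] := @bessel_small R g _ 0 (e / 3) hg; first by lra.
exists N.+1 => n Nn; rewrite sumE; apply: le_lt_trans (cabsB _ _) _.
rewrite !cabsM !cabs_cexpi !mulr1.
have := hN (- n%:Z - 1) ltac:(lia); have := hN n%:Z ltac:(lia); lra.
Qed.

Lemma tco_untwist t y m : tco y (fr t m) = tco (fun x => y x * cexpi (- (t * x))) (fr 0 m).
Proof. by rewrite tco_shift; congr tco; rewrite /fr; ring. Qed.

(** The function y(x) e^{-itx} reduces the claim to t = 0. *)
Lemma inversion t g y B x0 : bmf g B -> cprim g y -> 0 < x0 < 1 ->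
  ccvg (fun N => \sum_(m <- box N) tco y (fr t m) * cexpi (fr t m * x0)) (y x0).
Proof.
move=> hg hy x0I.
have by_ := cprim_bmf (bmf_integrable hg) hy.
have be := cexpi_bmf (- t); have bie := bmfZ (complex.Complex 0 (- t)) be.
have hF := cprimM (bmf_integrable hg) (bmf_integrable bie) hy (cprim_cexpi (- t)).
have bG := bmfD (bmfM hg be) (bmfM bie by_).
have := ccvgZ (cexpi (t * x0)) (inversion0 bG hF x0I).
rewrite mulrCA -cexpiD mulNr subrr cexpi0 mulr1; apply: ccvg_ext => N.
rewrite mulr_sumr; apply: eq_bigr => m _.
rewrite mulrCA; congr (_ * _).
  by rewrite [RHS]tco_untwist; apply: tco_eq => x _; rewrite mulNr.
by rewrite -cexpiD /fr; congr cexpi; ring.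
Qed.

Definition fser t u (x : R) : C := csum (fun m => u m * cexpi (fr t m * x)).

Section Fser.
Variables (t : R) (u : int -> C) (f : int -> R) (M : R).
Hypotheses (hu : dom u f) (hM : bsum f M).

Lemma fser_dom x : dom (fun m => u m * cexpi (fr t m * x)) f.
Proof. by move=> m; rewrite cabsM cabs_cexpi mulr1. Qed.

Lemma fser_near (e : R) : 0 < e -> exists N0, forall N x, (N0 <= N)%N ->
  cabs (fser t u x - \sum_(m <- box N) u m * cexpi (fr t m * x)) <= e.
Proof.
move=> e0; have [N0 hN] := bsum_tail (fun j => dom_ge0 j hu) hM e0; exists N0 => N x NN.
apply: csum_near (fser_dom x) hM _ => s us hs; apply: hN us _ => j /hs.
exact: leq_ltn_trans.
Qed.

Lemma fpart_bmf N : bmf (fun x => \sum_(m <- box N) u m * cexpi (fr t m * x))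
  (\sum_(m <- box N) cabs (u m) * 1).
Proof. by apply: bmf_sum => m; exact: bmfZ (cexpi_bmf _). Qed.

Lemma fser_bmf : bmf (fser t u) M.
Proof.
split; last by move=> x _; exact: csum_le (fser_dom x) hM.
split.
- apply: (@measurable_fun_cvg _ _ _ _ (fun N x => Re (\sum_(m <- box N) u m * cexpi (fr t m * x)))).
    by move=> N; exact: (fpart_bmf N).1.1.
  move=> x _; apply/cvgrPdist_lt => e e0; have [|N hN] := @fser_near (e / 2); first by lra.
  exists N => // n /= Nn; rewrite -cReN -cReD; apply: le_lt_trans (Re_le_cabs _) _.
  by have := hN n x Nn; lra.
- apply: (@measurable_fun_cvg _ _ _ _ (fun N x => Im (\sum_(m <- box N) u m * cexpi (fr t m * x)))).
    by move=> N; exact: (fpart_bmf N).1.2.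
  move=> x _; apply/cvgrPdist_lt => e e0; have [|N hN] := @fser_near (e / 2); first by lra.
  exists N => // n /= Nn; rewrite -cImN -cImD; apply: le_lt_trans (Im_le_cabs _) _.
  by have := hN n x Nn; lra.
Qed.

(** The partial sums of [fser] converge uniformly, and uniform convergence survives multiplication
    by an integrable [q]; no summability of the coefficients of [q] is involved. *)
Lemma tco_mul_fser q m : cintegrable I01 q ->
  tco (fun x => q x * fser t u x) (fr t m) = csum (fun k => fourier q (m - k) * u k).
Proof.
move=> iq; apply/esym; apply: clim_eq => e e0.
have n0 := n1_ge0 q.
(* The error is at most 2 d times [n1 q]; the added 1 makes it strictly less than [e] and the
   quotient meaningful. *)
pose d := e / (2 * n1 q + 1).
have d0 : 0 < d by apply: divr_gt0 => //; lra.
have [N0 hN] := fser_near d0; exists N0 => N NN.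
have bP := fpart_bmf N; have bE := cexpiN_bmf (fr t m).
have -> : \sum_(k <- box N) fourier q (m - k) * u k =
    tco (fun x => q x * \sum_(m <- box N) u m * cexpi (fr t m * x)) (fr t m).
  rewrite (@tco_eq _ _ (fun x => \sum_(k <- box N) u k * (q x * cexpi (fr t k * x)))); last first.
    by move=> x _; rewrite mulr_sumr; apply: eq_bigr => k _; rewrite mulrCA.
  have iE k : cintegrable I01 (fun x => q x * cexpi (fr t k * x)) by exact: cintegrableM iq (cexpi_bmf _).
  rewrite tco_sum; last by move=> k; exact: cintegrableZ (@mI01 R) (iE k).
  apply: eq_bigr => k _; rewrite tcoZ // tco_shiftN fourierE mulrC; congr (_ * tco _ _).
  by rewrite /fr rmorphB /=; ring.
have bD : bmf (fun x => \sum_(m <- box N) u m * cexpi (fr t m * x) - fser t u x) d.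
  split; first exact: (bmfB bP fser_bmf).1.
  by move=> x _; rewrite cabs_subC; exact: hN.
rewrite -tcoB; [|exact: cintegrableM iq bP|exact: cintegrableM iq fser_bmf].
have := cint_bound iq (bmfM bD bE).
rewrite (@cint_eq _ _ _ (fun x => (q x * (\sum_(m <- box N) u m * cexpi (fr t m * x)) - q x * fser t u x)
    * cexpi (- (fr t m * x)))); last by move=> x _; ring.
rewrite -/(tco _ _) mulr1; move=> h; apply: le_lt_trans h _.
have : d * (2 * n1 q + 1) = e by rewrite /d mulfVK // gt_eqF //; lra.
lra.
Qed.

Lemma tco_fser m : tco (fser t u) (fr t m) = u m.
Proof.
have i1 := bmf_integrable (bmf_cst (1 : C)).
rewrite (@tco_eq _ _ (fun x => 1 * fser t u x)); last by move=> x _; rewrite mul1r.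
rewrite (tco_mul_fser m i1) -[RHS](csum_pt m); apply: csum_eq => k.
rewrite fourier_cst1 subr_eq0 (eq_sym m); case: eqP => [->|_]; by rewrite ?mul1r ?mul0r.
Qed.

End Fser.

Lemma inversion_fser t g y B (f : int -> R) M x0 : bmf g B -> cprim g y -> 0 < x0 < 1 ->
  dom (fun m => tco y (fr t m)) f -> bsum f M -> y x0 = fser t (fun m => tco y (fr t m)) x0.
Proof.
move=> hg hy x0I hd hM; apply: ccvg_unique (inversion t hg hy x0I) _.
exact: csum_cvg (fser_dom t hd x0) hM.
Qed.

(** Inversion gives values at interior points only; the Lipschitz bound carries the vanishing to the
    endpoints. *)
Lemma cprim_vanish g y B : bmf g B -> cprim g y -> (forall x, 0 < x < 1 -> y x = 0) ->
  forall x, 0 <= x <= 1 -> y x = 0.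
Proof.
move=> hg hy h x x01; apply: cabs_small => e e0.
have B0 := bmf_ge0 hg.
pose d := Num.min (1 / 2) (e / (2 * B + 1)).
have d0 : 0 < d by rewrite lt_min divr_gt0 //=; apply: divr_gt0 => //; lra.
have d1 : d <= 1 / 2 by rewrite ge_min lexx.
have d2 : d * (2 * B + 1) <= e by rewrite -ler_pdivlMr ?ge_min ?lexx ?orbT //; lra.
have H x' : 0 < x' < 1 -> `|x - x'| <= d -> cabs (y x) <= e.
  move=> x'01 xx; have /andP[p1 p2] := x'01; have x'I : 0 <= x' <= 1 by rewrite !ltW.
  have := cprim_lip hg hy x'I x01; rewrite (h x' x'01) subr0 => h1; apply: le_trans h1 _.
  have := ler_wpM2l (mulr_ge0 (ler0n _ 2) B0) xx; lra.
have /andP[x0 x1] := x01.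
have [xh|xh] := leP x (1 / 2).
  apply: (H (x + d / 2)); first by apply/andP; split; lra.
  by rewrite opprD addrA subrr add0r normrN ger0_norm; lra.
apply: (H (x - d / 2)); first by apply/andP; split; lra.
by rewrite opprB addrCA subrr addr0 ger0_norm; lra.
Qed.

End FourierInversion.

(** * The operator L_t(q) in Fourier coefficients, and the Riemann-Lebesgue lemma *)

Section Operator.
Variable R : realType.
Local Notation C := (R[i]).
Local Notation mu := (@lebesgue_measure R).
Local Notation Re := complex.Re.
Local Notation Im := complex.Im.
Local Notation I01 := (`[0, 1]%classic : set R).
Implicit Types (f g h y q F G : R -> C) (c : C) (u : int -> C).

Lemma ae_imp (P Q : R -> Prop) : (forall x, P x -> Q x) ->
  {ae mu, forall x, P x} -> {ae mu, forall x, Q x}.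
Proof. by move=> PQ; apply: negligibleS => x /= nQ hP; apply: nQ; exact: PQ. Qed.

Lemma cint_ae f g : cintegrable I01 f -> cintegrable I01 g ->
  {ae mu, forall x, 0 <= x <= 1 -> f x = g x} -> cint I01 f = cint I01 g.
Proof.
move=> [f1 f2] [g1 g2] h.
have key (k l : R -> R) : rintegrable I01 k -> rintegrable I01 l ->
    {ae mu, forall x, I01 x -> (k x)%:E = (l x)%:E} ->
    \int[mu]_(x in I01) k x = \int[mu]_(x in I01) l x.
  move=> ik il kl; rewrite /Rintegral; congr fine.
  exact: (@ae_eq_integral _ _ _ mu I01 _ _ (@mI01 R) (measurable_int _ ik) (measurable_int _ il) kl).
apply: cplx_eq => /=; apply: key => //; apply: ae_imp h => x hx /I01P /hx -> //.
Qed.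

Lemma tco_ae f g a : cintegrable I01 f -> cintegrable I01 g ->
  {ae mu, forall x, 0 <= x <= 1 -> f x = g x} -> tco f a = tco g a.
Proof.
move=> hf hg h; apply: cint_ae; [exact: tco_integrable|exact: tco_integrable|].
by apply: ae_imp h => x hx /hx ->.
Qed.

Lemma ae_open01 (P : R -> Prop) : (forall x, 0 < x < 1 -> P x) ->
  {ae mu, forall x, 0 <= x <= 1 -> P x}.
Proof.
move=> h; have n0 : mu.-negligible ([set 0] `|` [set 1] : set R).
  by apply: negligibleU; apply/negligibleP => //; exact: lebesgue_measure_set1.
apply: negligibleS n0 => x /= /not_implyP[/andP[x0 x1] nP].
move: x0; rewrite le_eqVlt => /predU1P[<-|x0]; first by left.
move: x1; rewrite le_eqVlt => /predU1P[->|x1]; first by right.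
by exfalso; apply: nP; apply: h; rewrite x0 x1.
Qed.

Lemma cL2_integrable f : cL2 I01 f -> cintegrable I01 f.
Proof.
move=> [m1 [m2 i2]].
have i3 : mu.-integrable I01 (EFin \o (fun x => 1 + (Re (f x) ^+ 2 + Im (f x) ^+ 2))).
  have := integrableD (mu := mu) (@mI01 R) (rintegrable_cst 1 1) i2.
  by apply: (@eq_integrable _ _ _ mu I01 (@mI01 R)) => x _; rewrite /= EFinD.
have key (a b : R) : `|a| <= `|1 + (a ^+ 2 + b ^+ 2)|.
  rewrite [leRHS]ger0_norm; last by rewrite addr_ge0 ?addr_ge0 ?sqr_ge0.
  have := sqr_ge0 (`|a| - 1); have := sqr_ge0 b; rewrite sqrrB real_normK ?num_real //.
  have := normr_ge0 a; lra.
split; apply: (le_integrable (mu := mu) (@mI01 R) _ _ i3).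
- exact/measurable_EFinP.
- by move=> x _; rewrite /= lee_fin.
- exact/measurable_EFinP.
- by move=> x _; rewrite /= lee_fin addrC (addrC (_ ^+ 2)) addrC.
Qed.

Lemma bmf_cL2 f B : bmf f B -> cL2 I01 f.
Proof.
move=> [[m1 m2] hB]; split=> //; split=> //.
apply: (bmf_rintegrable (B := B ^+ 2)).
  by apply: measurable_funD; apply: measurable_funX.
move=> x xI; rewrite -cabs_sqr ger0_norm ?sqr_ge0 // ler_sqr ?nnegrE ?cabs_ge0 ?hB //.
exact: le_trans (cabs_ge0 _) (hB x xI).
Qed.

Definition inv2 (m : int) : R := if m == 0 then 0 else (m%:~R ^+ 2)^-1.
Lemma inv2_ge0 m : 0 <= inv2 m.
Proof. by rewrite /inv2; case: eqP => // _; rewrite invr_ge0 sqr_ge0. Qed.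
Lemma inv2N m : inv2 (- m) = inv2 m.
Proof. by rewrite /inv2 oppr_eq0 rmorphN sqrrN. Qed.

Lemma bsum_box (f : int -> R) M : (forall j, 0 <= f j) -> (forall N, \sum_(j <- box N) f j <= M) -> bsum f M.
Proof.
move=> f0 h s us; have [N hN] := sub_box s; apply: le_trans (h N).
by rewrite (sum_cond_disjoint f us (box_uniq N) hN) lerDl sumr_ge0.
Qed.

Lemma sum_boxS (V : nmodType) (f : int -> V) N :
  \sum_(j <- box N.+1) f j = \sum_(j <- box N) f j + (f N.+1%:Z + f (- N.+1%:Z)).
Proof.
have e : perm_eq (box N.+1) (box N ++ [:: N.+1%:Z; - N.+1%:Z]).
  apply: uniq_perm; first exact: box_uniq.
    by rewrite cat_uniq box_uniq /= !mem_box ?inE; lia.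
  by move=> j; rewrite mem_cat !mem_box !inE; lia.
by rewrite (perm_big _ e) big_cat; congr (_ + _); rewrite big_cons big_seq1.
Qed.

Lemma bsum_inv2 : bsum inv2 4.
Proof.
apply: bsum_box; first exact: inv2_ge0.
(* Both signs together: adding index N + 2 costs 2/(N+2)^2 <= 2/(N+1) - 2/(N+2), so the subtracted
   term telescopes. *)
suff h N : \sum_(j <- box N.+1) inv2 j <= 4 - 2 / N.+1%:R.
  case=> [|N]; first by rewrite big_seq1 /inv2 /=; lra.
  by apply: le_trans (h N) _; rewrite lerBlDr lerDl divr_ge0.
elim: N => [|N IH]; rewrite sum_boxS inv2N.
  by rewrite big_seq1 /inv2 /= expr1n invr1; lra.
have -> : inv2 N.+2%:Z = (N.+2%:R ^+ 2)^-1 by [].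
set a : R := N.+1%:R; have p1 : 0 < a by rewrite ltr0n.
have -> : N.+2%:R = a + 1 :> R by rewrite -natr1.
have : ((a + 1) ^+ 2)^-1 <= a^-1 - (a + 1)^-1.
  have -> : a^-1 - (a + 1)^-1 = (a * (a + 1))^-1 by field; rewrite !gt_eqF //; lra.
  have a2 : a * (a + 1) <= (a + 1) ^+ 2 by nra.
  have a3 : 0 < a * (a + 1) by nra.
  by rewrite lef_pV2 // posrE //; exact: lt_le_trans a3 a2.
move: IH; rewrite -/a; set X := _^-1; set ia := a^-1; set ib := (a + 1)^-1.
by set S := bigop _ _ _ => IH hX; lra.
Qed.

Lemma fr_ge (t : R) (m : int) : 0 <= t <= 1 -> m != 0 -> `|m%:~R : R| <= `|fr t m|.
Proof.
move=> /andP[t0 t1] m0; have p2 := pi_ge2 R.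
have m1 : 1 <= `|m%:~R : R|.
  by rewrite -intr_norm ler1z; move: m0; lia.
have : `|2 * pi * m%:~R| - `|t| <= `|fr t m| by exact: lerB_normD.
rewrite !normrM (ger0_norm t0) (@ger0_norm _ 2) // (@ger0_norm _ pi) ?pi_ge0 //.
have := ler_wpM2r (normr_ge0 (m%:~R : R)) p2; lra.
Qed.

Lemma fr_eq0 (t : R) (m : int) : 0 <= t <= 1 -> fr t m = 0 -> m = 0 /\ t = 0.
Proof.
move=> tI h; have [m0|m0] := eqVneq m 0.
  by split=> //; move: h; rewrite m0 /fr mulr0 add0r.
have := fr_ge tI m0; rewrite h normr0 normr_le0 intr_eq0.
by rewrite (negbTE m0).
Qed.

Lemma cexpi_fr1 (t : R) m : cexpi (- fr t m) = cexpi (- t) :> C.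
Proof.
by rewrite /fr opprD cexpiD -mulrN -rmorphN /= cexpi2pi mul1r.
Qed.

(** Quasi-periodicity is exactly what cancels the boundary terms at every frequency 2 pi m + t. *)
Lemma tco_qper g y t m : cintegrable I01 g -> cprim g y -> y 1 = cexpi t * y 0 ->
  tco g (fr t m) = complex.Complex 0 (fr t m) * tco y (fr t m).
Proof.
move=> ig hy hp; rewrite (tco_ibp _ ig hy) hp cexpi_fr1 mulrAC -cexpiD subrr cexpi0 mul1r.
by rewrite subrr add0r.
Qed.

Lemma imag_sqr (a : R) : complex.Complex 0 a * complex.Complex 0 a = - RC (a ^+ 2) :> C.
Proof. by apply: cplx_eq => /=; ring. Qed.

Section Forward.
Variables (q : R -> C) (t : R) (y f : R -> C).
Hypotheses (iq : cintegrable I01 q) (tI : 0 <= t <= 1) (hL : Lrel q t y f).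
Let u m := tco y (fr t m).

Lemma Lrel_deriv : exists g B, bmf g B /\ cprim g y.
Proof.
have [y1 [y2 [i1 [i2 [h1 [h2 _]]]]]] := hL.
by exists y1; eexists; split; [exact: cprim_bmf i2 h2|].
Qed.
Lemma Lrel_bmf : exists B, bmf y B.
Proof.
have [g [B [hg hy]]] := Lrel_deriv; eexists; exact: cprim_bmf (bmf_integrable hg) hy.
Qed.

Lemma Lrel_coef1 m : RC (fr t m ^+ 2) * u m + tco (fun x => q x * y x) (fr t m) = tco f (fr t m).
Proof.
have [By hB] := Lrel_bmf.
have [y1 [y2 [i1 [i2 [h1 [h2 [hf [hae [p1 p2]]]]]]]]] := hL.
have iqy := cintegrableM iq hB.
rewrite (tco_ae _ (cL2_integrable hf) (cintegrableD (@mI01 R) (cintegrableN (@mI01 R) i2) iqy) hae).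
rewrite tcoD //; last exact: cintegrableN.
rewrite (@tco_eq _ (fun x => - y2 x) (fun x => -1 * y2 x)); last by move=> x _; rewrite mulN1r.
rewrite tcoZ // (tco_qper m i2 h2 p2) (tco_qper m i1 h1 p1) [X in -1 * X]mulrA imag_sqr.
by rewrite mulN1r mulNr opprK.
Qed.

(** Two integrations by parts express u m as -(2 pi m + t)^-2 times a coefficient of the integrable
    function [y2]. The index 0, where the frequency may vanish, is majorized by itself. *)
Lemma Lrel_summable : exists M, bsum (fun m => cabs (u m)) M.
Proof.
have [y1 [y2 [i1 [i2 [h1 [h2 [hf [hae [p1 p2]]]]]]]]] := hL.
have n0 := n1_ge0 y2.
have hle m : cabs (u m) <= (if m == 0 then cabs (u 0) else 0) + 2 * n1 y2 * inv2 m.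
  rewrite /inv2; case: eqP => [->|/eqP m0]; first by rewrite mulr0 addr0.
  rewrite add0r ler_pdivlMr; last by rewrite exprn_even_gt0 //= intr_eq0.
  apply: le_trans (tco_bound (fr t m) i2).
  rewrite (tco_qper m i2 h2 p2) (tco_qper m i1 h1 p1) mulrA imag_sqr mulNr cabsN cabsM cabs_RC.
  rewrite mulrC ler_wpM2r ?cabs_ge0 // -/(u m) normrX -(@real_normK _ m%:~R) ?num_real //.
  by rewrite ler_sqr ?nnegrE ?normr_ge0 // fr_ge.
exists (cabs (u 0) + 2 * n1 y2 * 4); apply: bsum_le hle _.
apply: bsumD; first by apply: bsum_pt; exact: cabs_ge0.
by apply: bsumZ; [lra|exact: bsum_inv2].
Qed.

(** On (0,1), hence almost everywhere, y equals its absolutely convergent Fourier series, which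
    turns the coefficient of q y into a convolution. *)
Lemma Lrel_coef m : RC (fr t m ^+ 2) * u m + csum (fun k => fourier q (m - k) * u k) = tco f (fr t m).
Proof.
have [M hM] := Lrel_summable; have hd : dom u (fun m => cabs (u m)) by move=> k.
have [By hB] := Lrel_bmf; have [g [B [hg hy]]] := Lrel_deriv.
rewrite -Lrel_coef1 -(tco_mul_fser t hd hM m iq); congr (_ + _).
apply: tco_ae; [exact: cintegrableM iq (fser_bmf t hd hM)|exact: cintegrableM iq hB|].
apply: ae_open01 => x xI; congr (_ * _); exact/esym/(inversion_fser hg hy xI hd hM).
Qed.

Lemma Lrel_vanish : (forall m, u m = 0) -> forall x, 0 <= x <= 1 -> y x = 0.
Proof.
move=> h0; have [g [B [hg hy]]] := Lrel_deriv; apply: (cprim_vanish hg hy) => x xI.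
have hd : dom u (fun=> 0) by move=> k; rewrite h0 cabs0.
have hM : bsum (fun _ : int => 0 : R) 0 by move=> s _; rewrite big1.
rewrite (inversion_fser hg hy xI hd hM); apply: clim_eq; apply: ccvg_ext (ccvg_cst 0) => N.
by rewrite big1 // => m _; rewrite [tco _ _]h0 mul0r.
Qed.
End Forward.

Lemma cexpi_neq1 (t : R) : 0 < t <= 1 -> cexpi t - 1 != 0 :> C.
Proof.
move=> /andP[t0 t1]; apply/eqP => /(congr1 (@complex.Im R)); rewrite cImD cImN /= oppr0 addr0.
have : 0 < sin t by apply: sin_gt0_pi; rewrite t0 /=; have := pi_ge2 R; lra.
by move=> + h; rewrite h ltxx.
Qed.

(** For t > 0 the boundary condition determines the constant of integration, as e^{it} <> 1. For t =
    0 it holds for every constant once h has mean 0, and the constant is used to prescribe the mean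
    of F. *)
Lemma qper_prim h t (v : C) : cintegrable I01 h -> 0 <= t <= 1 -> (t = 0 -> cint I01 h = 0) ->
  exists F, cprim h F /\ F 1 = cexpi t * F 0 /\ (t = 0 -> cint I01 F = v).
Proof.
move=> ih /andP[t0 t1] h0.
have mk (c : C) : cprim h (fun x => c + cprm h x).
  move=> x _; rewrite /cprm set_itv1 [X in _ = c + X + _](_ : _ = 0) ?addr0 //.
  by apply: cplx_eq; rewrite /= Rintegral_set1.
have z0 : cprm h 0 = 0 by apply: cplx_eq; rewrite /cprm set_itv1 /= Rintegral_set1.
move: t0; rewrite le_eqVlt => /predU1P[te|tp].
  exists (fun x => (v - cint I01 (cprm h)) + cprm h x); split; first exact: mk.
  split; first by rewrite -te cexpi0 mul1r z0 /cprm h0.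
  move=> _; have ip := bmf_integrable (cprm_bmf ih).
  rewrite cintD //; last exact: bmf_integrable (bmf_cst _).
  set a := v - _; have -> : cint I01 (fun=> a) = a.
    have := int_cexpi R 0; rewrite eqxx => h1.
    rewrite (@cint_eq _ _ _ (fun x => a * cexpi (- (fr 0 0 * x)))).
      by rewrite cintZ // ?h1 ?mulr1 //; exact: bmf_integrable (cexpiN_bmf _).
    by move=> x _; rewrite /fr mulr0 addr0 mul0r oppr0 cexpi0 mulr1.
  by rewrite /a subrK.
have tI : 0 < t <= 1 by rewrite tp t1.
exists (fun x => cprm h 1 / (cexpi t - 1) + cprm h x); split; first exact: mk.
split; last by move=> te; rewrite te ltxx in tp.
by rewrite z0 addr0; field; exact: cexpi_neq1.
Qed.

(** The Fourier series Y is not known to be differentiable, so h = q Y - lam Y, the expected Y'', is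
    integrated twice with the right boundary conditions. The result y has the coefficients of Y and
    therefore equals Y on (0,1). *)
Lemma Lrel_of_coef q t (lam : C) u (f : int -> R) M : cintegrable I01 q -> 0 <= t <= 1 ->
  dom u f -> bsum f M ->
  (forall m, (lam - RC (fr t m ^+ 2)) * u m = csum (fun k => fourier q (m - k) * u k)) ->
  exists y, Lrel q t y (fun x => lam * y x) /\ forall m, tco y (fr t m) = u m.
Proof.
move=> iq tI hd hM hu.
pose Y := fser t u; have bY : bmf Y M := fser_bmf t hd hM.
have iqY := cintegrableM iq bY; have iY := bmf_integrable bY.
pose h x := q x * Y x - lam * Y x.
have ilY := cintegrableZ lam (@mI01 R) iY.
have ih : cintegrable I01 h by exact: cintegrableB.
have hco m : tco h (fr t m) = - RC (fr t m ^+ 2) * u m.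
  rewrite tcoB // tcoZ // (tco_mul_fser t hd hM m iq) (tco_fser t hd hM) -hu; ring.
have cint_tco g : t = 0 -> cint I01 g = tco g (fr t 0).
  by move=> ->; apply: cint_eq => x _; rewrite /fr mulr0 addr0 mul0r oppr0 cexpi0 mulr1.
have h0 : t = 0 -> cint I01 h = 0.
  by move=> te; rewrite cint_tco // hco te /fr mulr0 addr0 expr0n /= oppr0 mul0r.
have [y1 [hy1 [p1 v1]]] := qper_prim 0 ih tI h0.
have b1 := cprim_bmf ih hy1; have i1 := bmf_integrable b1.
have [y [hy [p0 v0]]] := qper_prim (u 0) i1 tI v1.
have by_ := cprim_bmf i1 hy.
have yu m : tco y (fr t m) = u m.
  have e : - RC (fr t m ^+ 2) * tco y (fr t m) = - RC (fr t m ^+ 2) * u m.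
    by rewrite -hco (tco_qper m ih hy1 p1) (tco_qper m i1 hy p0) mulrA imag_sqr.
  (* At frequency 0, that is m = 0 and t = 0, this relation says nothing; the coefficient is then
     the prescribed mean of y. *)
  have [a0|a0] := eqVneq (fr t m) 0; last first.
    by apply: mulfI e; rewrite oppr_eq0 RC_eq0 expf_eq0 /=.
  by have [m0 te] := fr_eq0 tI a0; rewrite m0 -v0 // cint_tco.
have yY x : 0 < x < 1 -> y x = Y x.
  move=> xI; have hd' : dom (fun m => tco y (fr t m)) f by move=> m; rewrite yu.
  rewrite (inversion_fser b1 hy xI hd' hM) /Y; congr (fser t _ x); exact: funext.
exists y; split=> //; exists y1, h; do 4 (split=> //).
split; first exact: bmf_cL2 (bmfZ lam by_).
split=> //; apply: ae_open01 => x xI; rewrite /h -(yY x xI); ring.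
Qed.

Lemma n1_trunc f (e : R) : cintegrable I01 f -> 0 < e -> exists g B, bmf g B /\
  n1 (fun x => f x - g x) <= e.
Proof.
move=> hf e0; have [f1 f2] := hf; have [m1 m2] := cintegrable_meas hf.
pose h x := `|Re (f x)| + `|Im (f x)|.
have ih : rintegrable I01 h := n1_integrable hf.
have mh := rintegrable_mfun ih.
have h0 x : 0 <= h x by apply: addr_ge0.
pose g (K : nat) x := if h x <= K%:R then f x else 0.
have mb K : measurable_fun I01 (fun x => h x <= K%:R).
  by apply: measurable_fun_ler => //; exact: measurable_cst.
have mif (K : nat) (k l : R -> R) : measurable_fun I01 k -> measurable_fun I01 l ->
    measurable_fun I01 (fun x => if h x <= K%:R then k x else l x).
  move=> mk ml; apply: (@measurable_fun_if _ _ _ _ k l I01 (@mI01 R) (fun x => h x <= K%:R)) => //.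
  - by apply: measurable_funS mk => // x [].
  - by apply: measurable_funS ml => // x [].
have bg K : bmf (g K) K%:R.
  split; first split.
  - have -> : (fun x => Re (g K x)) = (fun x => if h x <= K%:R then Re (f x) else 0).
      by apply: funext => x; rewrite /g; case: ifP.
    by apply: mif.
  - have -> : (fun x => Im (g K x)) = (fun x => if h x <= K%:R then Im (f x) else 0).
      by apply: funext => x; rewrite /g; case: ifP.
    by apply: mif.
  - move=> x _; rewrite /g; case: ifP => [hx|_]; last by rewrite cabs0.
    exact: le_trans (cabs_le_ReIm _) hx.
pose r (K : nat) x := if h x <= K%:R then 0 else h x.
have rE K x : `|Re (f x - g K x)| + `|Im (f x - g K x)| = r K x.
  by rewrite cReD cReN cImD cImN /r /g; case: ifP => _; rewrite /= ?subrr ?normr0 ?addr0 // !subr0.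
have [] := @dominated_convergence _ _ _ mu I01 (@mI01 R) (fun K x => (r K x)%:E) (fun=> 0%E) (EFin \o h).
- by move=> K; apply/measurable_EFinP; apply: mif.
- exact: measurable_cst.
- apply: aeW => x _; apply: cvg_near_cst; exists (Num.bound (h x)) => // K /= hK.
  rewrite /r ifT //; apply: le_trans (ltW (archi_boundP (h0 x))) _; by rewrite ler_nat.
- exact: ih.
- apply: aeW => x K _; rewrite /= lee_fin /r; case: ifP => _; rewrite ?normr0 //.
  by rewrite ger0_norm.
move=> _ _; rewrite integral0_eq // => /fine_cvgP[_] /cvgrPdist_lt/(_ e e0)[K _ hK].
exists (g K), K%:R; split; first exact: bg.
have := hK K (leqnn K); rewrite /= sub0r normrN => /ltW; apply: le_trans.
rewrite /n1 (@eq_Rintegral _ _ _ mu _ (r K)); last by move=> x _; rewrite rE.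
exact: ler_norm.
Qed.

(** Bessel's inequality settles bounded functions; truncation of f leaves a remainder small in L1,
    whose coefficients are small uniformly in m. *)
Lemma riemann_lebesgue f (e : R) : cintegrable I01 f -> 0 < e ->
  exists N, forall m : int, (N < `|m|)%N -> cabs (fourier f m) <= e.
Proof.
move=> hf e0; have [|g [B [bg hg]]] := n1_trunc (e := e / 4) hf; first by lra.
have [|N hN] := @bessel_small R g B 0 (e / 2) bg; first by lra.
exists N => m Nm; have ig := bmf_integrable bg.
have := tco_bound (fr 0 m) (cintegrableB (@mI01 R) hf ig); rewrite tcoB // => h1.
have := hN m Nm; rewrite fourierE => h2.
have -> : tco f (fr 0 m) = (tco f (fr 0 m) - tco g (fr 0 m)) + tco g (fr 0 m) by rewrite subrK.
apply: le_trans (cabsD _ _) _; lra.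
Qed.

End Operator.

(** * Estimates for [psis], and reduction of the infinite system to the resonant indices *)

Section PsiEstimates.
Variable R : realType.
Local Notation C := (R[i]).
Implicit Types (q w u v r phi : int -> C) (nu m : int).

Lemma psis_bd q w M nu : (forall j, cabs (q j) <= M) -> bsum (fun l => M * cabs (w l)) (1 / 2) ->
  bd (psis q w nu) (2 * M).
Proof.
by move=> hq hw; apply: (nser_bd (conv_ker hq) hw) => m; exact: hq.
Qed.

Lemma psis_eq q w M nu m : (forall j, cabs (q j) <= M) -> bsum (fun l => M * cabs (w l)) (1 / 2) ->
  psis q w nu m = csum (fun l => q (m - l) * w l * psis q w nu l) + q (m - nu).
Proof.
by move=> hq hw; apply: (nser_eq (conv_ker hq) hw m (G := M)) => k; exact: hq.
Qed.

(** The difference of the two solutions solves the equation for [w] with free term sum_l q_{k-l}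
    (w_l - w'_l) psi'_l, bounded by 2 M^2 D; the Neumann series at most doubles it. *)
Lemma psis_lip q w w' M D nu m : (forall j, cabs (q j) <= M) ->
  bsum (fun l => M * cabs (w l)) (1 / 2) -> bsum (fun l => M * cabs (w' l)) (1 / 2) ->
  bsum (fun l => cabs (w l - w' l)) D ->
  cabs (psis q w nu m - psis q w' nu m) <= 4 * M ^+ 2 * D.
Proof.
move=> hq hw hw' hD.
have M0 : 0 <= M by apply: le_trans (hq 0); exact: cabs_ge0.
have b := psis_bd nu hq hw; have b' := psis_bd nu hq hw'.
pose phi l := psis q w nu l - psis q w' nu l.
pose g k := csum (fun l => q (k - l) * (w l - w' l) * psis q w' nu l).
have gd k : dom (fun l => q (k - l) * (w l - w' l) * psis q w' nu l)
    (fun l => (M * (2 * M)) * cabs (w l - w' l)).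
  move=> l; rewrite !cabsM.
  have -> : M * (2 * M) * cabs (w l - w' l) = M * cabs (w l - w' l) * (2 * M) by ring.
  by apply: ler_pM; rewrite ?mulr_ge0 ?cabs_ge0 ?ler_wpM2r ?cabs_ge0.
have gb : bsum (fun l => (M * (2 * M)) * cabs (w l - w' l)) ((M * (2 * M)) * D).
  by apply: bsumZ => //; rewrite !mulr_ge0.
have hg : bd g ((M * (2 * M)) * D) by move=> k; exact: csum_le (gd k) gb.
have hphi : forall k, phi k = kop (fun m l => q (m - l) * w l) phi k + g k.
  move=> k; rewrite /phi (psis_eq nu k hq hw) (psis_eq nu k hq hw').
  rewrite (kopB (conv_ker hq) hw k b b') /kop /g.
  have -> : csum (fun l => q (k - l) * (w l - w' l) * psis q w' nu l) =
     csum (fun l => q (k - l) * w l * psis q w' nu l) - csum (fun l => q (k - l) * w' l * psis q w' nu l).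
    rewrite -(csumB (kop_dom (conv_ker hq) k b') (kop_bsum hw b')
       (kop_dom (conv_ker hq) k b') (kop_bsum hw' b')).
    by apply: csum_eq => l; ring.
  move: (csum (fun l => q (k - l) * w l * psis q w nu l)) (csum (fun l => q (k - l) * w l * psis q w' nu l))
    (csum (fun l => q (k - l) * w' l * psis q w' nu l)) (q (k - nu)) => a1 a2 a3 a4.
  by rewrite opprD addrACA subrr addr0 addrA subrK.
have := nser_fix_bd (conv_ker hq) hw hg (bdD b (bdN b')) hphi m.
by move=> h; apply: le_trans h _; rewrite le_eqVlt; apply/orP; left; apply/eqP; ring.
Qed.

(* Reversing the order of the summation indices; it expresses A' as A for the reflected weights. *)
Lemma psis_reverse q w M nu : (forall j, cabs (q j) <= M) ->
  bsum (fun l => M * cabs (w l)) (1 / 2) ->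
  psis q (fun l => w (- l)) (- nu) (- nu) = psis q w nu nu.
Proof.
move=> hq hw.
have M0 : 0 <= M by apply: le_trans (hq 0); exact: cabs_ge0.
have hwN : bsum (fun l => M * cabs (w (- l))) (1 / 2).
  exact: (bsum_inj (h := fun l => - l) (@oppr_inj _) hw).
pose psi := psis q w nu.
pose phi l := psis q (fun l => w (- l)) (- nu) (- l).
have bpsi : bd psi (2 * M) := psis_bd nu hq hw.
have bphi : bd phi (2 * M) by move=> l; exact: (psis_bd (- nu) hq hwN).
pose W l := M * cabs (w l).
have phiE i : phi i = csum (fun j => q (j - i) * w j * phi j) + q (nu - i).
  rewrite /phi (psis_eq _ _ hq hwN) addrC opprK addrC (addrC (- i)); congr (_ + _).
  pose F j := q (j - i) * w j * phi j.
  rewrite -/(csum F) -(@csum_bij _ F (fun j => 2 * M * W j) (2 * M * (1 / 2)) (fun l => - l) (fun l => - l)).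
  - by apply: csum_eq => l; rewrite /F /phi opprK (addrC (- l)).
  - exact: opprK.
  - exact: opprK.
  - by move=> j; rewrite /F cabsM mulrC ler_pM ?cabs_ge0 // cabsM ler_wpM2r ?cabs_ge0.
  - by apply: bsumZ => //; rewrite mulr_ge0.
(* A bilinear sum evaluated in two orders: the equation for [psi] gives [csum T - csum P], the one
   for [phi] gives [csum T - csum P']. Hence the sums of [P] and [P'] agree. *)
pose G j i := w j * phi j * (q (j - i) * w i * psi i).
have hG j i : cabs (G j i) <= (2 * W j) * (2 * M * W i).
  rewrite /G !cabsM /W.
  have h1 := bphi j; have h2 := bpsi i; have h3 := hq (j - i).
  have -> : 2 * (M * cabs (w j)) * (2 * M * (M * cabs (w i))) =
     cabs (w j) * (2 * M) * (M * cabs (w i) * (2 * M)) by ring.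
  by rewrite !ler_pM ?mulr_ge0 ?cabs_ge0.
have b1 : bsum (fun j => 2 * W j) (2 * (1 / 2)) by exact: bsumZ.
have b2 : bsum (fun i => 2 * M * W i) (2 * M * (1 / 2)) by apply: bsumZ => //; rewrite mulr_ge0.
have W0 j : 0 <= W j by rewrite mulr_ge0 ?cabs_ge0.
have fub := csum_fubini hG b1 b2 (fun j => mulr_ge0 (ler0n _ 2) (W0 j))
  (fun i => mulr_ge0 (mulr_ge0 (ler0n _ 2) M0) (W0 i)).
pose T j := w j * phi j * psi j.
have dT : dom T (fun j => 2 * M * (2 * W j)).
  move=> j; rewrite /T !cabsM /W; have h1 := bphi j; have h2 := bpsi j.
  have -> : 2 * M * (2 * (M * cabs (w j))) = cabs (w j) * (2 * M) * (2 * M) by ring.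
  by rewrite !ler_pM ?mulr_ge0 ?cabs_ge0.
have bT : bsum (fun j => 2 * M * (2 * W j)) (2 * M * (2 * (1 / 2))).
  by apply: bsumZ => //; rewrite mulr_ge0.
have row j : csum (G j) = w j * phi j * (psi j - q (j - nu)).
  rewrite /psi (psis_eq nu j hq hw) addrK /G.
  exact: csumZ _ (kop_dom (conv_ker hq) j bpsi) (kop_bsum hw bpsi).
have col i : csum (G ^~ i) = w i * psi i * (phi i - q (nu - i)).
  rewrite phiE addrK -(@csumZ _ _ (fun j => 2 * M * W j) (2 * M * (1 / 2))).
  - by apply: csum_eq => j; rewrite /G; ring.
  - by move=> j; rewrite cabsM mulrC ler_pM ?cabs_ge0 // cabsM ler_wpM2r ?cabs_ge0.
  - exact: b2.
pose P j := w j * phi j * q (j - nu).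
pose P' i := w i * psi i * q (nu - i).
have dP : dom P (fun j => 2 * M * W j).
  move=> j; rewrite /P !cabsM /W; have h1 := bphi j; have h3 := hq (j - nu).
  have -> : 2 * M * (M * cabs (w j)) = cabs (w j) * (2 * M) * M by ring.
  by rewrite !ler_pM ?mulr_ge0 ?cabs_ge0.
have dP' : dom P' (fun j => 2 * M * W j).
  move=> j; rewrite /P' !cabsM /W; have h1 := bpsi j; have h3 := hq (nu - j).
  have -> : 2 * M * (M * cabs (w j)) = cabs (w j) * (2 * M) * M by ring.
  by rewrite !ler_pM ?mulr_ge0 ?cabs_ge0.
have e1 : csum (fun j => csum (G j)) = csum T - csum P.
  rewrite -(csumB dT bT dP b2); apply: csum_eq => j; rewrite row /T /P; ring.
have e2 : csum (fun i => csum (G ^~ i)) = csum T - csum P'.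
  rewrite -(csumB dT bT dP' b2); apply: csum_eq => j; rewrite col /T /P'; ring.
have PP : csum P = csum P'.
  by move: fub; rewrite e1 e2 => /addrI /oppr_inj.
have -> : psis q (fun l => w (- l)) (- nu) (- nu) = phi nu by [].
rewrite phiE -/psi /psi (psis_eq nu nu hq hw); congr (_ + _).
transitivity (csum P); first by apply: csum_eq => j; rewrite /P; ring.
by rewrite PP; apply: csum_eq => j; rewrite /P' /psi; ring.
Qed.

Section Weighted.
Variables (q w : int -> C) (M sg : R) (s : nat) (nu : int).
Hypotheses (hqs : forall j, cabs (q j) * (1 + `|j%:~R|) ^+ s <= M)
  (hws : bsum (fun l => M * cabs (w l)) sg) (hsg : sg <= 1 / 2).
Let wg (m : int) : R := (1 + `|m%:~R|) ^+ s.

Lemma wg_ge1 m : 1 <= wg m.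
Proof. by rewrite /wg exprn_ege1 // lerDl. Qed.
(** Submultiplicativity of the weight, from 1 + |a + b| <= (1 + |a|)(1 + |b|). It lets the Neumann
    series keep the decay of [q] in m - nu with the same contraction factor [sg]. *)
Lemma wg_sub m l : wg (m - nu) <= wg (m - l) * wg (l - nu).
Proof.
rewrite /wg -exprMn; apply: lerXn2r; rewrite ?nnegrE.
- by rewrite addr_ge0.
- by rewrite mulr_ge0 // addr_ge0.
- have : `|(m - nu)%:~R| <= `|(m - l)%:~R| + `|(l - nu)%:~R| :> R.
    by rewrite -[m - nu](subrKA l) rmorphD /= ler_normD.
  have := mulr_ge0 (normr_ge0 ((m - l)%:~R : R)) (normr_ge0 ((l - nu)%:~R : R)); nra.
Qed.

Lemma weighted_bd j : cabs (q j) <= M.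
Proof.
apply: le_trans (hqs j); rewrite -[leLHS]mulr1 ler_wpM2l ?cabs_ge0 //; exact: wg_ge1.
Qed.
Lemma weighted_bsum : bsum (fun l => M * cabs (w l)) (1 / 2).
Proof. exact: bsum_leM hsg hws. Qed.

Let K (m l : int) := q (m - l) * w l.

Lemma weighted_kop phi G : (forall m, cabs (phi m) * wg (m - nu) <= G) ->
  forall m, cabs (kop K phi m) * wg (m - nu) <= sg * G.
Proof.
move=> hphi m; have G0 : 0 <= G.
  by apply: le_trans (hphi 0); rewrite mulr_ge0 ?cabs_ge0 // (le_trans _ (wg_ge1 _)).
have p k : 0 < wg k by apply: lt_le_trans (wg_ge1 k).
rewrite -ler_pdivlMr ?p // -(mulrC G).
have := @csum_le _ (fun l => K m l * phi l) (fun l => G / wg (m - nu) * (M * cabs (w l))) (G / wg (m - nu) * sg).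
rewrite mulrAC; apply.
- move=> l; rewrite /K !cabsM.
  have -> : G / wg (m - nu) * (M * cabs (w l)) = cabs (w l) * (M * G / wg (m - nu)) by ring.
  have -> : cabs (q (m - l)) * cabs (w l) * cabs (phi l) = cabs (w l) * (cabs (phi l) * cabs (q (m - l))) by ring.
  apply: ler_wpM2l; rewrite ?cabs_ge0 //.
  rewrite ler_pdivlMr ?p //.
  apply: (@le_trans _ _ ((cabs (phi l) * wg (l - nu)) * (cabs (q (m - l)) * wg (m - l)))).
    have h := wg_sub m l.
    have -> : cabs (phi l) * wg (l - nu) * (cabs (q (m - l)) * wg (m - l)) =
      cabs (phi l) * cabs (q (m - l)) * (wg (m - l) * wg (l - nu)) by ring.
    by apply: ler_wpM2l; rewrite ?mulr_ge0 ?cabs_ge0.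
  rewrite mulrC; apply: ler_pM; rewrite ?mulr_ge0 ?cabs_ge0 ?hqs ?hphi // ltW ?p //.
- by rewrite mulrAC; apply: bsumZ => //; rewrite divr_ge0 // ltW ?p.
Qed.

Lemma psis_weighted m : cabs (psis q w nu m) * wg (m - nu) <= 2 * M.
Proof.
have M0 : 0 <= M by apply: le_trans (weighted_bd 0); exact: cabs_ge0.
have p k : 0 < wg k by apply: lt_le_trans (wg_ge1 k).
have s0 : 0 <= sg := bsum_ge0 hws.
pose g k := q (k - nu).
have it i k : cabs (iter i (kop K) g k) * wg (k - nu) <= M / 2 ^+ i.
  elim: i k => [|i IH] k; first by rewrite expr0 divr1; exact: hqs.
  rewrite iterS; apply: le_trans (weighted_kop IH k) _.
  have -> : M / 2 ^+ i.+1 = (1 / 2) * (M / 2 ^+ i) by rewrite exprSr invfM; ring.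
  by apply: ler_wpM2r => //; rewrite divr_ge0 // exprn_ge0.
have pt k : cabs (npart K g k m) * wg (m - nu) <= 2 * M - 2 * M / 2 ^+ k.
  elim: k => [|k IH]; first by rewrite /npart big_ord0 cabs0 mul0r expr0 divr1 subrr.
  rewrite /npart big_ord_recr /= -/(npart K g k m).
  apply: le_trans (ler_wpM2r (ltW (p _)) (cabsD _ _)) _; rewrite mulrDl.
  apply: le_trans (lerD IH (it k m)) _; rewrite exprSr invfM; lra.
rewrite -ler_pdivlMr ?p //.
have bg : bd g M by move=> k; exact: weighted_bd.
apply: ccvg_bound (nser_cvg (conv_ker weighted_bd) weighted_bsum m bg) _ => k.
rewrite ler_pdivlMr ?p //; apply: le_trans (pt k) _.
by rewrite lerBlDr lerDl divr_ge0 ?mulr_ge0 // exprn_ge0.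
Qed.

(** What remains after the free and the first-order term is the operator applied twice to [psis],
    hence two factors [sg]; by [vw0_small] their product is o(1/n). *)
Lemma psis_expand m :
  cabs (psis q w nu m - q (m - nu) - csum (fun l => q (m - l) * w l * q (l - nu))) * wg (m - nu)
  <= sg * (sg * (2 * M)).
Proof.
have hq := weighted_bd; have hw := weighted_bsum.
have bpsi := psis_bd nu hq hw.
have bg : bd (fun l => q (l - nu)) M by move=> l.
have -> : psis q w nu m - q (m - nu) - csum (fun l => q (m - l) * w l * q (l - nu)) =
   kop K (kop K (psis q w nu)) m.
  rewrite (psis_eq nu m hq hw) addrK.
  rewrite -/(kop K (psis q w nu) m) -/(kop K (fun l => q (l - nu)) m).
  have := kopB (conv_ker hq) hw m bpsi bg => <-.
  congr (kop K _ m); apply: funext => l; apply/eqP; rewrite subr_eq; apply/eqP.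
  exact: psis_eq nu l hq hw.
by apply: weighted_kop; apply: weighted_kop; exact: psis_weighted.
Qed.

Lemma psis_diag : q 0 = 0 -> cabs (psis q w nu nu) <= sg * (2 * M).
Proof.
move=> q0; have hq := weighted_bd; have hw := weighted_bsum.
rewrite (psis_eq nu nu hq hw) subrr q0 addr0.
have := weighted_kop psis_weighted nu; rewrite /kop; apply: le_trans.
by rewrite -[leLHS]mulr1 ler_wpM2l ?cabs_ge0 //; exact: wg_ge1.
Qed.
End Weighted.

Section Resonance.
Variables (q w : int -> C) (d : int -> C) (M : R) (n : nat).
Hypotheses (hq : forall j, cabs (q j) <= M) (hw : bsum (fun l => M * cabs (w l)) (1 / 2))
  (n0 : (0 < n)%N)
  (wn : w n = 0) (wn' : w (- n%:Z) = 0)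
  (hd : forall m, m != n%:Z -> m != - n%:Z -> d m * w m = 1).
Let N := n%:Z.
Let K (m l : int) := q (m - l) * w l.

Section Chain.
Variables (u r : int -> C) (f : int -> R) (Mu Mr : R).
Hypotheses (hu : dom u f) (hf : bsum f Mu) (hr : bd r Mr)
  (heq : forall m, d m * u m = csum (fun k => q (m - k) * u k) - r m).
Let v m := csum (fun k => q (m - k) * u k).

Lemma conv_dom m : dom (fun k => q (m - k) * u k) (fun k => M * f k).
Proof. by move=> k; rewrite cabsM ler_pM ?cabs_ge0. Qed.
Lemma M_ge0 : 0 <= M.
Proof. by apply: le_trans (hq 0); exact: cabs_ge0. Qed.
Lemma conv_bsum : bsum (fun k => M * f k) (M * Mu).
Proof. by apply: bsumZ => //; exact: M_ge0. Qed.
Lemma conv_bd : bd v (M * Mu).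
Proof. by move=> m; exact: csum_le (conv_dom m) conv_bsum. Qed.

Lemma off_res k : k != N -> k != - N -> u k = w k * (v k - r k).
Proof. by move=> k1 k2; rewrite -heq mulrA (mulrC (w k)) hd // mul1r. Qed.

(** The convolution v of q and u, rather than u, is taken as the unknown. Its equation has the same
    form in all rows: the zero weights drop n and -n from the kernel, and the resonant values of u
    enter through the free term only. *)
Lemma chain_conv m : v m = u N * psis q w N m + u (- N) * psis q w (- N) m - nser K (kop K r) m.
Proof.
have bv := conv_bd; have bp := psis_bd N hq hw; have bp' := psis_bd (- N) hq hw.
have bKr := kop_bd (conv_ker hq) hw hr.
have bg : bd (fun m => u N * q (m - N) + u (- N) * q (m + N) - kop K r m)
    (cabs (u N) * M + cabs (u (- N)) * M + Mr / 2).
  by apply: bdD (bdN bKr); apply: bdD; apply: bdZ => k.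
have e1 : forall k, v k = kop K v k + (u N * q (k - N) + u (- N) * q (k + N) - kop K r k).
  move=> k; rewrite {1}/v (csum_split1 N (conv_dom k) conv_bsum).
  have D1 : dom (fun j => if j == N then 0 else q (k - j) * u j) (fun k => M * f k).
    move=> j; case: eqP => _; last exact: conv_dom.
    by rewrite cabs0; exact: (dom_ge0 j (conv_dom k)).
  rewrite (csum_split1 (- N) D1 conv_bsum).
  have -> : (- N == N) = false by apply/negbTE; rewrite /N; lia.
  rewrite opprK.
  have := kopB (conv_ker hq) hw k bv hr => h.
  have -> : csum (fun j => if j == - N then 0 else if j == N then 0 else q (k - j) * u j) =
      kop K (fun l => v l - r l) k.
    apply: csum_eq => j; rewrite /K; case: (eqVneq j (- N)) => [->|j1].
      by rewrite wn' mulr0 mul0r.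
    case: (eqVneq j N) => [->|j2]; first by rewrite wn mulr0 mul0r.
    by rewrite -mulrA -off_res.
  rewrite h; ring.
pose phi m := u N * psis q w N m + u (- N) * psis q w (- N) m - nser K (kop K r) m.
have bN := nser_bd (conv_ker hq) hw bKr.
have bphi : bd phi (cabs (u N) * (2 * M) + cabs (u (- N)) * (2 * M) + 2 * (Mr / 2)).
  by apply: bdD (bdN bN); apply: bdD; apply: bdZ.
have e2 : forall k, phi k = kop K phi k + (u N * q (k - N) + u (- N) * q (k + N) - kop K r k).
  move=> k; rewrite /phi.
  have b12 := bdD (bdZ (u N) bp) (bdZ (u (- N)) bp').
  rewrite (kopB (conv_ker hq) hw k b12 bN).
  rewrite (kopD (conv_ker hq) hw k (bdZ (u N) bp) (bdZ (u (- N)) bp')).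
  rewrite (kopZ (conv_ker hq) hw (u N) k bp) (kopZ (conv_ker hq) hw (u (- N)) k bp').
  rewrite (psis_eq N k hq hw) (psis_eq (- N) k hq hw) (nser_eq (conv_ker hq) hw k bKr) opprK.
  rewrite -/(kop K (psis q w N) k) -/(kop K (psis q w (- N)) k); ring.
rewrite (nser_unique (conv_ker hq) hw bg bv e1 m).
by rewrite -(nser_unique (conv_ker hq) hw bg bphi e2 m).
Qed.
End Chain.

Lemma kernel_coef u f Mu : dom u f -> bsum f Mu ->
  (forall m, d m * u m = csum (fun k => q (m - k) * u k)) ->
  forall m, csum (fun k => q (m - k) * u k) = u N * psis q w N m + u (- N) * psis q w (- N) m.
Proof.
move=> hu hf he m; have hr : bd (fun _ : int => 0 : C) 0 by move=> k /=; rewrite cabs0.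
have he' k : d k * u k = csum (fun j => q (k - j) * u j) - (fun _ : int => 0 : C) k by rewrite subr0.
rewrite (chain_conv hu hf hr he' m).
have k0 k : kop K (fun _ : int => 0 : C) k = 0.
  by apply: clim_eq; apply: ccvg_ext (ccvg_cst 0) => L; rewrite big1 // => l _; rewrite mulr0.
have -> : nser K (kop K (fun _ : int => 0 : C)) m = 0.
  apply/esym; apply: (@nser_unique _ K _ (conv_ker hq) hw _ 0 (fun _ : int => 0 : C) 0 _ _ _ m).
  - by move=> k; rewrite k0 cabs0.
  - by move=> k /=; rewrite cabs0.
  - by move=> k; rewrite !k0 addr0.
by rewrite subr0.
Qed.

Lemma kernel_off u f Mu : dom u f -> bsum f Mu ->
  (forall m, d m * u m = csum (fun k => q (m - k) * u k)) ->
  forall m, m != N -> m != - N -> u m = w m * (u N * psis q w N m + u (- N) * psis q w (- N) m).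
Proof.
by move=> hu hf he m m1 m2; rewrite -(kernel_coef hu hf he) -he mulrA (mulrC (w m)) hd // mul1r.
Qed.

Lemma kernel_zero u f Mu : dom u f -> bsum f Mu ->
  (forall m, d m * u m = csum (fun k => q (m - k) * u k)) ->
  u N = 0 -> u (- N) = 0 -> forall m, u m = 0.
Proof.
move=> hu hf he u1 u2 m; case: (eqVneq m N) => [->//|m1]; case: (eqVneq m (- N)) => [->//|m2].
by rewrite (kernel_off hu hf he m1 m2) u1 u2 !mul0r addr0 mulr0.
Qed.

Lemma kernel_exists (a b : C) :
  d N * a = a * psis q w N N + b * psis q w (- N) N ->
  d (- N) * b = a * psis q w N (- N) + b * psis q w (- N) (- N) ->
  exists u f Mu, [/\ dom u f, bsum f Mu, u N = a, u (- N) = b &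
    forall m, d m * u m = csum (fun k => q (m - k) * u k)].
Proof.
move=> ea eb.
have bp := psis_bd N hq hw; have bp' := psis_bd (- N) hq hw.
pose v m := a * psis q w N m + b * psis q w (- N) m.
pose V := cabs a * (2 * M) + cabs b * (2 * M).
have bv : bd v V by apply: bdD; apply: bdZ.
have V0 := bd_ge0 bv.
have NN : (- N == N) = false by apply/negbTE; rewrite /N; lia.
pose u m := if m == N then a else if m == - N then b else w m * v m.
have M0 := M_ge0.
(* The majorant in the main case divides by [M]. If [M = 0], then q vanishes and u is supported on n
   and -n. *)
have [Mp|M00] := ltP 0 M; last first.
  have Mz : M = 0 by apply/eqP; rewrite eq_le M00 M0.
  have q0 j : q j = 0 by apply: cabs_eq0; apply/eqP; rewrite eq_le cabs_ge0 andbT -Mz hq.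
  have p0 nu m : psis q w nu m = 0.
    apply: cabs_eq0; apply/eqP; rewrite eq_le cabs_ge0 andbT.
    by have := psis_bd nu hq hw m; rewrite Mz mulr0.
  exists (fun m => if m == N then a else if m == - N then b else 0),
    (fun m => (if m == N then cabs a else 0) + (if m == - N then cabs b else 0)), (cabs a + cabs b).
  split.
  - move=> m; case: eqP => _; first by case: eqP => _; rewrite ?addr0 ?lerDl ?cabs_ge0.
    by rewrite add0r; case: eqP => _; rewrite ?cabs0.
  - by apply: bsumD; apply: bsum_pt; exact: cabs_ge0.
  - by rewrite eqxx.
  - by rewrite NN eqxx.
  - move=> m; rewrite (csum_eq (G := fun=> 0)); last by move=> k; rewrite q0 mul0r.
    have -> : csum (fun=> 0 : C) = 0.
      by apply: clim_eq; apply: ccvg_ext (ccvg_cst 0) => L; rewrite big1.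
    case: eqP => [->|_]; first by rewrite ea !p0 !mulr0 addr0.
    by case: eqP => [->|_]; rewrite ?mulr0 // eb !p0 !mulr0 addr0.
pose f m := ((if m == N then cabs a else 0) + (if m == - N then cabs b else 0)) + V / M * (M * cabs (w m)).
have hu : dom u f.
  move=> m; rewrite /u /f; have x0 : 0 <= V / M * (M * cabs (w m)).
    by rewrite mulr_ge0 ?divr_ge0 // mulr_ge0 ?cabs_ge0.
  case: eqP => _; first by case: eqP => _; have := cabs_ge0 b; lra.
  case: eqP => _; first by rewrite add0r lerDl.
  have M1 : M != 0 by rewrite gt_eqF.
  have -> : 0 + 0 + V / M * (M * cabs (w m)) = cabs (w m) * V by field.
  by rewrite cabsM; apply: ler_wpM2l; [exact: cabs_ge0|exact: bv].
have hf : bsum f (cabs a + cabs b + V / M * (1 / 2)).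
  apply: bsumD; first by apply: bsumD; apply: bsum_pt; exact: cabs_ge0.
  by apply: bsumZ => //; rewrite divr_ge0.
have uN : u N = a by rewrite /u eqxx.
have uN' : u (- N) = b by rewrite /u NN eqxx.
have cv m : csum (fun k => q (m - k) * u k) = v m.
  rewrite (csum_split1 N (conv_dom hu m) (conv_bsum hf)).
  have D1 : dom (fun j => if j == N then 0 else q (m - j) * u j) (fun k => M * f k).
    move=> j; case: eqP => _; last exact: conv_dom.
    by rewrite cabs0; exact: (dom_ge0 j (conv_dom hu m)).
  rewrite (csum_split1 (- N) D1 (conv_bsum hf)) NN uN uN' opprK.
  have -> : csum (fun j => if j == - N then 0 else if j == N then 0 else q (m - j) * u j) = kop K v m.
    apply: csum_eq => j; rewrite /K; case: (eqVneq j (- N)) => [->|j1].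
      by rewrite wn' mulr0 mul0r.
    case: (eqVneq j N) => [->|j2]; first by rewrite wn mulr0 mul0r.
    by rewrite /u (negbTE j1) (negbTE j2) mulrA.
  rewrite (kopD (conv_ker hq) hw m (bdZ a bp) (bdZ b bp')).
  rewrite (kopZ (conv_ker hq) hw a m bp) (kopZ (conv_ker hq) hw b m bp').
  rewrite /v (psis_eq N m hq hw) (psis_eq (- N) m hq hw) opprK.
  rewrite -/(kop K (psis q w N) m) -/(kop K (psis q w (- N)) m); ring.
exists u, f; eexists; split; [exact: hu|exact: hf|exact: uN|exact: uN'|].
move=> m; rewrite cv; case: (eqVneq m N) => [->|m1]; first by rewrite uN ea.
case: (eqVneq m (- N)) => [->|m2]; first by rewrite uN' eb.
by rewrite /u (negbTE m1) (negbTE m2) mulrA hd // mul1r.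
Qed.

(** Off resonance [u1] itself carries a factor [w], so applying the kernel to it costs the sum of
    the squared weights, which is O(n^-2) and thus much smaller than the sum of the weights. *)
Lemma chain_step u1 f1 M1 u2 f2 M2 S2 : dom u1 f1 -> bsum f1 M1 -> dom u2 f2 -> bsum f2 M2 ->
  bsum (fun l => cabs (w l) ^+ 2) S2 ->
  (forall m, d m * u1 m = csum (fun k => q (m - k) * u1 k)) ->
  (forall m, d m * u2 m = csum (fun k => q (m - k) * u2 k) - u1 m) ->
  exists r1 r2 : C, let e := 4 * M ^+ 2 * S2 * (cabs (u1 N) + cabs (u1 (- N))) in
  [/\ cabs r1 <= e, cabs r2 <= e,
    d N * u2 N = u2 N * psis q w N N + u2 (- N) * psis q w (- N) N - (u1 N + r1) &
    d (- N) * u2 (- N) = u2 N * psis q w N (- N) + u2 (- N) * psis q w (- N) (- N) - (u1 (- N) + r2)].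
Proof.
move=> h1 b1 h2 b2 hS e1 e2; have M0 := M_ge0.
have bu1 : bd u1 M1 by move=> m; apply: le_trans (h1 m) (bsum1 m b1).
pose E := (cabs (u1 N) + cabs (u1 (- N))).
have hk : bd (kop K u1) (M * (2 * M * E) * S2).
  move=> m; apply: (@csum_le _ _ (fun l => M * (2 * M * E) * cabs (w l) ^+ 2)); last first.
    by apply: bsumZ => //; rewrite !mulr_ge0 ?addr_ge0 ?cabs_ge0.
  move=> l; case: (eqVneq l N) => [->|l1]; first by rewrite /K wn mulr0 mul0r cabs0 expr0n /= mulr0.
  case: (eqVneq l (- N)) => [->|l2]; first by rewrite /K wn' mulr0 mul0r cabs0 expr0n /= mulr0.
  rewrite (kernel_off h1 b1 e1 l1 l2) /K !cabsM.
  have -> : M * (2 * M * E) * cabs (w l) ^+ 2 = M * cabs (w l) * (cabs (w l) * (2 * M * E)) by ring.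
  apply: ler_pM; rewrite ?mulr_ge0 ?cabs_ge0 //; first by rewrite ler_wpM2r ?cabs_ge0.
  rewrite ler_wpM2l ?cabs_ge0 //; apply: le_trans (cabsD _ _) _; rewrite !cabsM /E mulrDr.
  by rewrite lerD // mulrC ler_wpM2r ?cabs_ge0 //; exact: psis_bd.
have bn := nser_bd (conv_ker hq) hw hk.
have cc := chain_conv h2 b2 bu1 e2.
exists (nser K (kop K u1) N), (nser K (kop K u1) (- N)) => /=.
have eE : 2 * (M * (2 * M * E) * S2) = 4 * M ^+ 2 * S2 * E by ring.
split.
- by rewrite -eE; exact: bn.
- by rewrite -eE; exact: bn.
- by rewrite e2 cc; ring.
- by rewrite e2 cc; ring.
Qed.

End Resonance.
End PsiEstimates.

(** * Distance to the negative axis, square roots and a fixed point theorem on a disc *)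

Section Sector.
Variable R : realType.
Local Notation C := (R[i]).
Local Notation Re := complex.Re.
Local Notation Im := complex.Im.

(** If Re z >= 0 or 3 |z| < x, the bound is direct. Otherwise |z| >= (x + |z|)/4, and with Z = x + z
    one has |Z| + Re Z = (Im z)^2 / (|Z| - Re Z), where the numerator is at least ep^2 (x + |z|)^2 /
    16 and the denominator at most 2 (x + |z|); this is the origin of 32. *)
Lemma sector_bound (z : C) (x ep : R) : 0 <= x -> 0 < ep <= 1 ->
  0 <= Re z \/ ep * cabs z <= `|Im z| ->
  ep ^+ 2 / 32 * (x + cabs z) <= cabs (RC x + z) + Re (RC x + z).
Proof.
move=> x0 /andP[ep0 ep1] hz; have cz := cabs_ge0 z; have cZ := cabs_ge0 (RC x + z).
have eRe : Re (RC x + z) = x + Re z by rewrite cReD.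
have eIm : Im (RC x + z) = Im z by rewrite cImD /= add0r.
have e2 : ep ^+ 2 <= 1 by rewrite expr_le1 // ltW.
have sZ := cabs_sqr (RC x + z); rewrite eRe eIm in sZ *.
have sz := cabs_sqr z.
have e20 : 0 <= ep ^+ 2 by exact: sqr_ge0.
have base : ep ^+ 2 / 32 * (x + cabs z) <= x + cabs z.
  by rewrite ler_piMl ?addr_ge0 //; lra.
have [re0|re0] := leP 0 (Re z).
  have : cabs z <= cabs (RC x + z).
    rewrite -ler_sqr ?nnegrE // sZ sz lerD2r ler_sqr ?nnegrE ?addr_ge0 //; lra.
  lra.
case: hz => [h|hIm]; first by lra.
have [zx|zx] := ltP (3 * cabs z) x.
  have hr := Re_le_cabs z; have : - cabs z <= Re z by move: hr; rewrite ler_norml => /andP[].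
  have : ep ^+ 2 / 32 * (x + cabs z) <= 1 / 32 * (x + cabs z).
    by rewrite ler_wpM2r ?addr_ge0 //; lra.
  lra.
set Z := cabs (RC x + z) in sZ cZ *.
have triZ : Z <= x + cabs z.
  by apply: le_trans (cabsD _ _) _; rewrite cabs_RC ger0_norm.
have im2 : (ep * cabs z) ^+ 2 <= Im z ^+ 2.
  by rewrite -(real_normK (num_real (Im z))) ler_sqr ?nnegrE ?mulr_ge0 // ltW.
have zp : 0 < x + cabs z.
  have : 0 < cabs z by apply: cabs_gt0; apply/eqP => z0; move: re0; rewrite z0 /=; lra.
  lra.
have prod : (Z + (x + Re z)) * (Z - (x + Re z)) = Im z ^+ 2.
  by rewrite mulrC -subr_sqr sZ; ring.
have absl : `|x + Re z| <= Z by rewrite -eRe; exact: Re_le_cabs.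
have [l1 l2] : - Z <= x + Re z /\ x + Re z <= Z by move: absl; rewrite ler_norml => /andP[].
set s := Z + (x + Re z) in prod *; set d := Z - (x + Re z) in prod.
have d0 : d <= 2 * (x + cabs z) by rewrite /d; lra.
have s0 : 0 <= s by rewrite /s; lra.
have h1 : (ep * cabs z) ^+ 2 <= s * (2 * (x + cabs z)).
  by apply: le_trans im2 _; rewrite -prod ler_wpM2l.
have h2 : (x + cabs z) ^+ 2 <= 16 * cabs z ^+ 2.
  have -> : 16 * cabs z ^+ 2 = (4 * cabs z) ^+ 2 by ring.
  by rewrite ler_sqr ?nnegrE ?addr_ge0 ?mulr_ge0 //; lra.
have h3 : ep ^+ 2 * (x + cabs z) ^+ 2 <= 32 * (s * (x + cabs z)).
  apply: le_trans (ler_wpM2l e20 h2) _; rewrite exprMn in h1; lra.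
have h4 : ep ^+ 2 * (x + cabs z) <= 32 * s.
  rewrite -(ler_pM2r zp); apply: (@le_trans _ _ (32 * (s * (x + cabs z)))).
    by rewrite -mulrA -expr2.
  by rewrite mulrA.
lra.
Qed.

Lemma csqrt_unique (w w' : C) : w ^+ 2 = w' ^+ 2 -> 0 < Re w -> 0 < Re w' -> w = w'.
Proof.
move=> /eqP; rewrite eqf_sqr => /orP[/eqP //|/eqP ->]; rewrite cReN => h1 h2; exfalso; lra.
Qed.

Definition csq (z : C) : C :=
  ClassicalEpsilon.epsilon (inhabits 0) (fun w => w ^+ 2 = z /\ 0 < Re w).
Lemma csqP (z w : C) : w ^+ 2 = z -> 0 < Re w -> csq z = w.
Proof.
move=> h1 h2; have [h3 h4] : csq z ^+ 2 = z /\ 0 < Re (csq z).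
  exact: (ClassicalEpsilon.epsilon_spec _ (fun w => w ^+ 2 = z /\ 0 < Re w) (ex_intro _ w (conj h1 h2))).
by apply: csqrt_unique; rewrite // h3 h1.
Qed.

(** The open disc is not complete; the iterates stay in the closed disc of radius [r0], so their
    limit remains inside the domain. *)
Lemma disc_fixpoint (F : C -> C) (c0 : C) (r0 r1 : R) : 0 <= r0 -> r0 < r1 ->
  (forall x, cabs (x - c0) < r1 -> cabs (F x - c0) <= r0) ->
  (forall x y, cabs (x - c0) < r1 -> cabs (y - c0) < r1 -> cabs (F x - F y) <= 1 / 2 * cabs (x - y)) ->
  exists x, cabs (x - c0) < r1 /\ F x = x.
Proof.
move=> r00 r01 hF hL; pose u k := iter k F c0.
have ud k : cabs (u k - c0) <= r0.
  elim: k => [|k IH]; first by rewrite /u /= subrr cabs0.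
  by apply: hF; exact: le_lt_trans IH r01.
have ud' k : cabs (u k - c0) < r1 by exact: le_lt_trans (ud k) r01.
have st k : cabs (u k.+1 - u k) <= r0 / 2 ^+ k.
  elim: k => [|k IH]; first by rewrite expr0 divr1; exact: ud.
  have h := hL _ _ (ud' k.+1) (ud' k).
  apply: (le_trans h); rewrite exprSr invfM; lra.
have cau k l : cabs (u (k + l)%N - u k) <= 2 * r0 / 2 ^+ k.
  have : cabs (u (k + l)%N - u k) <= 2 * r0 / 2 ^+ k - 2 * r0 / 2 ^+ (k + l).
    elim: l => [|l IH]; first by rewrite addn0 !subrr cabs0.
    rewrite addnS; apply: le_trans (cabs_tri _ (u (k + l)%N) _) _.
    apply: le_trans (lerD (st _) IH) _; rewrite exprSr invfM; lra.
  have : 0 <= r0 / 2 ^+ (k + l) by rewrite divr_ge0 // exprn_ge0.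
  lra.
have [|x hx] := @cauchy_ccvg _ u.
  move=> e e0; have [|N hN] := @half_small R (2 * r0) e _ e0; first by lra.
  exists N => k Nk; rewrite -(subnKC Nk); apply: le_trans (cau _ _) (ltW (hN N (leqnn N))).
have xd : cabs (x - c0) <= r0 by apply: ccvg_bound (ccvgB hx (ccvg_cst c0)) ud.
have xd' := le_lt_trans xd r01; exists x; split=> //.
apply/eqP; rewrite -subr_eq0; apply/eqP; apply: cabs_small => e e0.
have [|N hN] := hx (e / 2); first by lra.
have h1 := hN N (leqnn N); have h2 := hN N.+1 (leqnSn N).
apply: le_trans (cabs_tri _ (u N.+1) _) _.
have h3 : cabs (F x - u N.+1) <= 1 / 2 * cabs (x - u N) by exact: hL.
by rewrite (cabs_subC x) in h3; lra.
Qed.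

End Sector.

(** * The abstract two by two problem near a resonance *)

Section TwoByTwo.
Variable R : realType.
Local Notation C := (R[i]).
Local Notation Re := complex.Re.
Variables (c0 a b : C) (tau r r1 ep ka eta l : R) (A A' Be Be' : C -> C).
Let disc (x : C) := cabs (x - c0) < r1.
Hypotheses (tau0 : 0 <= tau) (r0 : 0 < r) (hz : cabs (a * b) = r ^+ 2)
  (ep01 : 0 < ep <= 1) (hsec : 0 <= Re (a * b) \/ ep * cabs (a * b) <= `|complex.Im (a * b)|)
  (ka1 : 1 <= ka) (hka : cabs a <= ka * r) (hkb : cabs b <= ka * r)
  (eta0 : 0 <= eta) (heta : 12 * ka * eta <= ep ^+ 2 / 32)
  (l0 : 0 <= l)
  (hA : forall x, disc x -> cabs (A x) <= 1) (hA' : forall x, disc x -> cabs (A' x) <= 1)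
  (hC : forall x, disc x -> cabs (A x - A' x) <= 2 * (eta * tau))
  (hB : forall x, disc x -> cabs (Be x - a) <= eta * r)
  (hB' : forall x, disc x -> cabs (Be' x - b) <= eta * r)
  (lA : forall x y, disc x -> disc y -> cabs (A x - A y) <= l * cabs (x - y))
  (lA' : forall x y, disc x -> disc y -> cabs (A' x - A' y) <= l * cabs (x - y))
  (lB : forall x y, disc x -> disc y -> cabs (Be x - Be y) <= l * cabs (x - y))
  (lB' : forall x y, disc x -> disc y -> cabs (Be' x - Be' y) <= l * cabs (x - y)).
Let de := ep ^+ 2 / 32.
Let k := Num.sqrt de / 2.
Hypotheses (hl : 16 * ka * l <= k) (hr1 : 3 * tau + 2 * r + 1 < r1).

(** In the application c0 = (2 pi n + t)^2, tau = 4 pi n t, a = q_{2n}, b = q_{-2n}, Be = q_{2n} + B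
    and Be' = q_{-2n} + B'. [eta] measures the perturbation relative to tau and r, [l] is a
    Lipschitz constant in the spectral parameter. *)
Definition Cx (x : C) := (A x - A' x) / 2.
Definition Dx (x : C) := (RC tau + Cx x) ^+ 2 + Be x * Be' x.
(** The scale of sqrt D: [Dx_root] bounds the root above and its real part below by fixed multiples
    of [h]. *)
Let h := Num.sqrt (tau ^+ 2 + r ^+ 2).

Lemma h2E : h ^+ 2 = tau ^+ 2 + r ^+ 2.
Proof. by rewrite sqr_sqrtr // addr_ge0 ?sqr_ge0. Qed.
Lemma h_gt0 : 0 < h.
Proof. by rewrite sqrtr_gt0 ltr_wpDl ?sqr_ge0 ?exprn_gt0. Qed.
Lemma tau_h : tau <= h.
Proof. by rewrite -ler_sqr ?nnegrE ?(ltW h_gt0) // h2E lerDl sqr_ge0. Qed.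
Lemma r_h : r <= h.
Proof. by rewrite -ler_sqr ?nnegrE ?(ltW h_gt0) ?(ltW r0) // h2E lerDr sqr_ge0. Qed.
Lemma h_le : h <= tau + r.
Proof.
have := ltW r0 => r0'; rewrite -ler_sqr ?nnegrE ?(ltW h_gt0) ?addr_ge0 // h2E.
have := mulr_ge0 tau0 r0'; nra.
Qed.
Lemma de_gt0 : 0 < de.
Proof. by move: ep01 => /andP[e0 _]; rewrite divr_gt0 // exprn_gt0. Qed.
Lemma de_le : de <= 1 / 32.
Proof.
have /andP[e0 e1] := ep01; have : ep ^+ 2 <= 1 by rewrite expr_le1 // ltW.
rewrite /de; lra.
Qed.
Lemma k_gt0 : 0 < k.
Proof. by rewrite divr_gt0 // sqrtr_gt0 de_gt0. Qed.
Lemma k2E : k ^+ 2 = de / 4.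
Proof. by rewrite /k exprMn sqr_sqrtr ?(ltW de_gt0) //; field. Qed.
Lemma k_le : k <= 1 / 4.
Proof.
rewrite -ler_sqr ?nnegrE ?(ltW k_gt0) // ?divr_ge0 // k2E; have := de_le; lra.
Qed.
Lemma eta_le : eta <= 1 / 384.
Proof.
have := de_le; move: heta; rewrite -/de => h1 h2.
have := ler_wpM2r eta0 ka1; lra.
Qed.

Lemma Cx_le x : disc x -> cabs (Cx x) <= eta * tau.
Proof.
move=> /hC h1; rewrite /Cx cabsM cabsV.
have -> : cabs (2 : C) = 2.
  by rewrite -[2]/(2%:R) -RCnat cabs_RC ger0_norm.
by rewrite ler_pdivrMr //; lra.
Qed.

(** C is bounded by [eta * tau] and not just by a constant, so the cross term 2 tau C is at most 2
    eta tau^2, small relative to h^2 for every t including those near 0. *)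
Lemma Dx_near x : disc x -> cabs (Dx x - (RC (tau ^+ 2) + a * b)) <= 3 * ka * eta * h ^+ 2.
Proof.
move=> dx; have c1 := Cx_le dx; have c2 := hB dx; have c3 := hB' dx.
have -> : Dx x - (RC (tau ^+ 2) + a * b) = RC (2 * tau) * Cx x + Cx x * Cx x
    + (a * (Be' x - b) + (Be x - a) * b + (Be x - a) * (Be' x - b)).
  rewrite /Dx RCX RCM [RC 2](RCnat R 2); ring.
have e1 := eta_le; have r00 := ltW r0.
have et0 : 0 <= eta * tau by rewrite mulr_ge0.
have er0 : 0 <= eta * r by rewrite mulr_ge0.
have kr0 : 0 <= ka * r by rewrite mulr_ge0 // (le_trans _ ka1).
have p1 : cabs (RC (2 * tau) * Cx x) <= 2 * tau * (eta * tau).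
  by rewrite cabsM cabs_RC ger0_norm ?mulr_ge0 // ler_wpM2l // mulr_ge0.
have p2 : cabs (Cx x * Cx x) <= (eta * tau) * (eta * tau).
  by rewrite cabsM ler_pM ?cabs_ge0.
have p3 : cabs (a * (Be' x - b)) <= (ka * r) * (eta * r) by rewrite cabsM ler_pM ?cabs_ge0.
have p4 : cabs ((Be x - a) * b) <= (eta * r) * (ka * r) by rewrite cabsM ler_pM ?cabs_ge0.
have p5 : cabs ((Be x - a) * (Be' x - b)) <= (eta * r) * (eta * r) by rewrite cabsM ler_pM ?cabs_ge0.
apply: (@le_trans _ _ (2 * tau * (eta * tau) + (eta * tau) * (eta * tau) +
   ((ka * r) * (eta * r) + (eta * r) * (ka * r) + (eta * r) * (eta * r)))).
  apply: le_trans (cabsD _ _) _; apply: lerD.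
    by apply: le_trans (cabsD _ _) _; exact: lerD.
  apply: le_trans (cabsD _ _) _; apply: lerD => //.
  by apply: le_trans (cabsD _ _) _; exact: lerD.
rewrite h2E.
have t2 := sqr_ge0 tau; have r2 := sqr_ge0 r.
have q1 : eta * (eta * tau ^+ 2) <= eta * tau ^+ 2.
  by apply: ler_piMl; rewrite ?mulr_ge0 //; lra.
have q2 : eta * (eta * r ^+ 2) <= eta * r ^+ 2.
  by apply: ler_piMl; rewrite ?mulr_ge0 //; lra.
have q3 : eta * tau ^+ 2 <= ka * (eta * tau ^+ 2) by apply: ler_peMl; rewrite ?mulr_ge0.
have q4 : eta * r ^+ 2 <= ka * (eta * r ^+ 2) by apply: ler_peMl; rewrite ?mulr_ge0.
have -> : 2 * tau * (eta * tau) + (eta * tau) * (eta * tau) +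
   ((ka * r) * (eta * r) + (eta * r) * (ka * r) + (eta * r) * (eta * r)) =
   2 * (eta * tau ^+ 2) + eta * (eta * tau ^+ 2) + (2 * (ka * (eta * r ^+ 2)) + eta * (eta * r ^+ 2)) by ring.
have -> : 3 * ka * eta * (tau ^+ 2 + r ^+ 2) = 3 * (ka * (eta * tau ^+ 2)) + 3 * (ka * (eta * r ^+ 2)) by ring.
lra.
Qed.

Lemma near_le : 3 * ka * eta * h ^+ 2 <= de / 4 * h ^+ 2.
Proof. by apply: ler_wpM2r; rewrite ?sqr_ge0 //; move: heta; rewrite -/de; lra. Qed.

(** [sector_bound] gives |z| + Re z >= de h^2 for the unperturbed z. By [heta] the perturbation is
    at most (de/4) h^2 in modulus and costs twice that, so (Re w)^2 >= (de/4) h^2 = (k h)^2. *)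
Lemma Dx_root x : disc x -> exists w, [/\ w ^+ 2 = Dx x, 0 < Re w, k * h <= Re w & cabs w <= 2 * h].
Proof.
move=> dx; have nr := Dx_near dx; have nl := near_le.
set z := RC (tau ^+ 2) + a * b in nr.
have sb := sector_bound (sqr_ge0 tau) ep01 hsec; rewrite -/z hz -h2E -/de in sb.
have h0 := h_gt0; have d0 := de_gt0; have hh : 0 < h ^+ 2 by rewrite exprn_gt0.
have dh : 0 < de * h ^+ 2 by rewrite mulr_gt0.
have l1 := cabs_lb z (Dx x); rewrite cabs_subC in l1.
have l2 : Re z - Re (Dx x) <= cabs (Dx x - z).
  by rewrite cabs_subC -cReN -cReD; exact: le_trans (ler_norm _) (Re_le_cabs _).
have lo : de / 2 * h ^+ 2 <= cabs (Dx x) + Re (Dx x) by lra.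
have [|w [w2 wR wR2]] := @csqrt_exists R (Dx x); first by lra.
exists w; split=> //.
- rewrite -ler_sqr ?nnegrE ?mulr_ge0 ?(ltW k_gt0) ?(ltW h0) ?(ltW wR) //.
  rewrite exprMn k2E wR2; lra.
- rewrite -ler_sqr ?nnegrE ?cabs_ge0 ?mulr_ge0 ?(ltW h0) // -cabsX w2.
  have u1 := cabs_lb (Dx x) z.
  have u2 : cabs z <= h ^+ 2.
    by apply: le_trans (cabsD _ _) _; rewrite cabs_RC ger0_norm ?sqr_ge0 // hz h2E.
  have := ler_wpM2r (ltW hh) de_le; lra.
Qed.

Let wx x := csq (Dx x).
Lemma wxP x : disc x -> [/\ wx x ^+ 2 = Dx x, 0 < Re (wx x), k * h <= Re (wx x) & cabs (wx x) <= 2 * h].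
Proof.
by move=> /Dx_root[w [w1 w2 w3 w4]]; rewrite /wx (csqP w1 w2).
Qed.

Lemma Be_le x : disc x -> cabs (Be x) <= 2 * ka * r.
Proof.
move=> dx; have := cabs_lb (Be x) a; have := hB dx; have := eta_le => e1 e2 e3.
have : eta * r <= ka * r by apply: ler_wpM2r; [exact: ltW|move: ka1 e1; lra].
move: hka; lra.
Qed.
Lemma Be'_le x : disc x -> cabs (Be' x) <= 2 * ka * r.
Proof.
move=> dx; have := cabs_lb (Be' x) b; have := hB' dx; have := eta_le => e1 e2 e3.
have : eta * r <= ka * r by apply: ler_wpM2r; [exact: ltW|move: ka1 e1; lra].
move: hkb; lra.
Qed.

Lemma cabs2 : cabs (2 : C) = 2.
Proof. by rewrite -[2]/(2%:R) -RCnat cabs_RC ger0_norm. Qed.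

Lemma Dx_lip x y : disc x -> disc y -> cabs (Dx x - Dx y) <= 8 * ka * h * (l * cabs (x - y)).
Proof.
move=> dx dy; set e := l * cabs (x - y).
have e0 : 0 <= e by rewrite mulr_ge0 ?cabs_ge0.
have cx := Cx_le dx; have cy := Cx_le dy; have et := eta_le; have th := tau_h; have rh := r_h.
have et1 : eta * tau <= tau by apply: ler_piMl => //; lra.
have lC : cabs (Cx x - Cx y) <= e.
  have -> : Cx x - Cx y = ((A x - A y) - (A' x - A' y)) / 2 by rewrite /Cx; ring.
  rewrite cabsM cabsV cabs2 ler_pdivrMr //; apply: le_trans (cabsB _ _) _.
  have := lA dx dy; have := lA' dx dy; rewrite -/e; lra.
have -> : Dx x - Dx y = (RC (2 * tau) + Cx x + Cx y) * (Cx x - Cx y) +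
   ((Be x - Be y) * Be' x + Be y * (Be' x - Be' y)).
  rewrite /Dx RCM [RC 2](RCnat R 2); ring.
have h0 := ltW h_gt0.
have p1 : cabs ((RC (2 * tau) + Cx x + Cx y) * (Cx x - Cx y)) <= (4 * h) * e.
  rewrite cabsM ler_pM ?cabs_ge0 //; apply: le_trans (cabsD _ _) _.
  have := cabsD (RC (2 * tau)) (Cx x); rewrite cabs_RC ger0_norm ?mulr_ge0 //; lra.
have kh : 2 * ka * r <= 2 * ka * h by apply: ler_wpM2l => //; move: ka1; lra.
have p2 : cabs ((Be x - Be y) * Be' x) <= e * (2 * ka * h).
  by rewrite cabsM ler_pM ?cabs_ge0 ?lB // (le_trans (Be'_le dx)).
have p3 : cabs (Be y * (Be' x - Be' y)) <= (2 * ka * h) * e.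
  by rewrite cabsM ler_pM ?cabs_ge0 ?lB' // (le_trans (Be_le dy)).
apply: le_trans (cabsD _ _) _.
have := cabsD ((Be x - Be y) * Be' x) (Be y * (Be' x - Be' y)) => p4.
have he := mulr_ge0 h0 e0; have := ler_wpM2r he ka1; lra.
Qed.

(** The difference of the roots is that of D divided by their sum, whose real part is at least 2 k
    h. The scale h cancels and leaves 4 ka l / k <= 1/4. *)
Lemma wx_lip x y : disc x -> disc y -> cabs (wx x - wx y) <= 1 / 4 * cabs (x - y).
Proof.
move=> dx dy; have [x2 x0 xk _] := wxP dx; have [y2 y0 yk _] := wxP dy.
have h0 := h_gt0; have k0 := k_gt0; have kh : 0 < k * h by rewrite mulr_gt0.
have s : 2 * (k * h) <= cabs (wx x + wx y).
  have := Re_le_cabs (wx x + wx y); rewrite cReD => /(le_trans (ler_norm _)); lra.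
have e : cabs (wx x - wx y) * cabs (wx x + wx y) <= 8 * ka * h * (l * cabs (x - y)).
  by rewrite -cabsM -subr_sqr x2 y2; exact: Dx_lip.
have h1 : cabs (wx x - wx y) * (2 * (k * h)) <= 8 * ka * h * (l * cabs (x - y)).
  by apply: le_trans e; rewrite ler_wpM2l ?cabs_ge0.
have c := cabs_ge0 (x - y).
have h2 : 8 * ka * h * (l * cabs (x - y)) <= 1 / 4 * cabs (x - y) * (2 * (k * h)).
  have := ler_wpM2r (mulr_ge0 (ltW h0) c) hl; lra.
have p2 : 0 < 2 * (k * h) by lra.
by rewrite -(ler_pM2r p2); exact: le_trans h1 h2.
Qed.

Definition Fx (sg : bool) x := c0 - RC tau + (A x + A' x) / 2 + (-1) ^+ sg * wx x.

Lemma cabs_sign (sg : bool) (z : C) : cabs ((-1) ^+ sg * z) = cabs z.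
Proof. by case: sg; rewrite ?expr1 ?mulN1r ?cabsN // expr0 mul1r. Qed.

Lemma Fx_lip sg x y : disc x -> disc y -> cabs (Fx sg x - Fx sg y) <= 1 / 2 * cabs (x - y).
Proof.
move=> dx dy.
have -> : Fx sg x - Fx sg y = ((A x - A y) + (A' x - A' y)) / 2 + (-1) ^+ sg * (wx x - wx y).
  by rewrite /Fx; ring.
apply: le_trans (cabsD _ _) _; rewrite cabs_sign cabsM cabsV cabs2.
have h1 : (cabs (A x - A y + (A' x - A' y))) / 2 <= l * cabs (x - y).
  rewrite ler_pdivrMr //; apply: le_trans (cabsD _ _) _.
  have := lA dx dy; have := lA' dx dy; lra.
have h2 := wx_lip dx dy; have c := cabs_ge0 (x - y).
have h3 : l <= 1 / 4.
  have := k_le; have := ler_wpM2r l0 ka1; move: hl; lra.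
have := ler_wpM2r c h3; lra.
Qed.

(** The shift contributes tau, the mean of A and A' at most 1, and the root at most 2 h <= 2 tau + 2
    r. *)
Lemma Fx_disc sg x : disc x -> cabs (Fx sg x - c0) <= 3 * tau + 2 * r + 1.
Proof.
move=> dx; have [_ _ _ w] := wxP dx; have hl' := h_le.
have -> : Fx sg x - c0 = - RC tau + (A x + A' x) / 2 + (-1) ^+ sg * wx x by rewrite /Fx; ring.
apply: le_trans (cabsD _ _) _; rewrite cabs_sign.
apply: le_trans (lerD (cabsD _ _) (lexx _)) _; rewrite cabsN cabs_RC ger0_norm // cabsM cabsV cabs2.
have h1 : cabs (A x + A' x) / 2 <= 1.
  rewrite ler_pdivrMr //; apply: le_trans (cabsD _ _) _.
  have := hA dx; have := hA' dx; lra.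
lra.
Qed.

Lemma Fx_fix sg : exists x, disc x /\ Fx sg x = x.
Proof.
have r0' := ltW r0.
apply: (@disc_fixpoint R (Fx sg) c0 (3 * tau + 2 * r + 1) r1) => //.
- by move: tau0; lra.
- by move=> x; exact: Fx_disc.
- by move=> x y; exact: Fx_lip.
Qed.

Lemma Fx_unique sg x y : disc x -> disc y -> Fx sg x = x -> Fx sg y = y -> x = y.
Proof.
move=> dx dy ex ey; have := Fx_lip sg dx dy; rewrite ex ey => hh.
by apply/eqP; rewrite -subr_eq0; apply/eqP; apply: cabs_eq0; have := cabs_ge0 (x - y); lra.
Qed.

Lemma Fx_distinct x : disc x -> Fx true x = x -> Fx false x = x -> False.
Proof.
move=> dx e1 e2; have [_ w0 _ _] := wxP dx.
have : (Fx false x - Fx true x) = 2 * wx x by rewrite /Fx expr0 expr1; ring.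
rewrite e1 e2 subrr => /esym/eqP; rewrite mulf_eq0 pnatr_eq0 /= => /eqP w00.
by move: w0; rewrite w00 /= ltxx.
Qed.

Definition pp x := x - c0 - A x.
Definition pp' x := x - c0 + RC (2 * tau) - A' x.

(** Completing the square: with y the mean of [pp] and [pp'], half their difference is tau + C up to
    sign, so the determinant equals y^2 - D. *)
Lemma det_Fx x : disc x -> (pp x * pp' x = Be x * Be' x <-> exists sg, Fx sg x = x).
Proof.
move=> dx; have [w2 _ _ _] := wxP dx.
pose y := x - c0 + RC tau - (A x + A' x) / 2.
have e : pp x * pp' x - Be x * Be' x = y ^+ 2 - wx x ^+ 2.
  by rewrite w2 /Dx /pp /pp' /y /Cx RCM [RC 2](RCnat R 2); field.
split=> [h1|[sg h1]].
  have : y ^+ 2 == wx x ^+ 2 by rewrite -subr_eq0 -e h1 subrr.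
  rewrite eqf_sqr => /orP[/eqP h2|/eqP h2]; [exists false|exists true];
    rewrite /Fx ?expr0 ?expr1 ?mul1r ?mulN1r -h2 /y; ring.
apply/eqP; rewrite -subr_eq0 e subr_eq0; apply/eqP.
have -> : y = (-1) ^+ sg * wx x by rewrite /y -{1}h1 /Fx; ring.
by rewrite exprMn -exprM mulnC exprM sqrrN expr1n expr1n mul1r.
Qed.

(** If [Be x] vanished, then |a| <= eta r and |a b| <= eta ka r^2 < r^2. The nonvanishing later
    makes the second resonant coordinate a function of the first. *)
Lemma Be_neq0 x : disc x -> Be x != 0.
Proof.
move=> dx; apply/eqP => b0; have := hB dx; rewrite b0 sub0r cabsN => h1.
have h2 : r ^+ 2 <= (eta * r) * (ka * r) by rewrite -hz cabsM ler_pM ?cabs_ge0.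
have h3 : eta * ka <= 1 / 384.
  by have := de_le; move: heta; rewrite -/de; lra.
have r2 : 0 < r ^+ 2 by rewrite exprn_gt0.
have h4 : eta * r * (ka * r) = eta * ka * r ^+ 2 by ring.
have := ler_wpM2r (ltW r2) h3; lra.
Qed.

(* Multiplying the Jordan system by the adjugate matrix eliminates [y1, y2] and leaves
   [(pp + pp') (x1, x2) = small], while [pp + pp' = 2 sqrt D] up to sign. *)
Lemma resonance_simple sg x (x1 x2 y1 y2 s1 s2 : C) (e : R) : disc x -> Fx sg x = x ->
  0 <= e -> 8 * ka * e < k ->
  pp x * x1 = Be x * x2 -> pp' x * x2 = Be' x * x1 ->
  pp x * y1 = Be x * y2 - (x1 + s1) -> pp' x * y2 = Be' x * y1 - (x2 + s2) ->
  cabs s1 <= e * (cabs x1 + cabs x2) -> cabs s2 <= e * (cabs x1 + cabs x2) ->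
  x1 = 0 /\ x2 = 0.
Proof.
move=> dx fx e0 ek e1 e2 e3 e4 b1 b2.
have [w2 w0 wk wh] := wxP dx; have h0 := h_gt0.
have det : pp x * pp' x = Be x * Be' x by apply/det_Fx => //; exists sg.
have s_e : pp x + pp' x = 2 * ((-1) ^+ sg * wx x).
  rewrite /pp /pp' RCM [RC 2](RCnat R 2); have -> : x - c0 = - RC tau + (A x + A' x) / 2 + (-1) ^+ sg * wx x.
    by rewrite -{1}fx /Fx; ring.
  by field.
have cw : k * h <= cabs (wx x) by exact: le_trans (le_trans wk (ler_norm _)) (Re_le_cabs _).
have cs : 2 * (k * h) <= cabs (pp x + pp' x) by rewrite s_e cabsM cabs2 cabs_sign; lra.
have th := tau_h; have et := eta_le; have rh := r_h.
have et1 : eta * tau <= tau by apply: ler_piMl => //; lra.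
have cC := Cx_le dx.
have p_le : cabs (pp x) <= 4 * h.
  have -> : pp x = (-1) ^+ sg * wx x - RC tau - Cx x.
    by rewrite /pp -{1}fx /Fx /Cx; field.
  apply: le_trans (cabsB _ _) _; apply: le_trans (lerD (cabsB _ _) (lexx _)) _.
  by rewrite cabs_sign cabs_RC ger0_norm //; lra.
have p'_le : cabs (pp' x) <= 4 * h.
  have -> : pp' x = (-1) ^+ sg * wx x + RC tau + Cx x.
    by rewrite /pp' -{1}fx /Fx /Cx RCM [RC 2](RCnat R 2); field.
  apply: le_trans (cabsD _ _) _; apply: le_trans (lerD (cabsD _ _) (lexx _)) _.
  by rewrite cabs_sign cabs_RC ger0_norm //; lra.
have kh : 2 * ka * r <= 2 * ka * h by apply: ler_wpM2l => //; move: ka1; lra.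
have B_le := le_trans (Be_le dx) kh; have B'_le := le_trans (Be'_le dx) kh.
set S := cabs x1 + cabs x2 in b1 b2.
have S0 : 0 <= S by rewrite addr_ge0 ?cabs_ge0.
set E := e * S in b1 b2.
have E0 : 0 <= E by rewrite mulr_ge0.
have f1 : (pp x + pp' x) * x1 = - (pp' x * s1 + Be x * s2).
  have : pp' x * (pp x * y1) = pp' x * (Be x * y2 - (x1 + s1)) by rewrite e3.
  have -> : pp' x * (pp x * y1) = Be x * (Be' x * y1).
    by rewrite mulrA (mulrC (pp' x)) det mulrA.
  have -> : pp' x * (Be x * y2 - (x1 + s1)) = Be x * (pp' x * y2) - pp' x * (x1 + s1) by ring.
  rewrite e4 => h1.
  have h2 : Be x * (x2 + s2) + pp' x * (x1 + s1) = 0.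
    have : Be x * (Be' x * y1) - (Be x * (Be' x * y1 - (x2 + s2)) - pp' x * (x1 + s1)) = 0.
      by rewrite -h1 subrr.
    by move=> <-; ring.
  have -> : (pp x + pp' x) * x1 = pp x * x1 + pp' x * x1 by ring.
  rewrite e1; apply/eqP; rewrite -subr_eq0 opprK; apply/eqP; rewrite -[RHS]h2; ring.
have f2 : (pp x + pp' x) * x2 = - (Be' x * s1 + pp x * s2).
  have : pp x * (pp' x * y2) = pp x * (Be' x * y1 - (x2 + s2)) by rewrite e4.
  have -> : pp x * (pp' x * y2) = Be' x * (Be x * y2).
    by rewrite mulrA det mulrA (mulrC (Be x)).
  have -> : pp x * (Be' x * y1 - (x2 + s2)) = Be' x * (pp x * y1) - pp x * (x2 + s2) by ring.
  rewrite e3 => h1.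
  have h2 : Be' x * (x1 + s1) + pp x * (x2 + s2) = 0.
    have : Be' x * (Be x * y2) - (Be' x * (Be x * y2 - (x1 + s1)) - pp x * (x2 + s2)) = 0.
      by rewrite -h1 subrr.
    by move=> <-; ring.
  have -> : (pp x + pp' x) * x2 = pp x * x2 + pp' x * x2 by ring.
  rewrite e2; apply/eqP; rewrite -subr_eq0 opprK; apply/eqP; rewrite -[RHS]h2; ring.
have ka0 : 0 <= 2 * ka * h by rewrite !mulr_ge0 ?(ltW h0) //; move: ka1; lra.
have bd (P Q : C) : cabs P <= 4 * h -> cabs Q <= 2 * ka * h ->
    cabs (- (P * s1 + Q * s2)) <= (4 * h + 2 * ka * h) * E /\
    cabs (- (Q * s1 + P * s2)) <= (4 * h + 2 * ka * h) * E.
  move=> hP hQ.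
  have pq (P' Q' : C) (x' y' : R) : cabs P' <= x' -> cabs Q' <= y' -> cabs (P' * s1 + Q' * s2) <= (x' + y') * E.
    move=> h1 h2; apply: le_trans (cabsD _ _) _; rewrite !cabsM mulrDl.
    by apply: lerD; apply: ler_pM; rewrite ?cabs_ge0.
  by rewrite !cabsN; split; [exact: pq|rewrite addrC (addrC (4 * h)); rewrite addrC; exact: pq].
have [g1 _] := bd _ _ p'_le B_le; have [_ g2] := bd _ _ p_le B'_le.
have m1 : 2 * (k * h) * cabs x1 <= (4 * h + 2 * ka * h) * E.
  by apply: le_trans g1; rewrite -f1 cabsM ler_wpM2r ?cabs_ge0.
have m2 : 2 * (k * h) * cabs x2 <= (4 * h + 2 * ka * h) * E.
  by apply: le_trans g2; rewrite -f2 cabsM ler_wpM2r ?cabs_ge0.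
(* The scale h cancels again: the left sides of [m1] and [m2] add up to 2 k h S, the right sides to
   at most 12 ka e h S, which is smaller because 8 ka e < k. *)
have key : S = 0.
  apply/eqP; rewrite eq_le S0 andbT leNgt; apply/negP => Sp.
  have hS : 0 < h * S by rewrite mulr_gt0.
  have t1 : 2 * (k * h) * S <= 2 * ((4 * h + 2 * ka * h) * E) by rewrite {1}/S mulrDr; lra.
  have t2 : 2 * ((4 * h + 2 * ka * h) * E) <= 12 * ka * e * (h * S).
    have := ler_wpM2r (mulr_ge0 e0 (ltW hS)) ka1; rewrite /E; lra.
  have t3 : 8 * ka * e * (h * S) < k * (h * S) by rewrite ltr_pM2r.
  have t4 : 12 * ka * e * (h * S) < 2 * (k * h) * S.
    by have := mulr_gt0 k_gt0 hS; lra.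
  by have := lt_le_trans t4 (le_trans t1 t2); rewrite ltxx.
move: key; rewrite /S => hS; have := cabs_ge0 x1; have := cabs_ge0 x2 => u1 u2.
by split; apply: cabs_eq0; lra.
Qed.

End TwoByTwo.

(** * Sums of the reciprocal denominators *)

Section Weights.
Variable R : realType.
Local Notation C := (R[i]).
Implicit Types (m j : int).

Definition dist_n (n : nat) m : R := `|(m - n%:Z)%:~R| * `|(m + n%:Z)%:~R|.
Definition vw (n : nat) m : R := (dist_n n m)^-1.

Section Pointwise.
Variables (n : nat) (m : int).
Hypotheses (n0 : (0 < n)%N) (m1 : m != n%:Z) (m2 : m != - n%:Z).
Let x : R := `|(m - n%:Z)%:~R|.
Let y : R := `|(m + n%:Z)%:~R|.

Lemma x_ge1 : 1 <= x.
Proof. by rewrite /x -intr_norm ler1z; move: m1; lia. Qed.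
Lemma y_ge1 : 1 <= y.
Proof. by rewrite /y -intr_norm ler1z; move: m2; lia. Qed.
Lemma inv2x : inv2 R (m - n%:Z) = (x ^+ 2)^-1.
Proof.
rewrite /inv2 ifF; last by apply/negbTE; move: m1; rewrite subr_eq0.
by rewrite /x real_normK ?num_real.
Qed.
Lemma inv2y : inv2 R (m + n%:Z) = (y ^+ 2)^-1.
Proof.
rewrite /inv2 ifF; last by apply/negbTE; move: m2; rewrite addr_eq0.
by rewrite /y real_normK ?num_real.
Qed.

(** The larger factor of |m^2 - n^2| dominates both n and |m|, while the inverse square of the
    smaller one is summable; this yields all the bounds on squared weights. *)
Lemma max_cases : (n%:R <= x /\ `|m%:~R| <= x) \/ (n%:R <= y /\ `|m%:~R| <= y).
Proof.
have e : n%:R = (n%:Z)%:~R :> R by [].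
rewrite /x /y -!intr_norm e !ler_int.
have [h|h] := leP 0 m; [right|left]; lia.
Qed.

Lemma vw_ge0 : 0 <= vw n m.
Proof. by rewrite invr_ge0 mulr_ge0. Qed.

Lemma dist_gt0 : 0 < dist_n n m.
Proof. by apply: mulr_gt0; [have := x_ge1|have := y_ge1]; rewrite -/x -/y; lra. Qed.

Lemma dist_ge : n%:R <= dist_n n m.
Proof.
have h1 := x_ge1; have h2 := y_ge1; rewrite /dist_n -/x -/y.
case: max_cases => -[h _]; apply: le_trans h _.
  by rewrite ler_peMr //; lra.
by rewrite ler_peMl //; lra.
Qed.

Lemma inv_max (a b z : R) : 1 <= a -> 1 <= b -> z <= b -> n%:R <= b ->
  z * ((a * b)^-1) ^+ 2 <= (a ^+ 2)^-1 / n%:R.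
Proof.
move=> a1 b1 zb nb; have np : 0 < n%:R :> R by rewrite ltr0n.
have a0 : 0 < a by lra. have b0 : 0 < b by lra.
apply: (@le_trans _ _ (b * ((a * b)^-1) ^+ 2)).
  by rewrite ler_wpM2r // sqr_ge0.
have -> : b * ((a * b)^-1) ^+ 2 = (a ^+ 2)^-1 / b.
  by field; rewrite !gt_eqF.
by rewrite ler_wpM2l ?invr_ge0 ?sqr_ge0 // lef_pV2 ?posrE.
Qed.

Lemma vw_max (z : R) : (n%:R <= x -> z <= x) -> (n%:R <= y -> z <= y) ->
  z * vw n m ^+ 2 <= (inv2 R (m - n%:Z) + inv2 R (m + n%:Z)) / n%:R.
Proof.
move=> zx zy; have h1 := x_ge1; have h2 := y_ge1; rewrite inv2x inv2y mulrDl.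
have np : 0 < n%:R :> R by rewrite ltr0n.
have p1 : 0 <= (x ^+ 2)^-1 / n%:R by rewrite divr_ge0 ?invr_ge0 ?sqr_ge0.
have p2 : 0 <= (y ^+ 2)^-1 / n%:R by rewrite divr_ge0 ?invr_ge0 ?sqr_ge0.
rewrite /vw /dist_n -/x -/y; case: max_cases => -[h _].
  by rewrite (mulrC x); have := inv_max h2 h1 (zx h) h; lra.
by have := inv_max h1 h2 (zy h) h; lra.
Qed.

Lemma vw_n : n%:R * vw n m ^+ 2 <= (inv2 R (m - n%:Z) + inv2 R (m + n%:Z)) / n%:R.
Proof. exact: vw_max. Qed.

Lemma vw_m : `|m%:~R| * vw n m ^+ 2 <= (inv2 R (m - n%:Z) + inv2 R (m + n%:Z)) / n%:R.
Proof.
have np : 0 < n%:R :> R by rewrite ltr0n.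
have h1 := x_ge1; have h2 := y_ge1.
case: max_cases => -[h hm].
- rewrite inv2x inv2y mulrDl /vw /dist_n -/x -/y (mulrC x).
  have p1 : 0 <= (x ^+ 2)^-1 / n%:R by rewrite divr_ge0 ?invr_ge0 ?sqr_ge0.
  by have := inv_max h2 h1 hm h; lra.
- rewrite inv2x inv2y mulrDl /vw /dist_n -/x -/y.
  have p2 : 0 <= (y ^+ 2)^-1 / n%:R by rewrite divr_ge0 ?invr_ge0 ?sqr_ge0.
  by have := inv_max h1 h2 hm h; lra.
Qed.

Lemma vw_sqr : vw n m ^+ 2 <= (inv2 R (m - n%:Z) + inv2 R (m + n%:Z)) / n%:R ^+ 2.
Proof.
have np : 0 < n%:R :> R by rewrite ltr0n.
by rewrite expr2 invfM mulrA ler_pdivlMr // mulrC; exact: vw_n.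
Qed.
End Pointwise.

Lemma bsum_inv2_pair (n : nat) : bsum (fun m => inv2 R (m - n%:Z) + inv2 R (m + n%:Z)) 8.
Proof.
apply: (bsum_leM (M := 4 + 4)); first lra.
by apply: bsumD; apply: (bsum_inj _ (@bsum_inv2 R)) => a b; lia.
Qed.

Lemma bsum_tail2 (n : nat) : (0 < n)%N ->
  bsum (fun j => if (n <= `|j|)%N then inv2 R j else 0) (4 / n%:R).
Proof.
move=> n0; have np : 0 < n%:R :> R by rewrite ltr0n.
set f := fun j : int => _; have f0 j : 0 <= f j by rewrite /f; case: ifP => // _; exact: inv2_ge0.
apply: bsum_box => //.
have h k : \sum_(j <- box (n + k)) f j <= 4 / n%:R - 2 / (n + k)%:R.
  elim: k => [|k IH].
    rewrite addn0; have -> : \sum_(j <- box n) f j = 2 * inv2 R n%:Z.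
      case: n n0 @f f0 {np} => // n _ f f0; rewrite sum_boxS big_seq big1 ?add0r; last first.
        by move=> j; rewrite mem_box /f => hj; rewrite ifF //; lia.
      have -> : f (- n.+1%:Z) = f n.+1%:Z by rewrite /f inv2N abszN.
      by rewrite /f ifT //; ring.
    have -> : inv2 R n%:Z = (n%:R ^+ 2)^-1 by rewrite /inv2 ifF //; lia.
    have : (n%:R ^+ 2)^-1 <= n%:R^-1 :> R.
      by rewrite lef_pV2 ?posrE ?exprn_gt0 // expr2; apply: ler_peMl; [exact: ltW|rewrite ler1n].
    lra.
  rewrite addnS sum_boxS; have -> : f (- (n + k).+1%:Z) = f (n + k).+1%:Z by rewrite /f inv2N abszN.
  have -> : f (n + k).+1%:Z = ((n + k).+1%:R ^+ 2)^-1 by rewrite /f ifT; lia || by rewrite /inv2.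
  move: IH; set S := bigop _ _ _; set a : R := (n + k)%:R => IH.
  have p1 : 0 < a by rewrite ltr0n; lia.
  have -> : (n + k).+1%:R = a + 1 :> R by rewrite -natr1.
  have : ((a + 1) ^+ 2)^-1 <= a^-1 - (a + 1)^-1.
    have -> : a^-1 - (a + 1)^-1 = (a * (a + 1))^-1 by field; rewrite !gt_eqF //; lra.
    have a2 : a * (a + 1) <= (a + 1) ^+ 2 by nra.
    have a3 : 0 < a * (a + 1) by nra.
    by rewrite lef_pV2 // posrE //; exact: lt_le_trans a3 a2.
  move: IH; set X := (_ ^+ 2)^-1; set ia := a^-1; set ib := (a + 1)^-1 => IH hX; lra.
move=> N; apply: le_trans (_ : _ <= \sum_(j <- box (n + N)) f j) _.
  rewrite (sum_cond_disjoint f (box_uniq N) (box_uniq _) (box_sub (leq_addl n N))).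
  by rewrite lerDl sumr_ge0.
by apply: le_trans (h N) _; rewrite lerBlDr lerDl divr_ge0.
Qed.

Lemma bsum_ind (N : nat) : bsum (fun j => if (`|j| <= N)%N then 1 else 0 : R) (N + N).+1%:R.
Proof.
move=> s us; rewrite -big_mkcond /= big_const_seq iter_addr_0 ler_nat -size_filter.
have -> : (N + N).+1 = size (box N) by rewrite size_map size_iota.
apply: uniq_leq_size; first by rewrite filter_uniq.
by move=> j; rewrite mem_filter mem_box => /andP[].
Qed.

Lemma amgm (a b th : R) : 0 < th -> 0 < a -> 0 < b ->
  (a * b)^-1 <= (th * (a ^+ 2)^-1 + th^-1 * (b ^+ 2)^-1) / 2.
Proof.
move=> t0 a0 b0.
have st : 0 < Num.sqrt th by rewrite sqrtr_gt0.
have s2 : Num.sqrt th ^+ 2 = th by rewrite sqr_sqrtr // ltW.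
set c := Num.sqrt th in st s2; rewrite -s2.
have := sqr_ge0 (c / a - (c * b)^-1).
have -> : (c / a - (c * b)^-1) ^+ 2 = c ^+ 2 * (a ^+ 2)^-1 + (c ^+ 2)^-1 * (b ^+ 2)^-1 - 2 * (a * b)^-1.
  by field; rewrite !gt_eqF.
lra.
Qed.

Definition near_ind (N : nat) j : R := if (`|j| <= N)%N then 1 else 0.
Definition tail2 (K : nat) j : R := if (K <= `|j|)%N then inv2 R j else 0.

(** Within distance N of n or -n the weight is at most 1/n. Elsewhere both factors exceed N and one
    of them is at least n, so the weighted inequality of means splits the weight into a tail beyond
    N and a tail beyond n. *)
Lemma vw_split (n N : nat) (th : R) m : (0 < N)%N -> (N < n)%N -> 0 < th ->
  m != n%:Z -> m != - n%:Z ->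
  vw n m <= n%:R^-1 * (near_ind N (m - n%:Z) + near_ind N (m + n%:Z))
    + (th / 2 * (tail2 N (m - n%:Z) + tail2 N (m + n%:Z)) +
       th^-1 / 2 * (tail2 n (m - n%:Z) + tail2 n (m + n%:Z))).
Proof.
move=> N0 Nn t0 m1 m2; have n0 : (0 < n)%N by exact: leq_ltn_trans Nn.
pose I := near_ind N; pose T := tail2; rewrite -/I -/(T N) -/(T n).
have np : 0 < n%:R :> R by rewrite ltr0n.
have I0 j : 0 <= I j by rewrite /I /near_ind; case: ifP.
have T0 K j : 0 <= T K j by rewrite /T /tail2; case: ifP => // _; exact: inv2_ge0.
have ni : 0 <= n%:R^-1 :> R by rewrite invr_ge0 ltW.
have h1 := x_ge1 n0 m1 m2; have h2 := y_ge1 n0 m1 m2.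
have rest : 0 <= th / 2 * (T N (m - n%:Z) + T N (m + n%:Z)) + th^-1 / 2 * (T n (m - n%:Z) + T n (m + n%:Z)).
  by rewrite addr_ge0 // mulr_ge0 ?addr_ge0 // divr_ge0 ?invr_ge0 ?ltW.
have [near|far] := boolP ((`|(m - n%:Z)%R| <= N)%N || (`|(m + n%:Z)%R| <= N)%N).
  have : 1 <= I (m - n%:Z) + I (m + n%:Z).
    have p1 := I0 (m - n%:Z); have p2 := I0 (m + n%:Z); case/orP: near => h.
      have e : I (m - n%:Z) = 1 by rewrite /I /near_ind h.
      by rewrite e; lra.
    have e : I (m + n%:Z) = 1 by rewrite /I /near_ind h.
    by rewrite e; lra.
  move=> hI; have : vw n m <= n%:R^-1.
    by rewrite lef_pV2 ?posrE ?dist_gt0 //; exact: dist_ge.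
  have := ler_wpM2l ni hI; lra.
move: far; rewrite negb_or -!ltnNge => /andP[f1 f2].
have e1 : T N (m - n%:Z) = inv2 R (m - n%:Z) by rewrite /T /tail2 ltnW.
have e2 : T N (m + n%:Z) = inv2 R (m + n%:Z) by rewrite /T /tail2 ltnW.
have Ipos : 0 <= n%:R^-1 * (I (m - n%:Z) + I (m + n%:Z)) by rewrite mulr_ge0 ?addr_ge0.
have x0 : 0 < `|(m - n%:Z)%:~R : R| by lra.
have y0 : 0 < `|(m + n%:Z)%:~R : R| by lra.
have i1 := inv2_ge0 R (m - n%:Z); have i2 := inv2_ge0 R (m + n%:Z).
have tp : 0 <= th^-1 by rewrite invr_ge0 ltW.
have P (a b : R) : 0 <= a -> 0 <= b -> 0 <= a * b by exact: mulr_ge0.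
have [c|c] := leqP n `|(m + n%:Z)%R|.
  have e3 : T n (m + n%:Z) = inv2 R (m + n%:Z) by rewrite /T /tail2 c.
  have := amgm t0 x0 y0; rewrite -(inv2x m1) -(inv2y m2) e1 e2 e3 -/(dist_n n m) -/(vw n m).
  have := P _ _ tp (T0 n (m - n%:Z)); have := P _ _ (ltW t0) i2; lra.
have c' : (n <= `|(m - n%:Z)%R|)%N by clear -c; lia.
have e3 : T n (m - n%:Z) = inv2 R (m - n%:Z) by rewrite /T /tail2 c'.
have am := amgm t0 y0 x0; rewrite (mulrC `|(m + n%:Z)%:~R|) -/(dist_n n m) -/(vw n m) in am.
rewrite -(inv2x m1) -(inv2y m2) in am; rewrite e1 e2 e3.
have := P _ _ tp (T0 n (m + n%:Z)); have := P _ _ (ltW t0) i1; lra.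
Qed.

Definition vw0 (n : nat) m : R := if (m == n%:Z) || (m == - n%:Z) then 0 else vw n m.

Lemma bsum_vw0 (n N : nat) : (0 < N)%N -> (N < n)%N ->
  bsum (vw0 n) ((4 * N%:R + 2) / n%:R + 8 / Num.sqrt (N%:R * n%:R)).
Proof.
move=> N0 Nn; have n0 : (0 < n)%N by exact: leq_ltn_trans Nn.
have np : 0 < n%:R :> R by rewrite ltr0n. have Np : 0 < N%:R :> R by rewrite ltr0n.
pose a : R := Num.sqrt N%:R; pose b : R := Num.sqrt n%:R.
have a0 : 0 < a by rewrite sqrtr_gt0. have b0 : 0 < b by rewrite sqrtr_gt0.
have a2 : a ^+ 2 = N%:R by rewrite sqr_sqrtr // ltW.
have b2 : b ^+ 2 = n%:R by rewrite sqr_sqrtr // ltW.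
(* The parameter sqrt(N/n) balances the two tail contributions, of orders th/N and 1/(th n). *)
have t0 : 0 < a / b by rewrite divr_gt0.
rewrite sqrtrM ?(ltW Np) // -/a -/b.
have I0 j : 0 <= near_ind N j by rewrite /near_ind; case: ifP.
have T0 K j : 0 <= tail2 K j by rewrite /tail2; case: ifP => // _; exact: inv2_ge0.
have sh (f : int -> R) M : bsum f M -> bsum (fun m => f (m - n%:Z)%R + f (m + n%:Z)%R) (M + M).
  by move=> hf; apply: bsumD; apply: (bsum_inj _ hf) => c d; lia.
have bI := sh _ _ (@bsum_ind N).
have bN := sh _ _ (bsum_tail2 N0).
have bn := sh _ _ (bsum_tail2 n0).
have big := bsumD (bsumZ (c := n%:R^-1) _ bI) (bsumD (bsumZ (c := a / b / 2) _ bN) (bsumZ (c := (a / b)^-1 / 2) _ bn)).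
have {}big := big ltac:(by rewrite invr_ge0 ltW) ltac:(by rewrite divr_ge0 // ltW) ltac:(by rewrite divr_ge0 // invr_ge0 ltW).
apply: (bsum_leM _ (bsum_le _ big)); last first.
  move=> m; rewrite /vw0; case: ifP => [_|/negbT].
    rewrite addr_ge0 ?mulr_ge0 ?addr_ge0 ?invr_ge0 ?(ltW np) // ?I0 //.
    - by apply: mulr_ge0; rewrite ?addr_ge0 ?T0 // divr_ge0 // ltW.
    - by apply: mulr_ge0; rewrite ?addr_ge0 ?T0 // divr_ge0 // invr_ge0 ltW.
  by rewrite negb_or => /andP[m1 m2]; exact: vw_split.
rewrite -natr1 natrD -a2 -b2.
rewrite le_eqVlt; apply/orP; left; apply/eqP; field; by rewrite !gt_eqF.
Qed.

(** The true size of the sum is log n / n. A bound with n sg^2 -> 0 is all that the second-order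
    remainder needs, and it is reached without logarithms by fixing N large before n. *)
Lemma vw0_small (e : R) : 0 < e -> exists n0, forall n, (n0 <= n)%N ->
  exists sg, bsum (vw0 n) sg /\ n%:R * sg ^+ 2 <= e.
Proof.
(* The tail part of 2 n sg^2 amounts to 128/N, and this choice makes it at most e/2. *)
move=> e0; pose N := (Num.bound (256 / e)).+1.
have hN : 256 / e < N%:R.
  apply: lt_le_trans (_ : (Num.bound (256 / e))%:R <= _); last by rewrite ler_nat /N.
  by apply/archi_boundP/divr_ge0; [exact: ler0n|exact: ltW].
have Np : 0 < N%:R :> R by rewrite ltr0n.
pose c : R := 4 * N%:R + 2; have c0 : 0 < c by rewrite /c; lra.
pose n0 := (maxn N.+1 (Num.bound (4 * c ^+ 2 / e))).
exists n0 => n; rewrite geq_max => /andP[Nn hn].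
have n1 : (0 < n)%N by exact: leq_ltn_trans Nn.
have np : 0 < n%:R :> R by rewrite ltr0n.
exists (c / n%:R + 8 / Num.sqrt (N%:R * n%:R)); split; first exact: bsum_vw0.
have s0 : 0 < Num.sqrt (N%:R * n%:R) :> R by rewrite sqrtr_gt0 mulr_gt0.
have s2 : Num.sqrt (N%:R * n%:R) ^+ 2 = N%:R * n%:R :> R by rewrite sqr_sqrtr // mulr_ge0.
set S := Num.sqrt _ in s0 s2 *.
have : (c / n%:R + 8 / S) ^+ 2 <= 2 * (c / n%:R) ^+ 2 + 2 * (8 / S) ^+ 2.
  by have := sqr_ge0 (c / n%:R - 8 / S); nra.
move=> h; apply: le_trans (ler_wpM2l (ltW np) h) _.
have -> : n%:R * (2 * (c / n%:R) ^+ 2 + 2 * (8 / S) ^+ 2) = 2 * c ^+ 2 / n%:R + 128 * n%:R / S ^+ 2.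
  by field; rewrite !gt_eqF.
rewrite s2; have -> : 128 * n%:R / (N%:R * n%:R) = 128 / N%:R :> R by field; rewrite !gt_eqF.
have h1 : 128 / N%:R <= e / 2.
  rewrite ler_pdivrMr //; have := ltW hN; rewrite ler_pdivrMr //; lra.
have h2 : 2 * c ^+ 2 / n%:R <= e / 2.
  rewrite ler_pdivrMr //.
  have h3 : 4 * c ^+ 2 / e <= n%:R.
    apply: le_trans (ltW (archi_boundP _)) _; last by rewrite ler_nat.
    by rewrite divr_ge0 ?mulr_ge0 ?sqr_ge0 // ltW.
  by move: h3; rewrite ler_pdivrMr //; lra.
lra.
Qed.

Section Denominators.
Variables (n : nat) (lam : C) (t rho : R).
Hypotheses (n0 : (0 < n)%N) (hrho : rho <= 1 / 10) (tI : 0 <= t <= rho) (hD : inD n t rho lam).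

Lemma denom_near m :
  cabs ((lam - RC (fr t m ^+ 2)) - RC (fr t n%:Z ^+ 2 - fr t m ^+ 2)) < 15 * pi * n%:R * rho.
Proof.
by apply: le_lt_trans hD; rewrite le_eqVlt; apply/orP; left; apply/eqP; congr cabs; rewrite RCB /fr; ring.
Qed.

(** The squares of the frequencies at n and m differ by at least 4 pi (pi - rho) |m^2 - n^2|, while
    lam is within 15 pi n rho of the first one. With n <= |m^2 - n^2| and rho <= 1/10 the first
    bound wins. *)
Lemma denom_ge m : m != n%:Z -> m != - n%:Z -> dist_n n m <= cabs (lam - RC (fr t m ^+ 2)).
Proof.
move=> m1 m2; have h1 := x_ge1 n0 m1 m2; have h2 := y_ge1 n0 m1 m2; have hd := dist_ge n0 m1 m2.
have dn := denom_near m; have p2 := pi_ge2 R.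
have lb := cabs_lb (RC (fr t n%:Z ^+ 2 - fr t m ^+ 2)) (lam - RC (fr t m ^+ 2)).
rewrite [X in _ <= X]cabs_subC cabs_RC in lb.
have /andP[t0 t1] := tI.
have : 4 * pi * (pi - rho) * dist_n n m <= `|fr t n%:Z ^+ 2 - fr t m ^+ 2|.
  have -> : fr t n%:Z ^+ 2 - fr t m ^+ 2 = 4 * pi * (- (m - n%:Z)%:~R * (pi * (m + n%:Z)%:~R + t)).
    by rewrite /fr rmorphB rmorphD /=; ring.
  rewrite !normrM normrN (@ger0_norm _ 4) // (@ger0_norm _ pi) ?pi_ge0 //.
  rewrite -mulrA; apply: ler_wpM2l; first by rewrite mulr_ge0 // pi_ge0.
  rewrite /dist_n mulrCA; apply: ler_wpM2l => //.
  have := lerB_normD (pi * (m + n%:Z)%:~R) t; rewrite normrM (@ger0_norm _ pi) ?pi_ge0 // (ger0_norm t0).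
  have : rho <= rho * `|(m + n%:Z)%:~R| by rewrite ler_peMr //; lra.
  lra.
have d0 := ltW (dist_gt0 n0 m1 m2).
have q1 : n%:R * rho <= dist_n n m * rho by apply: ler_wpM2r => //; lra.
have q2 : dist_n n m * rho <= dist_n n m * (1 / 10) by apply: ler_wpM2l.
have q3 : pi * (dist_n n m * rho) <= pi * (dist_n n m * (1 / 10)) by apply: ler_wpM2l => //; lra.
have q4 : pi * (n%:R * rho) <= pi * (dist_n n m * rho) by apply: ler_wpM2l => //; lra.
have q5 : 2 * dist_n n m <= pi * dist_n n m by apply: ler_wpM2r.
have q6 : 2 * (pi * dist_n n m) <= pi * (pi * dist_n n m) by apply: ler_wpM2r => //; apply: mulr_ge0 => //; lra.
lra.
Qed.

Lemma denom_neq0 m : m != n%:Z -> m != - n%:Z -> lam - RC (fr t m ^+ 2) != 0.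
Proof.
move=> m1 m2; apply/eqP => h; have := denom_ge m1 m2; rewrite h cabs0.
by have := dist_gt0 n0 m1 m2; lra.
Qed.

Lemma wtE m : m != n%:Z -> m != - n%:Z -> wt n lam t m = (lam - RC (fr t m ^+ 2))^-1.
Proof. by move=> /negbTE m1 /negbTE m2; rewrite /wt m1 m2. Qed.

Lemma wt_mul m : m != n%:Z -> m != - n%:Z -> (lam - RC (fr t m ^+ 2)) * wt n lam t m = 1.
Proof. by move=> m1 m2; rewrite wtE // divff // denom_neq0. Qed.

Lemma wt_res : wt n lam t n = 0 /\ wt n lam t (- n%:Z) = 0.
Proof. by rewrite /wt !eqxx orbT. Qed.

Lemma wt_le m : cabs (wt n lam t m) <= vw0 n m.
Proof.
rewrite /wt /vw0; case: ifP => [_|/negbT]; first by rewrite cabs0.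
rewrite negb_or => /andP[m1 m2]; have h := denom_ge m1 m2; have p := dist_gt0 n0 m1 m2.
by rewrite cabsV /vw lef_pV2 ?posrE //; exact: lt_le_trans p h.
Qed.

Lemma vw0_sqr m : vw0 n m ^+ 2 <= (inv2 R (m - n%:Z) + inv2 R (m + n%:Z)) / n%:R ^+ 2.
Proof.
rewrite /vw0; case: ifP => [_|/negbT].
  by rewrite expr0n /= divr_ge0 ?sqr_ge0 // addr_ge0 // inv2_ge0.
by rewrite negb_or => /andP[m1 m2]; exact: vw_sqr.
Qed.

Lemma wt_bsum2 : bsum (fun m => cabs (wt n lam t m) ^+ 2) (8 / n%:R ^+ 2).
Proof.
rewrite mulrC; apply: (@bsum_le _ _ (fun m => (n%:R ^+ 2)^-1 * (inv2 R (m - n%:Z) + inv2 R (m + n%:Z)))).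
  move=> m; rewrite (mulrC _^-1); apply: le_trans (vw0_sqr m).
  by rewrite ler_sqr ?nnegrE ?cabs_ge0 ?wt_le // (le_trans _ (wt_le m)) ?cabs_ge0.
by apply: bsumZ; [rewrite invr_ge0 sqr_ge0|exact: bsum_inv2_pair].
Qed.

(** The denominators at m and -m differ by 8 pi t m. The factor t makes A - A' small relative to 4
    pi n t. *)
Lemma wt_reflect : bsum (fun m => cabs (wt n lam t m - wt n lam t (- m))) (8 * pi * t * (8 / n%:R)).
Proof.
have /andP[t0 t1] := tI; have p2 := pi_ge2 R.
have np : 0 < n%:R :> R by rewrite ltr0n.
have c0 : 0 <= 8 * pi * t by rewrite !mulr_ge0 //; lra.
apply: (@bsum_le _ _ (fun m => 8 * pi * t * (n%:R^-1 * (inv2 R (m - n%:Z) + inv2 R (m + n%:Z))))); last first.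
  rewrite (mulrC 8 _^-1); apply: bsumZ => //; apply: bsumZ; first by rewrite invr_ge0 ltW.
  exact: bsum_inv2_pair.
move=> m; have [mm|] := boolP ((m == n%:Z) || (m == - n%:Z)).
  have -> : wt n lam t m = 0 by rewrite /wt mm.
  have -> : wt n lam t (- m) = 0 by rewrite /wt ifT //; move: mm; lia.
  rewrite subrr cabs0; apply: mulr_ge0 => //; apply: mulr_ge0; first by rewrite invr_ge0 ltW.
  by apply: addr_ge0; exact: inv2_ge0.
rewrite negb_or => /andP[m1 m2].
have m1' : - m != n%:Z by move: m2; lia. have m2' : - m != - n%:Z by move: m1; lia.
have d1 := denom_neq0 m1 m2; have d2 := denom_neq0 m1' m2'.
have -> : wt n lam t m - wt n lam t (- m) = RC (8 * pi * t * m%:~R) * (wt n lam t m * wt n lam t (- m)).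
  rewrite !wtE //.
  have -> : RC (8 * pi * t * m%:~R) = (lam - RC (fr t (- m) ^+ 2)) - (lam - RC (fr t m ^+ 2)).
    rewrite [RHS](_ : _ = RC (fr t m ^+ 2 - fr t (- m) ^+ 2)); last by rewrite RCB; ring.
    by congr RC; rewrite /fr rmorphN /=; ring.
  by field; rewrite d1 d2.
rewrite !cabsM cabs_RC normrM (ger0_norm c0) -[X in X <= _]mulrA; apply: ler_wpM2l => //.
apply: (@le_trans _ _ (`|m%:~R| * vw n m ^+ 2)); last by rewrite (mulrC _^-1); exact: vw_m.
apply: ler_wpM2l => //; rewrite expr2; apply: ler_pM; rewrite ?cabs_ge0 //.
  by apply: le_trans (wt_le m) _; rewrite /vw0 (negbTE m1) (negbTE m2).
apply: le_trans (wt_le (- m)) _; rewrite /vw0 (negbTE m1') (negbTE m2') /=.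
have -> // : vw n (- m) = vw n m.
rewrite /vw /dist_n mulrC; congr (_ * _)^-1.
  by rewrite -opprB rmorphN normrN; congr (`|_|); congr (_%:~R); ring.
by rewrite -opprD rmorphN normrN.
Qed.

End Denominators.

Lemma wt_lip (n : nat) (lam lam' : C) (t rho : R) : (0 < n)%N -> rho <= 1 / 10 -> 0 <= t <= rho ->
  inD n t rho lam -> inD n t rho lam' ->
  bsum (fun m => cabs (wt n lam t m - wt n lam' t m)) (cabs (lam - lam') * (8 / n%:R ^+ 2)).
Proof.
move=> n0 hr tI h h'.
apply: (@bsum_le _ _ (fun m => cabs (lam - lam') * ((n%:R ^+ 2)^-1 * (inv2 R (m - n%:Z) + inv2 R (m + n%:Z))))); last first.
  apply: bsumZ; first exact: cabs_ge0.
  rewrite mulrC; apply: bsumZ; [by rewrite invr_ge0 sqr_ge0|exact: bsum_inv2_pair].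
move=> m; have [mm|] := boolP ((m == n%:Z) || (m == - n%:Z)).
  rewrite /wt mm subrr cabs0; apply: mulr_ge0; first exact: cabs_ge0.
  by apply: mulr_ge0; [rewrite invr_ge0 sqr_ge0|apply: addr_ge0; exact: inv2_ge0].
rewrite negb_or => /andP[m1 m2].
have d1 := denom_neq0 n0 hr tI h m1 m2; have d2 := denom_neq0 n0 hr tI h' m1 m2.
have -> : wt n lam t m - wt n lam' t m = - (lam - lam') * (wt n lam t m * wt n lam' t m).
  rewrite !wtE //; have -> : lam - lam' = (lam - RC (fr t m ^+ 2)) - (lam' - RC (fr t m ^+ 2)) by ring.
  by field; rewrite d1 d2.
rewrite !cabsM cabsN; apply: ler_wpM2l; first exact: cabs_ge0.
rewrite mulrC -[leRHS]mulrC; apply: le_trans (vw0_sqr n0 m); rewrite expr2.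
by apply: ler_pM; rewrite ?cabs_ge0 ?(wt_le n0 hr tI h) ?(wt_le n0 hr tI h').
Qed.

End Weights.

(** * Decay of q_j, and the self-convolution of a primitive of q *)

Section PotentialDecay.
Variable R : realType.
Local Notation C := (R[i]).
Local Notation mu := (@lebesgue_measure R).
Local Notation I01 := (`[0, 1]%classic : set R).
Implicit Types (f q : R -> C) (j m : int).

Lemma z01 : 0 <= (0 : R) <= 1. Proof. by rewrite lexx ler01. Qed.

Section W1p.
Variables (q : R -> C) (p s : nat) (g : nat -> R -> C).
Hypotheses (iq : cintegrable I01 q) (q0 : fourier q 0 = 0) (hW : W1p q p g) (sp : (s <= p)%N)
  (hbc : forall k, (k < s)%N -> g k 0 = g k 1).

Lemma fourier_W1p j k : (k <= s)%N -> fourier (g k) j = complex.Complex 0 (fr 0 j) ^+ k * fourier q j.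
Proof.
have [h1 [h2 h3]] := hW; elim: k => [|k IH] ks.
  rewrite expr0 mul1r !fourierE; apply: tco_ae => //; exact: h2.
rewrite exprS -mulrA -IH; last exact: ltnW.
rewrite !fourierE; apply: tco_qper.
- by apply: h2; exact: leq_trans ks sp.
- by apply: h3; exact: leq_trans ks sp.
- by rewrite cexpi0 mul1r hbc.
Qed.

Lemma q_decay j : cabs (fourier q j) * (1 + `|j%:~R|) ^+ s <= 2 ^+ s * cabs (fourier (g s) j).
Proof.
have [->|j0] := eqVneq j 0; first by rewrite q0 cabs0 mul0r mulr_ge0 ?cabs_ge0 // exprn_ge0.
rewrite fourier_W1p // cabsM cabsX mulrA -exprMn [leLHS]mulrC; apply: ler_wpM2r; first exact: cabs_ge0.
have h1 := fr_ge z01 j0.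
have -> : cabs (complex.Complex 0 (fr 0 j) : C) = `|fr 0 j|.
  by rewrite /cabs /= expr0n /= add0r sqrtr_sqr.
have h2 : 1 <= `|j%:~R : R| by rewrite -intr_norm ler1z; move: j0; lia.
apply: lerXn2r; rewrite ?nnegrE ?addr_ge0 ?mulr_ge0 //; lra.
Qed.

Definition decay_const : R := 2 ^+ s * (2 * n1 (g s)).

Lemma q_weighted j : cabs (fourier q j) * (1 + `|j%:~R|) ^+ s <= decay_const.
Proof.
apply: le_trans (q_decay j) _; apply: ler_wpM2l; first exact: exprn_ge0.
by rewrite fourierE; apply: tco_bound; have [_ [h2 _]] := hW; exact: h2.
Qed.

(** The Riemann-Lebesgue lemma for the s-th derivative, which is only known to be integrable. *)
Lemma q_small (e : R) : 0 < e -> exists N, forall j : int, (N < `|j|)%N ->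
  cabs (fourier q j) * (1 + `|j%:~R|) ^+ s <= e.
Proof.
move=> e0; have [_ [h2 _]] := hW; have p2 : 0 < 2 ^+ s :> R by exact: exprn_gt0.
have [N hN] := riemann_lebesgue (h2 s sp) (divr_gt0 e0 p2).
exists N => j /hN h; apply: le_trans (q_decay j) _.
by rewrite mulrC -ler_pdivlMr.
Qed.
End W1p.

Lemma cint_cst (c : C) : cint I01 (fun=> c) = c.
Proof.
have i1 := bmf_integrable (bmf_cst (1 : C)).
have := fourier_cst1 R 0; rewrite eqxx => h.
have -> : cint I01 (fun=> c) = c * fourier (fun=> 1 : C) 0.
  rewrite fourierE -tcoZ //; apply: cint_eq => x _.
  by rewrite /fr !mulr0 addr0 mul0r oppr0 cexpi0 !mulr1.
by rewrite h mulr1.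
Qed.

Lemma fourier0 f : fourier f 0 = cint I01 f.
Proof. by apply: cint_eq => x _; rewrite mulr0 mul0r oppr0 cexpi0 mulr1. Qed.

Lemma cs_term (a b d : R) : 0 < d -> a * b <= (d^-1 / 2) * a ^+ 2 + (d / 2) * b ^+ 2.
Proof.
move=> d0; have := sqr_ge0 (a - d * b) => h.
have : 0 <= (d^-1 / 2) * (a - d * b) ^+ 2 by rewrite mulr_ge0 // divr_ge0 // invr_ge0 ltW.
have -> : (d^-1 / 2) * (a - d * b) ^+ 2 = (d^-1 / 2) * a ^+ 2 + (d / 2) * b ^+ 2 - a * b.
  by field; rewrite gt_eqF.
lra.
Qed.

Section Primitive.
Variables (q Q : R -> C).
Hypotheses (iq : cintegrable I01 q) (hQ : cprim q Q) (Qper : Q 1 = Q 0).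
Let BQ := cabs (Q 0) + 2 * n1 q.
Let bQ : bmf Q BQ := cprim_bmf iq hQ.

Lemma flip_bij (N : int) : cancel (fun k => N - k) (fun k => N - k).
Proof. by move=> k; rewrite opprB addrC subrK. Qed.

(** The weighted Cauchy-Schwarz bound is kept with a free [d]: if the sup of f is of order [d], then
    so is the whole sum, as [conv_parseval] requires. *)
Lemma conv_bound f B N (d : R) : bmf f B -> 0 < d ->
  exists h M, [/\ dom (fun k => fourier f k * fourier Q (N - k)) h, bsum h M &
   M = (d^-1 / 2) * B ^+ 2 + (d / 2) * BQ ^+ 2].
Proof.
move=> hf d0.
have b1 : bsum (fun k => cabs (fourier f k) ^+ 2) (B ^+ 2).
  by move=> s us; under eq_bigr do rewrite fourierE; exact: bessel hf us.
have b2 : bsum (fun k => cabs (fourier Q k) ^+ 2) (BQ ^+ 2).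
  by move=> s us; under eq_bigr do rewrite fourierE; exact: bessel bQ us.
have b3 := bsum_inj (h := fun k => N - k) (can_inj (flip_bij N)) b2.
exists (fun k => (d^-1 / 2) * cabs (fourier f k) ^+ 2 + (d / 2) * cabs (fourier Q (N - k)) ^+ 2).
eexists; split; [|apply: bsumD; [apply: bsumZ b1|apply: bsumZ b3]|by []].
- by move=> k; rewrite cabsM; exact: cs_term.
- by rewrite divr_ge0 // invr_ge0 ltW.
- by rewrite divr_ge0 // ltW.
Qed.

(** For bounded r the coefficients of P are summable, since |P_k| <= |r_k| / |k| <= (|r_k|^2 +
    k^-2)/2 for k <> 0. So P is the sum of its Fourier series and can be multiplied termwise by
    Q. *)
Lemma smooth_parseval r B P N : bmf r B -> cprim r P -> P 1 = P 0 ->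
  csum (fun k => fourier P k * fourier Q (N - k)) = fourier (fun x => Q x * P x) N.
Proof.
move=> hr hP Pper; have ir := bmf_integrable hr; have bP := cprim_bmf ir hP.
pose u k := tco P (fr 0 k).
have uE k : k != 0 -> cabs (u k) <= (1 / 2) * cabs (tco r (fr 0 k)) ^+ 2 + (1 / 2) * inv2 R k.
  move=> k0; have := tco_qper k ir hP (t := 0); rewrite cexpi0 mul1r => /(_ Pper) e.
  have h1 := fr_ge z01 k0.
  have h2 : 1 <= `|k%:~R : R| by rewrite -intr_norm ler1z; move: k0; lia.
  have e2 : cabs (tco r (fr 0 k)) = `|fr 0 k| * cabs (u k).
    by rewrite e cabsM; congr (_ * _); rewrite /cabs /= expr0n /= add0r sqrtr_sqr.
  have kp : 0 < `|k%:~R : R| by lra.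
  have : cabs (u k) <= cabs (tco r (fr 0 k)) * `|k%:~R|^-1.
    by rewrite ler_pdivlMr // mulrC e2 ler_wpM2r ?cabs_ge0.
  have := cs_term (cabs (tco r (fr 0 k))) `|k%:~R : R|^-1 ltr01.
  have -> : inv2 R k = (`|k%:~R : R|^-1) ^+ 2.
    by rewrite /inv2 (negbTE k0) exprVn real_normK ?num_real.
  by rewrite invr1; lra.
pose fu k := (if k == 0 then cabs (u 0) else 0) + ((1 / 2) * cabs (tco r (fr 0 k)) ^+ 2 + (1 / 2) * inv2 R k).
have hd : dom u fu.
  move=> k; rewrite /fu; case: eqP => [->|/eqP k0]; last by rewrite add0r; exact: uE.
  by rewrite lerDl addr_ge0 // mulr_ge0 ?sqr_ge0 ?inv2_ge0.
have hM : bsum fu (cabs (u 0) + ((1 / 2) * B ^+ 2 + (1 / 2) * 4)).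
  apply: bsumD; first by apply: bsum_pt; exact: cabs_ge0.
  apply: bsumD; apply: bsumZ => //; last exact: bsum_inv2.
  by move=> s us; exact: bessel hr us.
have iQ := bmf_integrable bQ.
have -> : csum (fun k => fourier P k * fourier Q (N - k)) = csum (fun k => fourier Q (N - k) * u k).
  by apply: csum_eq => k; rewrite mulrC /u -fourierE.
rewrite -(tco_mul_fser 0 hd hM N iQ) fourierE; apply: tco_ae.
- exact: cintegrableM iQ (fser_bmf 0 hd hM).
- exact: cintegrableM iQ bP.
- by apply: ae_open01 => x xI; rewrite -(inversion_fser hr hP xI hd hM).
Qed.

(** The argument of [smooth_parseval] fails for Q itself, whose derivative is only integrable. Q is
    therefore replaced in one factor by the primitive P of a bounded approximation of q, with a
    uniformly small error D. *)
Lemma conv_parseval N :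
  csum (fun k => fourier Q k * fourier Q (N - k)) = fourier (fun x => Q x * Q x) N.
Proof.
have BQ0 := bmf_ge0 bQ; have iQ := bmf_integrable bQ.
apply/eqP; rewrite -subr_eq0; apply/eqP; apply: cabs_small => e e0.
(* With |D| <= 6 d, the convolution of D with Q contributes 3 d (1 + BQ^2) and the coefficient of Q
   D contributes 24 BQ d. *)
pose d := e / (3 * (1 + BQ ^+ 2) + 24 * BQ + 1).
have K0 : 0 < 3 * (1 + BQ ^+ 2) + 24 * BQ + 1 by have := sqr_ge0 BQ; lra.
have d0 : 0 < d by exact: divr_gt0.
have [r [Br [br hr]]] := n1_trunc iq d0.
have ir := bmf_integrable br.
have iqr := cintegrableB (@mI01 R) iq ir.
pose c0 := cint I01 r.
have q1 : cint I01 q = 0.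
  have := hQ (x := 1); rewrite Qper ler01 lexx => /(_ isT) /eqP.
  by rewrite addrC -subr_eq subrr => /eqP.
have c0d : cabs c0 <= 2 * d.
  have := tco_bound 0 iqr; rewrite (_ : tco _ 0 = - c0).
    by rewrite cabsN => h; apply: le_trans h _; lra.
  rewrite -[LHS](_ : cint I01 (fun x => q x - r x) = _).
    by rewrite cintB // ?q1 ?sub0r //; exact: mI01.
  by apply: cint_eq => x _; rewrite mul0r oppr0 cexpi0 mulr1.
have ic := bmf_integrable (bmf_cst c0).
(* Removing the mean makes P periodic; the mean is at most 2 d because q has mean 0. *)
pose r' x := r x - c0; have br' : bmf r' (Br + cabs c0) := bmfB br (bmf_cst c0).
have ir' := bmf_integrable br'.
have z0 (f : R -> C) : cprm f 0 = 0 by apply: cplx_eq; rewrite /cprm set_itv1 /= Rintegral_set1.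
pose P x := Q 0 + cprm r' x.
have hP : cprim r' P by move=> x _; rewrite /P z0 addr0.
have Pper : P 1 = P 0.
  by rewrite /P z0 /cprm cintB ?cint_cst ?subrr //; exact: mI01.
pose D x := Q x - P x.
have bP := cprim_bmf ir' hP.
have DE x : 0 <= x <= 1 -> cabs (D x) <= 6 * d.
  move=> xI; have /andP[x0 x1] := xI.
  have mI : measurable (`[0, x]%classic : set (measurableTypeR R)) by exact: measurable_itv.
  have -> : D x = cprm (fun y => q y - r y) x + cprm (fun=> c0) x.
    rewrite /D (cprimE hQ xI) /P /cprm (cintB mI (cintegrableS x1 iq) (cintegrableS x1 ir)).
    rewrite (cintB mI (cintegrableS x1 ir) (cintegrableS x1 ic)); ring.
  apply: le_trans (cabsD _ _) _.
  have h1 := (cprm_bmf iqr).2 x xI.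
  have hc : cprim (fun=> c0) (cprm (fun=> c0)) by move=> y _; rewrite z0 add0r.
  have := cprim_lip (bmf_cst c0) hc z01 xI; rewrite z0 !subr0 ger0_norm // => h2.
  have : 2 * cabs c0 * x <= 2 * cabs c0 by rewrite ler_piMr // mulr_ge0 ?cabs_ge0.
  lra.
have bD : bmf D (6 * d) by split=> //; exact: (bmfB bQ bP).1.
have [hd [M [dD bDM EM]]] := conv_bound N bD (d := 6 * d) ltac:(lra).
have [hP1 [M1 [dP bPM _]]] := conv_bound N bP ltr01.
have iP := bmf_integrable bP; have iD := bmf_integrable bD.
have split1 : csum (fun k => fourier Q k * fourier Q (N - k)) =
    csum (fun k => fourier D k * fourier Q (N - k)) + csum (fun k => fourier P k * fourier Q (N - k)).
  rewrite -(csumD dD bDM dP bPM); apply: csum_eq => k; rewrite -mulrDl; congr (_ * _).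
  by rewrite !fourierE tcoB // subrK.
have split2 : fourier (fun x => Q x * Q x) N = fourier (fun x => Q x * D x) N + fourier (fun x => Q x * P x) N.
  rewrite !fourierE -tcoD; [|exact: cintegrableM iQ bD|exact: cintegrableM iQ bP].
  by apply: tco_eq => x _; rewrite /D; ring.
rewrite split1 split2 (smooth_parseval N br' hP Pper) opprD addrACA subrr addr0.
apply: le_trans (cabsB _ _) _.
have h1 := csum_le dD bDM.
have h2 : cabs (fourier (fun x => Q x * D x) N) <= 4 * (BQ * (6 * d) * 1).
  exact: cint_bmf_bound (bmfM (bmfM bQ bD) (cexpiN_bmf _)).
have eM : M = 3 * d * (1 + BQ ^+ 2) by rewrite EM; field; rewrite gt_eqF.
have : d * (3 * (1 + BQ ^+ 2) + 24 * BQ + 1) = e by rewrite /d divfK // gt_eqF.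
rewrite eM in h1; lra.
Qed.

(** By [conv_parseval] the sum is a coefficient of the periodic function Q^2. Integration by parts
    trades N for a coefficient of the integrable function 2 q Q. *)
Lemma conv_small (e : R) : 0 < e -> exists N0, forall N : int, (N0 < `|N|)%N ->
  `|N%:~R| * cabs (csum (fun k => fourier Q k * fourier Q (N - k))) <= e.
Proof.
move=> e0; have iqQ : cintegrable I01 (fun x => q x * Q x + q x * Q x).
  by apply: cintegrableD (@mI01 R) _ _; exact: cintegrableM iq bQ.
have [N0 hN0] := riemann_lebesgue iqQ e0; exists N0 => N hN.
have N0' : N != 0 by move: hN; lia.
rewrite conv_parseval; have := hN0 N hN; apply: le_trans; rewrite !fourierE.
have := tco_qper N iqQ (cprimM iq iq hQ hQ) (t := 0); rewrite Qper cexpi0 mul1r => /(_ erefl) ->.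
rewrite cabsM ler_wpM2r ?cabs_ge0 //.
have -> : cabs (complex.Complex 0 (fr 0 N) : C) = `|fr 0 N|.
  by rewrite /cabs /= expr0n /= add0r sqrtr_sqr.
exact: fr_ge z01 N0'.
Qed.
End Primitive.

End PotentialDecay.

(** * The first-order term of B and B' *)

Section FirstOrder.
Variable R : realType.
Local Notation C := (R[i]).
Local Notation I01 := (`[0, 1]%classic : set R).
Implicit Types (l m nu j : int).

(** The index of size y >= n yields e / n^(s+1) and its denominator factor another 1/n. The other
    coefficient yields the extra 1/x that makes the sum over x converge without a logarithm; this
    takes one power of decay, hence the exponent [s.+1]. *)
Lemma pair_term (x y qa qb M e : R) (n s : nat) : (0 < n)%N -> 1 <= x -> 1 <= y -> n%:R <= y ->
  0 <= qa -> 0 <= qb -> qa * (1 + x) ^+ s.+1 <= M -> qb * (1 + y) ^+ s.+1 <= e ->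
  qa * qb * (x * y)^-1 <= e * M / n%:R ^+ s.+2 * (x ^+ 2)^-1.
Proof.
move=> n0 x1 y1 ny a0 b0 ha hb.
have np : 0 < n%:R :> R by rewrite ltr0n. have x0 : 0 < x by lra. have y0 : 0 < y by lra.
have h1 : qa <= M / x.
  rewrite ler_pdivlMr //; apply: le_trans ha; apply: ler_wpM2l => //.
  apply: (@le_trans _ _ (1 + x)); first lra.
  by rewrite exprS ler_peMr ?exprn_ege1 //; lra.
have h2 : qb <= e / n%:R ^+ s.+1.
  rewrite ler_pdivlMr ?exprn_gt0 //; apply: le_trans hb; apply: ler_wpM2l => //.
  by apply: lerXn2r; rewrite ?nnegrE ?ltW //; lra.
have h3 : (x * y)^-1 <= (x * n%:R)^-1.
  by rewrite lef_pV2 ?posrE ?mulr_gt0 // ler_wpM2l // ltW.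
apply: (@le_trans _ _ (M / x * (e / n%:R ^+ s.+1) * (x * n%:R)^-1)).
  by apply: ler_pM; rewrite ?mulr_ge0 ?invr_ge0 ?mulr_ge0 ?(ltW x0) ?(ltW y0) //; exact: ler_pM.
rewrite le_eqVlt; apply/orP; left; apply/eqP.
by rewrite [n%:R ^+ s.+2]exprS; field; rewrite !gt_eqF ?exprn_gt0.
Qed.

Section Pairing.
Variables (q : int -> C) (M e : R) (s n : nat) (m nu : int).
Hypotheses (n0 : (0 < n)%N) (hm : (m = n%:Z /\ nu = - n%:Z) \/ (m = - n%:Z /\ nu = n%:Z))
  (hq : forall j, cabs (q j) * (1 + `|j%:~R|) ^+ s <= M)
  (he : forall j, (n <= `|j|)%N -> cabs (q j) * (1 + `|j%:~R|) ^+ s <= e).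

Lemma pair_idx l : exists ja jb : int,
  [/\ `|ja%:~R : R| = `|(l - n%:Z)%:~R|, `|jb%:~R : R| = `|(l + n%:Z)%:~R|,
     cabs (q (m - l)) * cabs (q (l - nu)) = cabs (q ja) * cabs (q jb) &
     (n%:R <= `|(l - n%:Z)%:~R : R| -> (n <= `|ja|)%N) /\ (n%:R <= `|(l + n%:Z)%:~R : R| -> (n <= `|jb|)%N)].
Proof.
have nm (j k : int) : j = - k -> `|j%:~R : R| = `|k%:~R| by move=> ->; rewrite rmorphN normrN.
have cv1 (j k : int) : j = k \/ j = - k -> n%:R <= `|k%:~R : R| -> (n <= `|j|)%N.
  move=> h; rewrite -intr_norm -[n%:R]/((n%:Z)%:~R) ler_int; lia.
case: hm => -[-> ->].
- exists (n%:Z - l), (l - - n%:Z); split=> //.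
  + by apply: nm; ring.
  + by rewrite opprK.
  + by split; apply: cv1; [right|left]; ring.
- exists (l - n%:Z), (- n%:Z - l); split=> //.
  + by apply: nm; ring.
  + by rewrite mulrC.
  + by split; apply: cv1; [left|right]; ring.
Qed.
End Pairing.

Lemma pair_bound_pos (q : int -> C) (M e : R) (s n : nat) m nu l : (0 < n)%N ->
  (m = n%:Z /\ nu = - n%:Z) \/ (m = - n%:Z /\ nu = n%:Z) ->
  (forall j, cabs (q j) * (1 + `|j%:~R|) ^+ s.+1 <= M) ->
  (forall j, (n <= `|j|)%N -> cabs (q j) * (1 + `|j%:~R|) ^+ s.+1 <= e) ->
  l != n%:Z -> l != - n%:Z -> 0 <= e ->
  cabs (q (m - l)) * cabs (q (l - nu)) * vw R n l <=
  e * M / n%:R ^+ s.+2 * (inv2 R (l - n%:Z) + inv2 R (l + n%:Z)).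
Proof.
move=> n0 hm hq he l1 l2 e0; have [ja [jb [ea eb -> [ha hb]]]] := pair_idx q n0 hm l.
have M0 : 0 <= M by apply: le_trans (hq 0); rewrite mulr_ge0 ?cabs_ge0 // exprn_ge0.
have x1 := x_ge1 R n0 l1 l2; have y1 := y_ge1 R n0 l1 l2.
have k0 : 0 <= e * M / n%:R ^+ s.+2 by apply: divr_ge0; [exact: mulr_ge0|exact: exprn_ge0].
have i1 := mulr_ge0 k0 (inv2_ge0 R (l - n%:Z)); have i2 := mulr_ge0 k0 (inv2_ge0 R (l + n%:Z)).
rewrite mulrDr /vw /dist_n; case: (max_cases R n0 l1 l2) => -[c _].
- have := he ja (ha c); have := hq jb; rewrite ea eb => h1 h2.
  have := pair_term n0 y1 x1 c (cabs_ge0 _) (cabs_ge0 _) h1 h2.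
  rewrite -(inv2y R l2) (mulrC (cabs (q jb))) (mulrC `|(l + n)%:~R|); lra.
- have := he jb (hb c); have := hq ja; rewrite ea eb => h1 h2.
  have := pair_term n0 x1 y1 c (cabs_ge0 _) (cabs_ge0 _) h1 h2.
  rewrite -(inv2x R l1); lra.
Qed.

Lemma pair_bound_0 (q : int -> C) (M e : R) (n : nat) m nu l : (0 < n)%N ->
  (m = n%:Z /\ nu = - n%:Z) \/ (m = - n%:Z /\ nu = n%:Z) ->
  (forall j, cabs (q j) <= M) ->
  (forall j, (n <= `|j|)%N -> cabs (q j) <= e) ->
  l != n%:Z -> l != - n%:Z -> 0 <= e ->
  cabs (q (m - l)) * cabs (q (l - nu)) <= e * M.
Proof.
move=> n0 hm hq he l1 l2 e0; have [ja [jb [ea eb -> [ha hb]]]] := pair_idx q n0 hm l.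
case: (max_cases R n0 l1 l2) => -[c _].
- by apply: ler_pM; rewrite ?cabs_ge0 ?hq // he // ha.
- by rewrite mulrC; apply: ler_pM; rewrite ?cabs_ge0 ?hq // he // hb.
Qed.

Definition fo (q w : int -> C) m nu : C := csum (fun l => q (m - l) * w l * q (l - nu)).

Lemma wt0 n (lam : C) (t : R) l : (l == n%:Z) || (l == - n%:Z) -> wt n lam t l = 0.
Proof. by rewrite /wt => ->. Qed.

Section FO.
Variables (q : int -> C) (M e t rho : R) (n : nat) (m nu : int) (lam : C).
Hypotheses (n0 : (0 < n)%N) (hm : (m = n%:Z /\ nu = - n%:Z) \/ (m = - n%:Z /\ nu = n%:Z))
  (e0 : 0 <= e) (hrho : rho <= 1 / 10) (tI : 0 <= t <= rho) (hD : inD n t rho lam).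

Lemma fo_pos s : (forall j, cabs (q j) * (1 + `|j%:~R|) ^+ s.+1 <= M) ->
  (forall j, (n <= `|j|)%N -> cabs (q j) * (1 + `|j%:~R|) ^+ s.+1 <= e) ->
  cabs (fo q (wt n lam t) m nu) <= e * M / n%:R ^+ s.+2 * 8.
Proof.
move=> hq he; have M0 : 0 <= M by apply: le_trans (hq 0); rewrite mulr_ge0 ?cabs_ge0 // exprn_ge0.
have k0 : 0 <= e * M / n%:R ^+ s.+2 by apply: divr_ge0; [exact: mulr_ge0|exact: exprn_ge0].
apply: (csum_le (f := fun l => e * M / n%:R ^+ s.+2 * (inv2 R (l - n%:Z) + inv2 R (l + n%:Z)))); last first.
  by apply: bsumZ => //; exact: bsum_inv2_pair.
move=> l; have [ll|] := boolP ((l == n%:Z) || (l == - n%:Z)).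
  by rewrite wt0 // mulr0 mul0r cabs0 mulr_ge0 // addr_ge0 // inv2_ge0.
rewrite negb_or => /andP[l1 l2]; apply: le_trans (pair_bound_pos n0 hm hq he l1 l2 e0).
rewrite !cabsM mulrAC; apply: ler_wpM2l; first by rewrite mulr_ge0 ?cabs_ge0.
by have := wt_le n0 hrho tI hD l; rewrite /vw0 (negbTE l1) (negbTE l2).
Qed.

(* The weights at [t = 0], [lam = (2 pi n)^2], for which the first-order term is a convolution. *)
Definition w00 (l : int) : C :=
  if (l == n%:Z) || (l == - n%:Z) then 0
  else RC ((4 * pi ^+ 2 * (n%:R ^+ 2 - l%:~R ^+ 2))^-1).

Lemma d00_abs l : `|n%:R ^+ 2 - l%:~R ^+ 2| = dist_n R n l.
Proof.
rewrite /dist_n -normrM rmorphB rmorphD /= -normrN; congr (`|_|).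
rewrite -[(n%:Z)%:~R]/(n%:R : R); ring.
Qed.

Lemma w00_den l : l != n%:Z -> l != - n%:Z -> 4 * pi ^+ 2 * (n%:R ^+ 2 - l%:~R ^+ 2) != 0 :> R.
Proof.
move=> l1 l2; rewrite mulf_eq0 negb_or; apply/andP; split.
  by rewrite gt_eqF // mulr_gt0 // exprn_gt0 // pi_gt0.
by rewrite -normr_eq0 d00_abs gt_eqF // dist_gt0.
Qed.


(** The two denominators differ by O(n + |l|), and (n + |l|) times the squared weight is bounded by
    [vw_n] and [vw_m]. The exchange of weights thus costs O(1/n) in total, with no logarithm. *)
Lemma w00_diff l : cabs (wt n lam t l - w00 l) <= n%:R^-1 * (inv2 R (l - n%:Z) + inv2 R (l + n%:Z)).
Proof.
have np : 0 < n%:R :> R by rewrite ltr0n.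
have [ll|] := boolP ((l == n%:Z) || (l == - n%:Z)).
  rewrite wt0 // /w00 ll subrr cabs0; apply: mulr_ge0; first by rewrite invr_ge0 ltW.
  by apply: addr_ge0; exact: inv2_ge0.
rewrite negb_or => /andP[l1 l2]; have p2 := pi_ge2 R; have d0 := dist_gt0 R n0 l1 l2.
have dn := denom_neq0 n0 hrho tI hD l1 l2.
have /andP[t0 t1] := tI.
pose D0 : R := 4 * pi ^+ 2 * (n%:R ^+ 2 - l%:~R ^+ 2).
have D00 : D0 != 0 by exact: w00_den.
set X := lam - RC (fr t l ^+ 2) in dn.
have hX : cabs (X - RC D0) <= 2 * pi * (n%:R + `|l%:~R|).
  have -> : X - RC D0 = (X - RC (fr t n%:Z ^+ 2 - fr t l ^+ 2)) + RC (4 * pi * t * (n%:R - l%:~R)).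
    have -> : D0 = (fr t n%:Z ^+ 2 - fr t l ^+ 2) - 4 * pi * t * (n%:R - l%:~R).
      by rewrite /D0 /fr -[(n%:Z)%:~R]/(n%:R : R); ring.
    by rewrite [RC (_ - _ * _)]RCB; ring.
  apply: le_trans (cabsD _ _) _.
  have h1 := denom_near hD l; rewrite -/X in h1.
  have h2 : 15 * pi * n%:R * rho <= 15 * pi * n%:R * (1 / 10).
    by apply: ler_wpM2l => //; rewrite !mulr_ge0 //; lra.
  have h3 : cabs (RC (4 * pi * t * (n%:R - l%:~R)) : C) <= 4 * pi * (1 / 10) * (n%:R + `|l%:~R|).
    rewrite cabs_RC normrM; apply: ler_pM => //.
      rewrite ger0_norm; first by apply: ler_wpM2l; [rewrite mulr_ge0 // pi_ge0|move: hrho; lra].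
      by rewrite !mulr_ge0 //; lra.
    by apply: le_trans (ler_normB _ _) _; rewrite (ger0_norm (ltW np)).
  have := mulr_ge0 (pi_ge0 R) (ltW np); have := mulr_ge0 (pi_ge0 R) (normr_ge0 (l%:~R : R)); lra.
have -> : wt n lam t l - w00 l = - (X - RC D0) * (X^-1 * RC D0^-1).
  rewrite wtE // /w00 (negbTE l1) (negbTE l2) -/X -/D0 RCV; cbv iota beta delta [orb].
  by field; rewrite dn RC_eq0 D00.
rewrite cabsM cabsN [cabs (X^-1 * _)]cabsM RCV.
have a1 : cabs X^-1 <= vw R n l.
  by have := wt_le n0 hrho tI hD l; rewrite wtE // /vw0 (negbTE l1) (negbTE l2).
have a2 : cabs ((RC D0)^-1 : C) <= vw R n l / 16.
  have c4 : 0 <= 4 * pi ^+ 2 :> R by apply: mulr_ge0 => //; exact: sqr_ge0.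
  rewrite cabsV cabs_RC normrM d00_abs (ger0_norm c4) /vw -invfM.
  have h : dist_n R n l * 16 <= 4 * pi ^+ 2 * dist_n R n l.
    by rewrite mulrC; apply: ler_wpM2r; [exact: ltW|nra].
  have h0 : 0 < dist_n R n l * 16 by rewrite mulr_gt0.
  by rewrite lef_pV2 // posrE //; exact: lt_le_trans h0 h.
have p4 : pi <= 4 :> R by have := pihalf_lt2 R; lra.
have v0 := vw_ge0 R n l.
have a3 : cabs X^-1 * cabs ((RC D0)^-1 : C) <= vw R n l ^+ 2 / 16.
  by rewrite expr2 -mulrA; apply: ler_pM; rewrite ?cabs_ge0.
apply: (@le_trans _ _ ((2 * pi * (n%:R + `|l%:~R|)) * (vw R n l ^+ 2 / 16))).
  apply: ler_pM => //; first exact: cabs_ge0.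
  by apply: mulr_ge0; exact: cabs_ge0.
have b1 := vw_n R n0 l1 l2; have b2 := vw_m R n0 l1 l2.
rewrite [X in _ <= X]mulrC; set I := _ / n%:R in b1 b2 *.
have c1 : pi * (n%:R * vw R n l ^+ 2) <= 4 * I.
  apply: ler_pM => //; first exact: pi_ge0; by rewrite mulr_ge0 ?sqr_ge0 ?ltW.
have c2 : pi * (`|l%:~R| * vw R n l ^+ 2) <= 4 * I.
  apply: ler_pM => //; first exact: pi_ge0; by rewrite mulr_ge0 ?sqr_ge0.
have I0 : 0 <= I by apply: le_trans b1; rewrite mulr_ge0 ?sqr_ge0 ?ltW.
have -> : 2 * pi * (n%:R + `|l%:~R|) * (vw R n l ^+ 2 / 16) =
  (1 / 8) * (pi * (n%:R * vw R n l ^+ 2)) + (1 / 8) * (pi * (`|l%:~R| * vw R n l ^+ 2)) by field.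
lra.
Qed.

Hypotheses (hq : forall j, cabs (q j) <= M) (he : forall j, (n <= `|j|)%N -> cabs (q j) <= e).

Lemma fo_split : bsum (fun l => cabs (wt n lam t l)) 1 ->
  cabs (fo q (wt n lam t) m nu - fo q w00 m nu) <= e * M * (n%:R^-1 * 8).
Proof.
move=> hw; have M0 : 0 <= M by apply: le_trans (hq 0); exact: cabs_ge0.
have np : 0 < n%:R :> R by rewrite ltr0n.
have eM : 0 <= e * M by exact: mulr_ge0.
have d1 : dom (fun l => q (m - l) * wt n lam t l * q (l - nu)) (fun l => M * M * cabs (wt n lam t l)).
  by move=> l; rewrite !cabsM mulrAC; apply: ler_wpM2r; rewrite ?cabs_ge0 // ler_pM ?cabs_ge0.
have b1 := bsumZ (mulr_ge0 M0 M0) hw.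
have d3 : dom (fun l => q (m - l) * (wt n lam t l - w00 l) * q (l - nu))
   (fun l => e * M * (n%:R^-1 * (inv2 R (l - n%:Z) + inv2 R (l + n%:Z)))).
  move=> l; have [ll|] := boolP ((l == n%:Z) || (l == - n%:Z)).
    rewrite wt0 // /w00 ll subrr mulr0 mul0r cabs0; apply: mulr_ge0 => //; apply: mulr_ge0.
      by rewrite invr_ge0 ltW.
    by apply: addr_ge0; exact: inv2_ge0.
  rewrite negb_or => /andP[l1 l2]; rewrite !cabsM mulrAC.
  apply: ler_pM; rewrite ?mulr_ge0 ?cabs_ge0 ?w00_diff //.
  exact: (pair_bound_0 n0 hm hq he l1 l2 e0).
have b3 : bsum (fun l => e * M * (n%:R^-1 * (inv2 R (l - n%:Z) + inv2 R (l + n%:Z)))) (e * M * (n%:R^-1 * 8)).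
  by apply: bsumZ => //; apply: bsumZ; [rewrite invr_ge0 ltW|exact: bsum_inv2_pair].
have -> : fo q (wt n lam t) m nu - fo q w00 m nu =
    csum (fun l => q (m - l) * (wt n lam t l - w00 l) * q (l - nu)).
  have e1 : fo q w00 m nu = fo q (wt n lam t) m nu -
      csum (fun l => q (m - l) * (wt n lam t l - w00 l) * q (l - nu)).
    by rewrite /fo -(csumB d1 b1 d3 b3); apply: csum_eq => l; ring.
  by rewrite e1; ring.
exact: csum_le d3 b3.
Qed.
End FO.

(* [4 pi^2 (n^2 - l^2)] cancels against the derivatives, since [q_j = 2 pi i j Q_j]. *)
Lemma fo_main (q Q : R -> C) n m nu : (0 < n)%N ->
  (m = n%:Z /\ nu = - n%:Z) \/ (m = - n%:Z /\ nu = n%:Z) ->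
  cintegrable I01 q -> cprim q Q -> Q 1 = Q 0 -> fourier Q 0 = 0 ->
  fo (fourier q) (w00 n) m nu = - csum (fun k => fourier Q k * fourier Q (m - nu - k)).
Proof.
move=> n0 hm iq hQ Qper Q0.
have [h [M [dh bh _]]] := conv_bound iq hQ (m - nu) (cprim_bmf iq hQ) ltr01.
rewrite -(csum_bij (flip_bij m) (flip_bij m) dh bh) -mulN1r.
have dh' : dom (fun j => fourier Q (m - j) * fourier Q (m - nu - (m - j))) (fun j => h (m - j)).
  by move=> j; exact: dh.
rewrite -(csumZ (-1) dh' (bsum_inj (can_inj (flip_bij m)) bh)).
apply: csum_eq => l; rewrite mulN1r.
have -> : m - nu - (m - l) = l - nu by ring.
have qE j : fourier q j = complex.Complex 0 (2 * pi * j%:~R) * fourier Q j.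
  rewrite !fourierE (@tco_qper _ q Q 0 j iq hQ); first by rewrite /fr addr0.
  by rewrite cexpi0 mul1r.
(* At l = n and l = -n the left side has weight 0, and on the right one factor is the mean of Q,
   which is 0. *)
have [ll|] := boolP ((l == n%:Z) || (l == - n%:Z)).
  rewrite /w00 ll mulr0 mul0r.
  have : (m - l = 0) \/ (l - nu = 0).
    by case: hm => -[-> ->]; case/orP: ll => /eqP ->; rewrite ?subrr ?opprK ?addNr ?subrr; [left|right|right|left].
  by case=> ->; rewrite Q0 ?mul0r ?mulr0 oppr0.
rewrite negb_or => /andP[l1 l2]; rewrite /w00 (negbTE l1) (negbTE l2) /=.
set D0 : R := 4 * pi ^+ 2 * (n%:R ^+ 2 - l%:~R ^+ 2).
have D00 : D0 != 0 by exact: w00_den.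
rewrite !qE RCV.
have -> : complex.Complex 0 (2 * pi * (m - l)%:~R) * fourier Q (m - l) * (RC D0)^-1 *
   (complex.Complex 0 (2 * pi * (l - nu)%:~R) * fourier Q (l - nu)) =
   (complex.Complex 0 (2 * pi * (m - l)%:~R) * complex.Complex 0 (2 * pi * (l - nu)%:~R)) * (RC D0)^-1 *
   (fourier Q (m - l) * fourier Q (l - nu)) by ring.
have -> : complex.Complex 0 (2 * pi * (m - l)%:~R) * complex.Complex 0 (2 * pi * (l - nu)%:~R) = - RC D0.
  apply: cplx_eq => /=; last by ring.
  rewrite /D0; case: hm => -[-> ->]; rewrite !rmorphB ?rmorphN /= -[(n%:Z)%:~R]/(n%:R : R); ring.
by rewrite mulNr divff ?RC_eq0 // mulN1r.
Qed.

End FirstOrder.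

(** * B and B' are o(n^(-s-1)) *)

Section Offdiagonal.
Variable R : realType.
Local Notation C := (R[i]).
Local Notation I01 := (`[0, 1]%classic : set R).
Variables (q : R -> C) (p s : nat) (g : nat -> R -> C).
Hypotheses (iq : cintegrable I01 q) (q0 : fourier q 0 = 0) (hW : W1p q p g) (sp : (s <= p)%N)
  (hbc : forall k, (k < s)%N -> g k 0 = g k 1).

Lemma pair_diff (n : nat) (m nu : int) :
  (m = n%:Z /\ nu = - n%:Z) \/ (m = - n%:Z /\ nu = n%:Z) ->
  `|m - nu|%N = (n + n)%N /\ `|(m - nu)%:~R : R| = 2 * n%:R.
Proof.
move=> hm; have a : `|m - nu|%N = (n + n)%N by case: hm => -[-> ->]; lia.
by split => //; rewrite -intr_norm -abszE a -[_%:~R]/((n + n)%:R) natrD mulr_natl mulr2n.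
Qed.

Lemma fo_small (e : R) : 0 < e -> exists N, forall n, (N <= n)%N ->
  forall (t rho : R) (lam : C) (m nu : int),
  (m = n%:Z /\ nu = - n%:Z) \/ (m = - n%:Z /\ nu = n%:Z) ->
  rho <= 1 / 10 -> 0 <= t <= rho -> inD n t rho lam ->
  cabs (fo (fourier q) (wt n lam t) m nu) <= e / n%:R ^+ s.+1.
Proof.
move=> e0; have hM := q_weighted iq q0 hW sp hbc.
pose M := decay_const s g + 1.
have Mp : 0 < M by have := hM 0; rewrite q0 cabs0 mul0r /M; lra.
have {}hM j : cabs (fourier q j) * (1 + `|j%:~R|) ^+ s <= M by apply: le_trans (hM j) _; rewrite lerDl.
have bj j : (1 : R) <= (1 + `|j%:~R|) ^+ s by rewrite exprn_ege1 // lerDl.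
(* The first-order bounds carry the factor 8 M, so 32 M in the denominator leaves e/4. *)
have [N1 h1] := q_small iq q0 hW sp hbc (divr_gt0 e0 (mulr_gt0 (ltr0n R 32) Mp)).
have e32 : 0 <= e / (32 * M) by rewrite divr_ge0 ?ltW // mulr_gt0.
(* For [s = 0] only q_j -> 0 is known, and taking absolute values would lose log n; the first-order
   term is computed through the primitive Q instead. *)
have [sz|sz] := posnP s.
  have hM0 j : cabs (fourier q j) <= M by have := hM j; rewrite sz expr0 mulr1.
  have z01' : (0 : R) <= 0 <= 1 := z01 R.
  have iQ : (0 : R) = 0 -> cint I01 q = 0 by rewrite -fourier0.
  (* At t = 0 the mean of the primitive is free; the value 0 is what [fo_main] requires. *)
  have [Q [hQ [Qper Q0]]] := @qper_prim _ q 0 0 iq z01' iQ.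
  have {}Qper : Q 1 = Q 0 by rewrite Qper cexpi0 mul1r.
  have {}Q0 : fourier Q 0 = 0 by rewrite fourier0 Q0.
  have [N2 h2] := conv_small iq hQ Qper e0.
  have [N3 h3] := @vw0_small R 1 ltr01.
  exists (maxn 1 (maxn N1.+1 (maxn N2 N3))) => n; rewrite !geq_max => /and4P[n0 hn1 hn2 hn3].
  move=> t rho lam m nu hm hr ht hD.
  have np : 1 <= n%:R :> R by rewrite ler1n.
  have np0 : 0 < n%:R :> R by rewrite ltr0n.
  have [sg [hsg sg1]] := h3 _ hn3.
  have bw : bsum (fun l => cabs (wt n lam t l)) 1.
    have sgle : sg <= 1 by have := bsum_ge0 hsg; nra.
    apply: (bsum_le (g := vw0 R n)); first by move=> l; exact: (wt_le n0 hr ht hD).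
    exact: bsum_leM sgle hsg.
  have he j : (n <= `|j|)%N -> cabs (fourier q j) <= e / (32 * M).
    by move=> hj; have := h1 j (leq_trans hn1 hj); rewrite sz expr0 mulr1.
  have f1 := fo_split n0 hm e32 hr ht hD hM0 he bw.
  have f2 := fo_main n0 hm iq hQ Qper Q0.
  have [an hmn] := pair_diff hm.
  have f3 := h2 (m - nu) ltac:(rewrite an -addn1; exact: leq_add).
  rewrite sz expr1.
  have f4 : cabs (fo (fourier q) (w00 R n) m nu) <= e / 2 / n%:R.
    rewrite f2 cabsN ler_pdivlMr ?(lt_le_trans ltr01) //.
    by move: f3; rewrite hmn -mulrA ler_pdivlMr // mulrC [_ * n%:R]mulrC.
  have f5 : e / (32 * M) * M * (n%:R^-1 * 8) = e / 4 / n%:R.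
    by field; rewrite !gt_eqF // (lt_le_trans ltr01).
  rewrite f5 in f1.
  have := cabsD (fo (fourier q) (wt n lam t) m nu - fo (fourier q) (w00 R n) m nu) (fo (fourier q) (w00 R n) m nu).
  rewrite subrK => h; apply: le_trans h _; apply: le_trans (lerD f1 f4) _.
  rewrite -subr_ge0 (_ : _ - _ = e / 4 / n%:R) ?divr_ge0 // ?ltW //.
  by field; rewrite gt_eqF.
case: s sz hM h1 bj => [//|s'] _ hM h1 bj.
exists (maxn 1 N1.+1) => n; rewrite geq_max => /andP[n0 hn1] t rho lam m nu hm hr ht hD.
have np : 0 < n%:R :> R by rewrite ltr0n.
have he j : (n <= `|j|)%N -> cabs (fourier q j) * (1 + `|j%:~R|) ^+ s'.+1 <= e / (32 * M).
  by move=> hj; apply: h1; exact: leq_trans hn1 hj.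
apply: le_trans (fo_pos n0 hm e32 hr ht hD hM he) _.
have -> : e / (32 * M) * M / n%:R ^+ s'.+2 * 8 = e / 4 / n%:R ^+ s'.+2.
  by field; rewrite !gt_eqF // exprn_gt0.
by apply: ler_wpM2r; [rewrite invr_ge0 exprn_ge0 // ltW|lra].
Qed.

(** Half of [e] goes to the first-order term. The other half covers the remainder of [psis_expand],
    at most 2 M^3 sg^2, with the weight at m - nu = 2n or -2n supplying the factor n^-s. *)
Lemma offdiag_small (e : R) : 0 < e -> exists N, forall n, (N <= n)%N ->
  forall (t rho : R) (lam : C) (m nu : int),
  (m = n%:Z /\ nu = - n%:Z) \/ (m = - n%:Z /\ nu = n%:Z) ->
  rho <= 1 / 10 -> 0 <= t <= rho -> inD n t rho lam ->
  cabs (psis (fourier q) (wt n lam t) nu m - fourier q (m - nu)) <= e / n%:R ^+ s.+1.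
Proof.
move=> e0; have hM := q_weighted iq q0 hW sp hbc.
pose M := decay_const s g + 1.
have Mp : 1 <= M by have := hM 0; rewrite q0 cabs0 mul0r /M; lra.
have {}hM j : cabs (fourier q j) * (1 + `|j%:~R|) ^+ s <= M by apply: le_trans (hM j) _; rewrite lerDl.
have M0 : 0 < M by exact: lt_le_trans Mp.
have [N1 h1] := fo_small (divr_gt0 e0 (ltr0n R 2)).
(* The first entry bounds n times 2 M^3 sg^2 by e/2, the second ensures M sg <= 1/2. *)
pose k := Num.min (e / (4 * M ^+ 3)) (1 / (4 * M ^+ 2)).
have k0 : 0 < k by rewrite lt_min !divr_gt0 ?mulr_gt0 ?exprn_gt0.
have [N2 h2] := @vw0_small R k k0.
exists (maxn 1 (maxn N1 N2)) => n; rewrite !geq_max => /and3P[n0 hn1 hn2].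
move=> t rho lam m nu hm hr ht hD.
have np : 1 <= n%:R :> R by rewrite ler1n.
have np0 : 0 < n%:R :> R by exact: lt_le_trans np.
have [sg [hsg sg1]] := h2 _ hn2.
have sg0 := bsum_ge0 hsg.
move: sg1; rewrite /k le_min => /andP[k1 k2].
have bw : bsum (fun l => M * cabs (wt n lam t l)) (M * sg).
  apply: bsumZ; first exact: ltW.
  by apply: (bsum_le (g := vw0 R n)) => // l; exact: (wt_le n0 hr ht hD).
have Msg : M * sg <= 1 / 2.
  move: k2; rewrite ler_pdivlMr ?mulr_gt0 ?exprn_gt0 // => k2.
  have : sg ^+ 2 * (4 * M ^+ 2) <= 1.
    by apply: le_trans k2; rewrite -(mulrA n%:R) ler_peMl // mulr_ge0 ?sqr_ge0 // mulr_ge0 // sqr_ge0.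
  have -> : sg ^+ 2 * (4 * M ^+ 2) = (2 * (M * sg)) ^+ 2 by ring.
  by rewrite expr_le1 // ?mulr_ge0 // ?(ltW M0) //; lra.
have := psis_expand nu hM bw Msg m; rewrite -/(fo _ _ m nu).
set X := psis _ _ _ _ - _; set F := fo _ _ _ _ => hx.
have hF : cabs F <= e / 2 / n%:R ^+ s.+1 := h1 _ hn1 _ _ _ _ _ hm hr ht hD.
have ns : n%:R ^+ s <= (1 + `|(m - nu)%:~R|) ^+ s :> R.
  have h3 : n%:R <= 1 + `|(m - nu)%:~R| :> R.
    by have [_ ->] := pair_diff hm; rewrite mulr_natl mulr2n addrA lerDr addr_ge0 // ltW.
  by apply: lerXn2r; rewrite // nnegrE ?(ltW np0) // (le_trans (ltW np0)).
have nsp : 0 < n%:R ^+ s :> R by exact: exprn_gt0.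
have h4 : cabs (X - F) * n%:R ^+ s <= e / 2 / n%:R.
  apply: le_trans (ler_wpM2l (cabs_ge0 _) ns) _; apply: le_trans hx _.
  rewrite ler_pdivlMr //; move: k1; rewrite ler_pdivlMr ?mulr_gt0 ?exprn_gt0 // => k1.
  have -> : M * sg * (M * sg * (2 * M)) * n%:R = n%:R * sg ^+ 2 * (4 * M ^+ 3) / 2 by field.
  lra.
have h5 : cabs (X - F) <= e / 2 / n%:R ^+ s.+1.
  by rewrite exprS invfM mulrA ler_pdivlMr.
have := cabsD (X - F) F; rewrite subrK => h; apply: le_trans h _.
have -> : e / n%:R ^+ s.+1 = e / 2 / n%:R ^+ s.+1 + e / 2 / n%:R ^+ s.+1.
  by field; rewrite gt_eqF // exprn_gt0.
exact: lerD.
Qed.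

End Offdiagonal.

(** * Eigenvalues, root vectors and algebraic multiplicity in the disc *)

Section SpectralMultiplicity.
Variable R : realType.
Local Notation C := (R[i]).
Local Notation I01 := (`[0, 1]%classic : set R).
Implicit Types (y z g : R -> C) (u : int -> C).
Variables (q : R -> C) (n : nat) (t rho M : R) (lam : C).
Hypotheses (iq : cintegrable I01 q) (n0 : (0 < n)%N) (hrho : rho <= 1 / 10) (tI : 0 <= t <= rho)
  (hD : inD n t rho lam) (hq : forall j, cabs (fourier q j) <= M)
  (hsm : bsum (fun l => M * vw0 R n l) (1 / 2)).
Let N := n%:Z.
Let w := wt n lam t.
Let d (m : int) := lam - RC (fr t m ^+ 2).
Let P nu m := psis (fourier q) w nu m.
Let co y (m : int) := tco y (fr t m).

Let M0 : 0 <= M.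
Proof. exact: le_trans (cabs_ge0 _) (hq 0). Qed.

Lemma wt_bsumM : bsum (fun l => M * cabs (w l)) (1 / 2).
Proof. by apply: bsum_le hsm => l; apply: ler_wpM2l => //; exact: (wt_le n0 hrho tI hD). Qed.
Let hw := wt_bsumM.

Let t01 : 0 <= t <= 1.
Proof. by move/andP: tI => [a b]; move: hrho => c; apply/andP; split; lra. Qed.

Let wn : w n = 0. Proof. by have [] := wt_res n lam t. Qed.
Let wn' : w (- n%:Z) = 0. Proof. by have [] := wt_res n lam t. Qed.
Let hd m : m != n%:Z -> m != - n%:Z -> d m * w m = 1.
Proof. by move=> m1 m2; exact: (wt_mul n0 hrho tI hD m1 m2). Qed.

Definition in_kernel u := exists2 Mu, bsum (fun m => cabs (u m)) Mu &
  forall m, d m * u m = csum (fun k => fourier q (m - k) * u k).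

Let domc u : dom u (fun m => cabs (u m)). Proof. by move=> m. Qed.

Lemma Lrel_chain y z : cintegrable I01 z -> Lrel q t y (fun x => lam * y x + z x) ->
  (exists Mu, bsum (fun m => cabs (co y m)) Mu) /\
  forall m, d m * co y m = csum (fun k => fourier q (m - k) * co y k) - co z m.
Proof.
move=> iz hL; split; first exact: (Lrel_summable t01 hL).
move=> m; have := Lrel_coef iq t01 hL m.
have [B /bmf_integrable iy] := Lrel_bmf hL.
rewrite tcoD ?tcoZ //; last by apply: cintegrableZ => //; exact: mI01.
by rewrite /d mulrBl -/(co y m) -/(co z m) => h; rewrite -(addrK (co z m) (lam * co y m)) -h; ring.
Qed.

Lemma Lrel_kernel y : Lrel q t y (fun x => lam * y x) -> in_kernel (co y).
Proof.
move=> hL; have iz : cintegrable I01 (fun=> 0 : C) by apply: cintegrable0; exact: mI01.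
have [|[Mu b] h] := @Lrel_chain y (fun=> 0) iz.
  by rewrite (_ : (fun x => _) = (fun x => lam * y x)) //; apply: funext => x; rewrite addr0.
exists Mu => // m; rewrite h /co (_ : tco _ _ = 0) ?subr0 //.
by rewrite /tco (cint_eq (g := fun=> 0)) ?cint0 // => x _; rewrite mul0r.
Qed.

Lemma kernel_eqs u : in_kernel u ->
  (d N - P N N) * u N = P (- N) N * u (- N) /\
  (d (- N) - P (- N) (- N)) * u (- N) = P N (- N) * u N.
Proof.
move=> [Mu b e]; have h m := kernel_coef hq hw n0 wn wn' hd (domc u) b e m.
split; rewrite mulrBl e h.
  by rewrite [X in X + _ - _]mulrC addrAC subrr add0r mulrC.
by rewrite [X in _ + X - _]mulrC addrK mulrC.
Qed.

Lemma kernel_zero2 u : in_kernel u -> u N = 0 -> u (- N) = 0 -> forall m, u m = 0.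
Proof. by move=> [Mu b e]; exact: (kernel_zero hq hw n0 wn wn' hd (domc u) b e). Qed.

Lemma kernel_lin u v (a b : C) : in_kernel u -> in_kernel v -> in_kernel (fun m => a * u m + b * v m).
Proof.
move=> [Mu bu eu] [Mv bv ev].
exists (cabs a * Mu + cabs b * Mv).
  apply: (bsum_le (g := fun m => cabs a * cabs (u m) + cabs b * cabs (v m))).
    by move=> m; apply: le_trans (cabsD _ _) _; rewrite !cabsM.
  by apply: bsumD; apply: bsumZ => //; exact: cabs_ge0.
have D x m : dom (fun k => fourier q (m - k) * x k) (fun k => M * cabs (x k)).
  by move=> k; rewrite cabsM; apply: ler_wpM2r; rewrite ?cabs_ge0.
have DZ c x m : dom (fun k => c * (fourier q (m - k) * x k)) (fun k => cabs c * (M * cabs (x k))).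
  by move=> k; rewrite cabsM; apply: ler_wpM2l; [exact: cabs_ge0|exact: D].
move=> m; rewrite (csum_eq (G := fun k => a * (fourier q (m - k) * u k) + b * (fourier q (m - k) * v k))).
  rewrite (csumD (DZ a u m) (bsumZ (cabs_ge0 a) (bsumZ M0 bu)) (DZ b v m) (bsumZ (cabs_ge0 b) (bsumZ M0 bv))).
  by rewrite (csumZ a (D u m) (bsumZ M0 bu)) (csumZ b (D v m) (bsumZ M0 bv)) -eu -ev; ring.
by move=> k; ring.
Qed.

(** An eigenfunction has a nonzero resonant coordinate, since otherwise all its coefficients vanish;
    cancelling that coordinate from the two equations gives the determinant. *)
Lemma eigenvalue_det : is_eigenvalue q t lam ->
  (d N - P N N) * (d (- N) - P (- N) (- N)) = P (- N) N * P N (- N).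
Proof.
move=> [y [hL [x [xI yx]]]]; have hk := Lrel_kernel hL; have [e1 e2] := kernel_eqs hk.
have [u0|u0] := eqVneq (co y N) 0; last first.
  by apply: (mulIf u0); rewrite mulrAC e1 mulrAC -mulrA e2; ring.
have [v0|v0] := eqVneq (co y (- N)) 0; last first.
  by apply: (mulIf v0); rewrite -mulrA e2 mulrCA e1; ring.
by case: yx; apply: (Lrel_vanish hL) => // m; exact: (kernel_zero2 hk).
Qed.

Variables (ee : R).
Hypotheses (hBe : P (- N) N != 0) (hee : 32 * M ^+ 2 / n%:R ^+ 2 <= ee)
  (hdet : (d N - P N N) * (d (- N) - P (- N) (- N)) = P (- N) N * P N (- N))
  (hsimple : forall x1 x2 y1 y2 s1 s2 : C,
    (d N - P N N) * x1 = P (- N) N * x2 -> (d (- N) - P (- N) (- N)) * x2 = P N (- N) * x1 ->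
    (d N - P N N) * y1 = P (- N) N * y2 - (x1 + s1) ->
    (d (- N) - P (- N) (- N)) * y2 = P N (- N) * y1 - (x2 + s2) ->
    cabs s1 <= ee * (cabs x1 + cabs x2) -> cabs s2 <= ee * (cabs x1 + cabs x2) ->
    x1 = 0 /\ x2 = 0).

Let solve1 (x y p p' r : C) : x * p + y * p' - r - p * x = p' * y - r.
Proof. by ring. Qed.

Let solve2 (x y p p' r : C) : x * p + y * p' - r - p' * y = p * x - r.
Proof. by ring. Qed.

Let solve3 (a b p : C) : a * b = b * p + (a - p) * b.
Proof. by ring. Qed.

Let solve4 (a b p e : C) : a * (b - p) = e -> b * a = e + a * p.
Proof. by move=> <-; ring. Qed.

(** [chain_step] reduces a chain of length two to the resonant coordinates with corrections of
    relative size O(M^2/n^2), and [hsimple] then forces those of [u1] to vanish. *)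
Lemma no_jordan_chain u1 u2 M2 : in_kernel u1 -> bsum (fun m => cabs (u2 m)) M2 ->
  (forall m, d m * u2 m = csum (fun k => fourier q (m - k) * u2 k) - u1 m) -> forall m, u1 m = 0.
Proof.
move=> hk b2 e2; have [M1 b1 e1] := hk; have [k1 k2] := kernel_eqs hk.
have S2 := wt_bsum2 n0 hrho tI hD.
have [r1 [r2 [/= h1 h2 h3 h4]]] := chain_step hq hw n0 wn wn' hd (domc u1) b1 (domc u2) b2 S2 e1 e2.
have E : 4 * M ^+ 2 * (8 / n%:R ^+ 2) <= ee.
  by apply: le_trans hee; rewrite le_eqVlt; apply/orP; left; apply/eqP; ring.
have A0 : 0 <= cabs (u1 N) + cabs (u1 (- N)) by rewrite addr_ge0 ?cabs_ge0.
have [] := @hsimple (u1 N) (u1 (- N)) (u2 N) (u2 (- N)) r1 r2 k1 k2.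
- by rewrite mulrBl h3; exact: solve1.
- by rewrite mulrBl h4; exact: solve2.
- by apply: le_trans h1 _; apply: ler_wpM2r.
- by apply: le_trans h2 _; apply: ler_wpM2r.
exact: kernel_zero2.
Qed.

(** Going up the chain, each member below the top has zero coefficients by [no_jordan_chain], so the
    next one lies in the kernel. Coefficients are used throughout because root vectors are compared
    on [0,1] only. *)
Lemma rootvec_kernel y : rootvec q t lam y -> exists z g B,
  [/\ forall x, 0 <= x <= 1 -> y x = z x, bmf g B, cprim g z & in_kernel (co z)].
Proof.
move=> [m [u [u0 [hu hy]]]].
have c0 : forall j, co (u 0%N) j = 0.
  by move=> j; rewrite /co /tco (cint_eq (g := fun=> 0)) ?cint0 // => x /I01P xI; rewrite u0 // mul0r.
case: m hu hy => [|m] hu hy.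
  exists (fun=> 0), (fun=> 0), (cabs (0 : C)); split.
  - by move=> x xI; rewrite hy // u0.
  - exact: bmf_cst.
  - by move=> x _; rewrite cint0 addr0.
  - have z j : co (fun=> 0) j = 0.
      by rewrite /co /tco (cint_eq (g := fun=> 0)) ?cint0 // => x _; rewrite mul0r.
    exists 0; first by move=> s _; rewrite big1 // => j _; rewrite z cabs0.
    move=> j; rewrite z mulr0 /csum; apply/esym/clim_eq; apply: ccvg_ext (ccvg_cst 0) => L.
    by rewrite big1 // => k _; rewrite z mulr0.
have iu j : (j <= m)%N -> cintegrable I01 (u j).
  case: j => [_|j jm]; last by have [B /bmf_integrable] := Lrel_bmf (hu j (ltnW jm)).
  apply: (@cintegrable_eq _ _ (fun=> 0)); [exact: mI01| |by apply: cintegrable0; exact: mI01].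
  by move=> x /I01P xI; rewrite u0.
have ch j : (j <= m)%N -> _ := fun jm => Lrel_chain (iu j jm) (hu j jm).
have z j : (j <= m)%N -> forall k, co (u j) k = 0.
  elim: j => [_|j IH jm]; first exact: c0.
  have [[M1 b1] e1] := ch j (ltnW jm); have [[M2 b2] e2] := ch j.+1 jm.
  apply: (no_jordan_chain _ b2 e2); exists M1 => // k.
  by rewrite e1 IH ?subr0 // ltnW.
have [[M1 b1] e1] := ch m (leqnn m).
have [g [B [hg hp]]] := Lrel_deriv (hu m (leqnn _)).
exists (u m.+1), g, B; split => //.
by exists M1 => // k; rewrite e1 z // subr0.
Qed.

Lemma kernel_vanish z g B : bmf g B -> cprim g z -> (forall m, co z m = 0) ->
  forall x, 0 <= x <= 1 -> z x = 0.
Proof.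
move=> hg hz h0; apply: (cprim_vanish hg hz) => x xI.
have b0 : bsum (fun _ : int => 0 : R) 0 by move=> s _; rewrite big1.
rewrite (@inversion_fser _ t g z B (fun=> 0) 0 x hg hz xI _ b0).
  apply: clim_eq; apply: ccvg_ext (ccvg_cst 0) => L.
  by rewrite big1 // => m _; rewrite -/(co z m) h0 mul0r.
by move=> m; rewrite -/(co z m) h0 cabs0.
Qed.

(** Since [P (- N) N] is nonzero, coordinate n determines coordinate -n and hence the whole vector;
    a combination cancelling coordinate n therefore vanishes. *)
Lemma kernel_one_dim z1 g1 B1 z2 g2 B2 : bmf g1 B1 -> cprim g1 z1 -> bmf g2 B2 -> cprim g2 z2 ->
  in_kernel (co z1) -> in_kernel (co z2) -> exists a b : C,
  ~ (a = 0 /\ b = 0) /\ forall x, 0 <= x <= 1 -> a * z1 x + b * z2 x = 0.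
Proof.
move=> hg1 hz1 hg2 hz2 k1 k2.
have second u : in_kernel u -> u N = 0 -> u (- N) = 0.
  move=> hu uN; have [+ _] := kernel_eqs hu; rewrite uN mulr0 => /esym/eqP.
  by rewrite mulf_eq0 (negbTE hBe) => /eqP.
have [u0|u0] := eqVneq (co z1 N) 0.
  exists 1, 0; split; first by case=> /eqP; rewrite oner_eq0.
  move=> x xI; rewrite mul0r addr0 mul1r; apply: (kernel_vanish hg1 hz1) => //.
  by apply: (kernel_zero2 k1) => //; exact: second.
exists (co z2 N), (- co z1 N); split; first by case=> _ /eqP; rewrite oppr_eq0 (negbTE u0).
set a := co z2 N; set b := - co z1 N.
have i1 := bmf_integrable hg1; have i2 := bmf_integrable hg2.
have j1 := cprim_bmf i1 hz1; have j2 := cprim_bmf i2 hz2.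
have cz m : co (fun x => a * z1 x + b * z2 x) m = a * co z1 m + b * co z2 m.
  rewrite /co tcoD ?tcoZ //; try exact: (bmf_integrable j1); try exact: (bmf_integrable j2).
    by apply: cintegrableZ; [exact: mI01|exact: (bmf_integrable j1)].
  by apply: cintegrableZ; [exact: mI01|exact: (bmf_integrable j2)].
apply: (@kernel_vanish _ (fun x => a * g1 x + b * g2 x) _ (bmfD (bmfZ a hg1) (bmfZ b hg2))).
  move=> x /[dup] xI /andP[x0 x1]; have mx : measurable (`[0, x]%classic : set (measurableTypeR R)) by exact: measurable_itv.
  have s1 := cintegrableS x1 i1; have s2 := cintegrableS x1 i2.
  rewrite (hz1 x xI) (hz2 x xI) cintD ?cintZ //; [by ring|exact: cintegrableZ|exact: cintegrableZ].
have kl := kernel_lin a b k1 k2.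
have L0 : a * co z1 N + b * co z2 N = 0 by rewrite /a /b; ring.
by move=> m; rewrite cz; apply: (kernel_zero2 kl L0 (second _ kl L0)).
Qed.

Lemma alg_mult_one : alg_mult q t lam 1.
Proof.
split.
  (* The vector (P (- N) N, d N - P N N) satisfies the first equation identically and the second by
     [hdet]; its first entry is nonzero. *)
  have [u [f [Mu [hu hf uN uN' he]]]] : exists u f Mu, [/\ dom u f, bsum f Mu, u N = P (- N) N,
      u (- N) = d N - P N N & forall m, d m * u m = csum (fun k => fourier q (m - k) * u k)].
    exact: (kernel_exists hq hw n0 wn wn' hd (solve3 _ _ _) (solve4 hdet)).
  have [y [hL hy]] := Lrel_of_coef iq t01 hu hf he.
  exists (fun=> y); split.
    move=> _; exists 1%N, (fun k => if k is 0%N then (fun=> 0) else y); split => //; split => //.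
    case=> // _; rewrite (_ : (fun x => _) = (fun x => lam * y x)) //.
    by apply: funext => x; rewrite addr0.
  move=> c hc i; rewrite (ord1 i); apply/eqP/negPn/negP => ci.
  have y0 x : 0 <= x <= 1 -> y x = 0.
    move=> xI; have := hc x xI; rewrite big_ord1 => /eqP; rewrite mulf_eq0.
    by rewrite (negbTE ci) => /eqP.
  move/eqP: hBe; apply; rewrite -uN -hy /tco (cint_eq (g := fun=> 0)) ?cint0 // => x /I01P xI.
  by rewrite y0 // mul0r.
move=> [ys [hr hi]].
have [z1 [g1 [B1 [e1 hg1 hz1 k1]]]] := rootvec_kernel (hr ord0).
have [z2 [g2 [B2 [e2 hg2 hz2 k2]]]] := rootvec_kernel (hr ord_max).
have [a [b [ab h]]] := kernel_one_dim hg1 hz1 hg2 hz2 k1 k2.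
have hc : forall x, 0 <= x <= 1 -> \sum_(i < 2) (if i == ord0 then a else b) * ys i x = 0.
  move=> x xI; rewrite big_ord_recr big_ord1 /=.
  rewrite (_ : widen_ord _ _ = ord0); last exact: val_inj.
  by rewrite e1 // e2 //; exact: h.
by apply: ab; split; [have := hi _ hc ord0|have := hi _ hc ord_max].
Qed.

End SpectralMultiplicity.

(** * The two eigenvalues for fixed n and t *)

Section EigenvaluePair.
Variable R : realType.
Local Notation C := (R[i]).
Local Notation I01 := (`[0, 1]%classic : set R).
Variables (q : R -> C) (n : nat) (t rho M sg r ep ka eta : R).
Let N := n%:Z.
Let a := fourier q (2 * N).
Let b := fourier q (- (2 * N)).
Hypotheses (iq : cintegrable I01 q) (q0 : fourier q 0 = 0) (n0 : (0 < n)%N) (hrho : rho <= 1 / 10)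
  (tI : 0 <= t <= rho) (hq : forall j, cabs (fourier q j) <= M)
  (hsm : bsum (fun l => M * vw0 R n l) sg) (hsg : sg <= 1 / 2) (hsg1 : sg * (2 * M) <= 1)
  (r0 : 0 < r) (hz : cabs (a * b) = r ^+ 2) (ep01 : 0 < ep <= 1)
  (hsec : 0 <= complex.Re (a * b) \/ ep * cabs (a * b) <= `|complex.Im (a * b)|)
  (ka1 : 1 <= ka) (hka : cabs a <= ka * r) (hkb : cabs b <= ka * r)
  (eta0 : 0 <= eta) (heta : 12 * ka * eta <= ep ^+ 2 / 32)
  (hoff : forall lam m nu, (m = n%:Z /\ nu = - n%:Z) \/ (m = - n%:Z /\ nu = n%:Z) -> inD n t rho lam ->
    cabs (psis (fourier q) (wt n lam t) nu m - fourier q (m - nu)) <= eta * r)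
  (hC0 : 32 * M ^+ 2 / n%:R ^+ 2 <= eta).
Let l := 32 * M ^+ 2 / n%:R ^+ 2.
Hypotheses (hl : 16 * ka * l <= Num.sqrt (ep ^+ 2 / 32) / 2) (hr1 : 2 * r + 1 < 3 * pi * n%:R * rho).

Let tau : R := 4 * pi * n%:R * t.
Let c0 : C := RC ((2 * pi * n%:R + t) ^+ 2).
Let P nu m lam := psis (fourier q) (wt n lam t) nu m.
Let r1 : R := 15 * pi * n%:R * rho.
Let disc (x : C) := cabs (x - c0) < r1.

Let np : 0 < n%:R :> R. Proof. by rewrite ltr0n. Qed.
Let t0 : 0 <= t. Proof. by case/andP: tI. Qed.
Let pi0 : 0 < pi :> R := pi_gt0 R.
Let tau0 : 0 <= tau.
Proof. by rewrite /tau !mulr_ge0 // ltW. Qed.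
Let l0 : 0 <= l.
Proof. by apply: divr_ge0; [apply: mulr_ge0 => //; exact: sqr_ge0|exact: (exprn_ge0 2 (ltW np))]. Qed.

Let wsg lam : disc lam -> bsum (fun m => M * cabs (wt n lam t m)) sg.
Proof.
move=> hD; apply: bsum_le hsm => m; apply: ler_wpM2l; first exact: le_trans (cabs_ge0 _) (hq 0).
exact: (wt_le n0 hrho tI hD).
Qed.

Let wh lam : disc lam -> bsum (fun m => M * cabs (wt n lam t m)) (1 / 2).
Proof. by move=> hD; apply: bsum_leM (wsg hD). Qed.

Lemma diag_le1 nu lam : disc lam -> cabs (P nu nu lam) <= 1.
Proof.
move=> hD; have h0 j : cabs (fourier q j) * (1 + `|j%:~R|) ^+ 0 <= M by rewrite expr0 mulr1.
exact: le_trans (psis_diag nu h0 (wsg hD) hsg q0) hsg1.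
Qed.

Lemma psis_lam_lip nu m x y : disc x -> disc y -> cabs (P nu m x - P nu m y) <= l * cabs (x - y).
Proof.
move=> hx hy; apply: le_trans (psis_lip nu m hq (wh hx) (wh hy) (wt_lip n0 hrho tI hx hy)) _.
rewrite le_eqVlt; apply/orP; left; apply/eqP; rewrite /l; field; by rewrite gt_eqF.
Qed.

(** By [psis_reverse], A is the value of A' for the weights reflected in m. So the difference is
    controlled by the oddness of the weights, which is O(t/n), that is O(tau/n^2). *)
Lemma diag_diff lam : disc lam -> cabs (P N N lam - P (- N) (- N) lam) <= 2 * (eta * tau).
Proof.
move=> hD; rewrite -[P N N lam](psis_reverse N hq (wh hD)) /P.
have hr : bsum (fun m => cabs (wt n lam t (- m) - wt n lam t m)) (8 * pi * t * (8 / n%:R)).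
  by apply: bsum_le (wt_reflect n0 hrho tI hD) => m; rewrite cabs_subC.
have hw' : bsum (fun m => M * cabs (wt n lam t (- m))) (1 / 2).
  exact: (bsum_inj (f := fun m => M * cabs (wt n lam t m)) oppr_inj (wh hD)).
apply: le_trans (psis_lip (- N) (- N) hq hw' (wh hD) hr) _.
have -> : 4 * M ^+ 2 * (8 * pi * t * (8 / n%:R)) = 2 * (l * tau).
  by rewrite /l /tau; field; rewrite gt_eqF.
by apply: ler_wpM2l => //; apply: ler_wpM2r.
Qed.

Lemma off_a lam : disc lam -> cabs (P (- N) N lam - a) <= eta * r.
Proof.
move=> hD; have := hoff (or_introl (conj erefl erefl)) hD.
by rewrite opprK -[n%:Z + n%:Z]/(n%:Z + n%:Z) -mulr2n -mulr_natl.
Qed.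

Lemma off_b lam : disc lam -> cabs (P N (- N) lam - b) <= eta * r.
Proof.
move=> hD; have := hoff (or_intror (conj erefl erefl)) hD.
by rewrite -opprD -mulr2n -mulr_natl.
Qed.

(** Of the radius 15 pi n rho, the part 12 pi n rho covers 3 tau for every t <= rho, and 3 pi n rho
    is left for 2 r + 1. *)
Let hr1' : 3 * tau + 2 * r + 1 < r1.
Proof.
have : 12 * pi * n%:R * t <= 12 * pi * n%:R * rho.
  by apply: ler_wpM2l; [rewrite !mulr_ge0 // ltW|case/andP: tI].
by move: hr1; rewrite /tau /r1; lra.
Qed.

Let FF (s : bool) x := Fx c0 tau (P N N) (P (- N) (- N)) (P (- N) N) (P N (- N)) s x.

Lemma FF_fix s : exists x, disc x /\ FF s x = x.
Proof.
exact: (Fx_fix tau0 r0 hz ep01 hsec ka1 hka hkb eta0 heta l0 (@diag_le1 N)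
  (@diag_le1 (- N)) diag_diff off_a off_b (@psis_lam_lip _ _) (@psis_lam_lip _ _)
  (@psis_lam_lip _ _) (@psis_lam_lip _ _) hl hr1' s).
Qed.

Lemma FF_unique s x y : disc x -> disc y -> FF s x = x -> FF s y = y -> x = y.
Proof.
exact: (Fx_unique tau0 r0 hz ep01 hsec ka1 hka hkb eta0 heta l0
  diag_diff off_a off_b (@psis_lam_lip _ _) (@psis_lam_lip _ _)
  (@psis_lam_lip _ _) (@psis_lam_lip _ _) hl).
Qed.

Lemma denom_minus x : x - RC (fr t (- N) ^+ 2) = x - c0 + RC (2 * tau).
Proof.
rewrite /c0 -addrA -RCN -RCN -RCD; congr (_ + RC _).
by rewrite /fr /tau rmorphN /= -[(N)%:~R]/(n%:R : R); ring.
Qed.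

Lemma FF_det x : disc x ->
  (x - RC (fr t N ^+ 2) - P N N x) * (x - RC (fr t (- N) ^+ 2) - P (- N) (- N) x) =
  P (- N) N x * P N (- N) x <-> exists s, FF s x = x.
Proof.
rewrite denom_minus.
exact: (det_Fx tau0 r0 hz ep01 hsec ka1 hka hkb eta0 heta diag_diff off_a off_b).
Qed.

Lemma FF_alg_mult s x : disc x -> FF s x = x -> alg_mult q t x 1.
Proof.
move=> hx fx; have k0 : 0 < Num.sqrt (ep ^+ 2 / 32) / 2 := k_gt0 ep01.
have hs1 := bsum_leM hsg hsm.
apply: (alg_mult_one iq n0 hrho tI hx hq hs1 _ (lexx l)).
- exact: (Be_neq0 r0 hz ep01 hkb heta off_a hx).
- by apply/(FF_det hx); exists s.
move=> x1 x2 y1 y2 s1 s2; rewrite denom_minus.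
apply: (resonance_simple tau0 r0 hz ep01 hsec ka1 hka hkb eta0 heta diag_diff off_a off_b hx fx l0).
by have : 0 <= ka * l; [rewrite mulr_ge0 // (le_trans ler01)|move: hl k0; lra].
Qed.

Lemma eigenvalue_FF x : disc x -> is_eigenvalue q t x -> exists s, FF s x = x.
Proof.
move=> hx he; apply/(FF_det hx).
exact: (eigenvalue_det iq n0 hrho tI hx hq (bsum_leM hsg hsm) he).
Qed.

Lemma Dfun_Dx x : disc x ->
  Dfun q n x t = Dx tau (P N N) (P (- N) (- N)) (P (- N) N) (P N (- N)) x.
Proof.
move=> hx; have hw := wh hx.
rewrite /Dfun /Dx /Cx /Cser (Aser_psis n0 q0 hq hw) (A'ser_psis n0 q0 hq hw)
  (Bser_psis n0 q0 hq hw) (B'ser_psis n0 q0 hq hw) -/N -/a -/b.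
rewrite -/(P N N x) -/(P (- N) N x) -/(P (- N) (- N) x) -/(P N (- N) x).
have -> : 8 * pi * n%:R * t = 2 * tau by rewrite /tau; ring.
rewrite -/tau RCX RCM -[RC 2]/(RC 2%:R) RCnat.
move: (P N N x) (P (- N) N x) (P (- N) (- N) x) (P N (- N) x) (RC tau) a b => A1 B1 A2 B2 T a' b'.
ring.
Qed.

Lemma FF_formula s x : disc x -> FF s x = x -> exists w : C,
  [/\ w ^+ 2 = Dfun q n x t, 0 < complex.Re w &
  x = c0 + (Aser q n x t + A'ser q n x t) / 2 - RC tau + (-1) ^+ s * w].
Proof.
move=> hx fx; have [h1 h2 _ _] := wxP tau0 r0 hz ep01 hsec ka1 hka hkb eta0 heta diag_diff off_a off_b hx.
exists (csq (Dx tau (P N N) (P (- N) (- N)) (P (- N) N) (P N (- N)) x)); rewrite Dfun_Dx //; split => //.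
rewrite (Aser_psis n0 q0 hq (wh hx)) (A'ser_psis n0 q0 hq (wh hx)) -/N.
by rewrite -[LHS]fx /FF /Fx; congr (_ + _); rewrite addrAC.
Qed.

Lemma FF_distinct x : disc x -> FF true x = x -> FF false x = x -> False.
Proof.
exact: (Fx_distinct tau0 r0 hz ep01 hsec ka1 hka hkb eta0 heta diag_diff off_a off_b).
Qed.

Lemma eigenvalue_pair : exists lam1 lam2 : C,
  lam1 <> lam2 /\ inD n t rho lam1 /\ inD n t rho lam2 /\
  alg_mult q t lam1 1 /\ alg_mult q t lam2 1 /\
  (forall mu, inD n t rho mu -> is_eigenvalue q t mu -> mu = lam1 \/ mu = lam2) /\
  forall (j : nat) (lam : C), (j = 1%N /\ lam = lam1) \/ (j = 2%N /\ lam = lam2) ->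
    exists w : C, w ^+ 2 = Dfun q n lam t /\ 0 < complex.Re w /\
      lam = RC ((2 * pi * n%:R + t) ^+ 2) + (Aser q n lam t + A'ser q n lam t) / 2
            - RC (4 * pi * n%:R * t) + (-1) ^+ j * w.
Proof.
(* The boolean is the exponent of -1, so [true] belongs to j = 1 and [false] to j = 2. *)
have [x1 [d1 f1]] := FF_fix true; have [x2 [d2 f2]] := FF_fix false.
exists x1, x2; split; first by move=> e; apply: (FF_distinct d1 f1); rewrite e.
do 2![split => //]; split; first exact: FF_alg_mult f1.
split; first exact: FF_alg_mult f2.
split.
  move=> x hx /(eigenvalue_FF hx) [[]] fx; [left|right]; exact: FF_unique fx _.
move=> j lam [[-> ->]|[-> ->]].
  by have [w [h1 h2 h3]] := FF_formula d1 f1; exists w; do 2!split => //.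
have [w [h1 h2 h3]] := FF_formula d2 f2; exists w; do 2!split => //.
by rewrite sqrrN expr1n -[1]/((-1) ^+ false).
Qed.

End EigenvaluePair.

(** |a|^2 <= K |a| |b| and K <= (1 + K)^2. Thus q_{2n} and q_{-2n}, being of the same order, are
    both bounded by a multiple of r = sqrt|q_{2n} q_{-2n}|. *)
Lemma geometric_mean_bound (R : realType) (a b : R[i]) (K : R) : 0 <= K -> cabs a <= K * cabs b ->
  cabs a <= (1 + K) * Num.sqrt (cabs (a * b)).
Proof.
move=> K0 h; have a0 := cabs_ge0 a; have b0 := cabs_ge0 b.
have k1 : 0 <= (1 + K) * Num.sqrt (cabs (a * b)) by rewrite mulr_ge0 ?sqrtr_ge0 ?addr_ge0.
rewrite -ler_sqr ?nnegrE // exprMn (sqr_sqrtr (cabs_ge0 (a * b))) cabsM.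
have h1 : cabs a ^+ 2 <= K * (cabs a * cabs b) by rewrite expr2 mulrCA; apply: ler_wpM2l.
apply: le_trans h1 _; apply: ler_wpM2r; first exact: mulr_ge0.
by have := sqr_ge0 K; rewrite sqrrD expr1n mul1r; lra.
Qed.

Lemma nat_above (R : realType) (x : R) : exists N, forall n, (N <= n)%N -> x <= n%:R.
Proof.
exists (Num.bound `|x|) => n hn; apply: le_trans (ler_norm x) _.
by apply: le_trans (ltW (archi_boundP (normr_ge0 x))) _; rewrite ler_nat.
Qed.

Theorem theorem2 (R : realType) :
  exists rho0 : R, 0 < rho0 < pi / 2 /\
  forall rho : R, 0 < rho <= rho0 ->
  forall (q : R -> R[i]) (p s : nat) (g : nat -> R -> R[i]),
    (forall x : R, q (x + 1) = q x) ->
    cintegrable `[0, 1] q ->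
    fourier q 0 = 0 ->
    W1p q p g ->
    (s <= p)%N ->
    (forall k, (k < s)%N -> g k 0 = g k 1) ->
    (exists c eps K : R, 0 < c /\ 0 < eps /\ 0 < K /\
      exists N : nat, forall n : nat, (N <= n)%N ->
        let q2n := fourier q (2 * n%:Z) in
        let qm2n := fourier q (- (2 * n%:Z)) in
        cabs q2n <= K * cabs qm2n /\ cabs qm2n <= K * cabs q2n /\
        cabs q2n > c / (n%:R ^+ s.+1) /\
        (0 <= complex.Re (q2n * qm2n) \/
         `|complex.Im (q2n * qm2n)| >= eps * cabs (q2n * qm2n))) ->
    exists N : nat, forall n : nat, (N <= n)%N ->
    forall t : R, 0 <= t <= rho ->
    exists lam1 lam2 : R[i],
      lam1 <> lam2 /\
      inD n t rho lam1 /\ inD n t rho lam2 /\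
      alg_mult q t lam1 1 /\ alg_mult q t lam2 1 /\
      (forall mu : R[i], inD n t rho mu -> is_eigenvalue q t mu ->
         mu = lam1 \/ mu = lam2) /\
      forall (j : nat) (lam : R[i]), (j = 1%N /\ lam = lam1) \/ (j = 2%N /\ lam = lam2) ->
        exists w : R[i], w ^+ 2 = Dfun q n lam t /\ 0 < complex.Re w /\
          lam = RC ((2 * pi * n%:R + t) ^+ 2)
                + (Aser q n lam t + A'ser q n lam t) / 2
                - RC (4 * pi * n%:R * t) + (-1) ^+ j * w.
Proof.
(* The value 1/10 is the bound on rho under which [denom_ge] separates the disc from the other
   frequencies. *)
have rho0 : 0 < (1 / 10 : R) < pi / 2 by have := pi_ge2 R => h; apply/andP; split; lra.
exists (1 / 10); split => // rho /andP[rp hrho] q p s g _ iq q0 hW sp hbc.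
move=> [c [eps [K [cp [ep0 [Kp [N0 hN0]]]]]]].
(* The minimum provides ep <= 1, and [eta] makes the smallness condition [heta] an equality. *)
pose ep := Num.min eps 1; pose ka := 1 + K; pose eta := ep ^+ 2 / 32 / (12 * ka).
have ep01 : 0 < ep <= 1 by rewrite lt_min ep0 ltr01 ge_min lexx orbT.
have /andP[epp _] := ep01.
have kap : 0 < ka by rewrite addr_gt0.
have ka1 : 1 <= ka by rewrite lerDl ltW.
have etap : 0 < eta by apply: divr_gt0; [apply: divr_gt0 => //; exact: exprn_gt0|exact: mulr_gt0].
have heta : 12 * ka * eta <= ep ^+ 2 / 32.
  by rewrite le_eqVlt /eta; apply/orP; left; apply/eqP; field; rewrite gt_eqF.
pose M := decay_const s g + 1.
have hM := q_weighted iq q0 hW sp hbc.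
have Mp : 1 <= M by have := hM 0; rewrite q0 cabs0 mul0r /M; lra.
have M0 : 0 < M by exact: lt_le_trans Mp.
have hq j : cabs (fourier q j) <= M.
  apply: le_trans (_ : decay_const s g <= _); last by rewrite lerDl.
  apply: le_trans (hM j); apply: ler_peMr; first exact: cabs_ge0.
  by rewrite exprn_ege1 // lerDl.
(* The lower bound on |q_{2n}| gives (c / ka) n^(-s-1) <= r, so this precision turns the
   off-diagonal errors into at most eta r. *)
have [N1 hN1] := offdiag_small iq q0 hW sp hbc (mulr_gt0 etap (divr_gt0 cp kap)).
(* With sg <= si the diagonal bound 2 M^2 sg is at most 1, and M sg <= 1/2 follows from M >= 1. *)
pose si := 1 / (2 * M ^+ 2).
have sip : 0 < si by rewrite divr_gt0 ?mulr_gt0 ?exprn_gt0.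
have [N2 hN2] := @vw0_small R (si ^+ 2) (exprn_gt0 2 sip).
pose k0 := Num.sqrt (ep ^+ 2 / 32) / 2; have k0p : 0 < k0 := k_gt0 ep01.
pose de := Num.min eta (k0 / (16 * ka)).
have dep : 0 < de by rewrite lt_min etap divr_gt0 // mulr_gt0.
have [N3 hN3] := nat_above (32 * M ^+ 2 / de).
(* Since r <= M, such n satisfy 2 r + 1 < 3 pi n rho, the room required in the disc. *)
have [N4 hN4] := nat_above ((2 * M + 2) / (3 * pi * rho)).
exists (maxn 1 (maxn N0 (maxn N1 (maxn N2 (maxn N3 N4))))) => n.
rewrite !geq_max => /and5P[n0 hn0 hn1 hn2 /andP[hn3 hn4]] t tI.
have np : 0 < n%:R :> R by rewrite ltr0n.
have np1 : 1 <= n%:R :> R by rewrite ler1n.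
have [h1 [h2 [h3 h4]]] := hN0 n hn0.
set a := fourier q (2 * n%:Z) in h1 h2 h3 h4; set b := fourier q (- (2 * n%:Z)) in h1 h2 h4.
pose r := Num.sqrt (cabs (a * b)).
have nsp : 0 < n%:R ^+ s.+1 :> R by exact: exprn_gt0.
have hka : cabs a <= ka * r by apply: geometric_mean_bound h1; exact: ltW.
have hkb : cabs b <= ka * r.
  by rewrite /r [a * b]mulrC; apply: geometric_mean_bound h2; exact: ltW.
have ca : c / ka / n%:R ^+ s.+1 <= r.
  have := lt_le_trans h3 hka; rewrite -ltr_pdivrMl // => /ltW.
  by rewrite mulrA [ka^-1 * c]mulrC.
have rp0 : 0 < r by apply: lt_le_trans ca; rewrite !divr_gt0.
have hz : cabs (a * b) = r ^+ 2 by rewrite sqr_sqrtr // cabs_ge0.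
have hsec : 0 <= complex.Re (a * b) \/ ep * cabs (a * b) <= `|complex.Im (a * b)|.
  case: h4 => [h4|h4]; [by left|right; apply: le_trans h4].
  by apply: ler_wpM2r; [exact: cabs_ge0|rewrite ge_min lexx].
have rM : r <= M.
  rewrite -ler_sqr ?nnegrE ?(ltW rp0) ?(ltW M0) // -hz cabsM expr2.
  by apply: ler_pM; rewrite ?cabs_ge0 //; exact: hq.
have [sg [hsg sg2]] := hN2 n hn2.
have sg0 := bsum_ge0 hsg.
have sgle : sg <= si.
  rewrite -ler_sqr ?nnegrE ?(ltW sip) //; apply: le_trans sg2.
  by apply: ler_peMl => //; exact: sqr_ge0.
have hsm := bsumZ (ltW M0) hsg.
have MM : M * (2 * M) * si = 1 by rewrite /si; field; rewrite gt_eqF.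
have E1 : M * sg * (2 * M) <= 1.
  rewrite mulrAC; apply: le_trans (_ : M * (2 * M) * si <= _); last by rewrite MM.
  apply: ler_wpM2l sgle.
  by rewrite !mulr_ge0 // ltW.
have E2 : M * sg <= 1 / 2.
  have : M * sg * 2 <= M * sg * (2 * M).
    by apply: ler_wpM2l; [rewrite mulr_ge0 // ltW|rewrite ler_peMr].
  by rewrite ler_pdivlMr // => h; exact: le_trans h E1.
have L1 : 32 * M ^+ 2 / n%:R ^+ 2 <= de.
  rewrite ler_pdivrMr ?exprn_gt0 //; have := hN3 n hn3; rewrite ler_pdivrMr // => /le_trans; apply.
  by rewrite mulrC; apply: ler_wpM2l; [exact: ltW|rewrite expr2 ler_peMr // ltW].
have [L2 L3] : 32 * M ^+ 2 / n%:R ^+ 2 <= eta /\ 32 * M ^+ 2 / n%:R ^+ 2 <= k0 / (16 * ka).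
  by move: L1; rewrite le_min => /andP[].
have L4 : 16 * ka * (32 * M ^+ 2 / n%:R ^+ 2) <= k0.
  by rewrite mulrC -ler_pdivlMr // mulr_gt0.
have pr : 0 < 3 * pi * rho by rewrite !mulr_gt0 // pi_gt0.
have L5 : 2 * r + 1 < 3 * pi * n%:R * rho.
  have := hN4 n hn4; rewrite ler_pdivrMr // => hh.
  apply: lt_le_trans (_ : 2 * M + 2 <= _); first by clear -rM; lra.
  by apply: le_trans hh _; rewrite le_eqVlt; apply/orP; left; apply/eqP; ring.
apply: (eigenvalue_pair iq q0 n0 hrho tI hq hsm E2 E1 rp0 hz ep01 hsec ka1 hka hkb (ltW etap) heta _ L2 L4 L5).
move=> lam m nu hm hD; apply: le_trans (hN1 n hn1 t rho lam m nu hm hrho tI hD) _.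
by rewrite -mulrA; apply: ler_wpM2l => //; exact: ltW.
Qed.
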